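(* Let $p\in(1,2)$, $a\in(0,1/2)$ and $\mu>0$. Let $\lambda_{a,p}(\mu)$ denote the optimal (largest) constant such that \[ \|\psi'-i\,a\,\psi\|_{\mathrm L^2(\mathbb S^1)}^2+\mu\,\|\psi\|_{\mathrm L^p(\mathbb S^1)}^2\ge\lambda_{a,p}(\mu)\,\|\psi\|_{\mathrm L^2(\mathbb S^1)}^2\quad\forall\,\psi\in\mathrm H^1(\mathbb S^1,\mathbb C), \] and consider the inequality for real-valued functions \[ \|u'\|_{\mathrm L^2(\mathbb S^1)}^2+a^2\,\|u^{-1}\|_{\mathrm L^2(\mathbb S^1)}^{-2}+\mu\,\|u\|_{\mathrm L^p(\mathbb S^1)}^2\ge\lambda_{a,p}(\mu)\,\|u\|_{\mathrm L^2(\mathbb S^1)}^2\quad\forall\,u\in\mathrm H^1(\mathbb S^1). \qquad (\ast) \] Then: (i) If $\mu\,(2-p)+4\,a^2\le1$, then $\lambda_{a,p}(\mu)=a^2+\mu$ and equality in $(\ast)$ (for $u\neq0$) is achieved only by the constant functions. (ii) If $\mu\,(2-p)+4\,a^2>1$, then $\lambda_{a,p}(\mu)<a^2+\mu$ and equality in $(\ast)$ is not achieved by the constant functions.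
   Context: $\mathbb S^1$ is identified with $[-\pi,\pi)$ (functions on $\mathbb S^1$ are $2\pi$-periodic functions on $\mathbb R$), equipped with the uniform probability measure $d\sigma=d\theta/(2\pi)$; all norms $\|\cdot\|_{\mathrm L^q(\mathbb S^1)}$ are taken with respect to $d\sigma$. $\mathrm H^1(\mathbb S^1)$ denotes the space of $2\pi$-periodic (real-valued, resp. complex-valued for $\mathrm H^1(\mathbb S^1,\mathbb C)$) continuous functions with derivative in $\mathrm L^2(\mathbb S^1)$. Convention: $\|u^{-1}\|_{\mathrm L^2(\mathbb S^1)}^{-2}=\big(\int_{\mathbb S^1}u^{-2}\,d\sigma\big)^{-1}$, and this quantity is set equal to $0$ if $u^{-2}$ is not integrable (in particular if $u$ vanishes somewhere). *)

(* Defs.v *)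
From HB Require Import structures.
From mathcomp Require Import all_boot all_order all_algebra.
From mathcomp Require Import all_classical all_reals all_analysis.
Set Implicit Arguments. Unset Strict Implicit. Unset Printing Implicit Defensive.
Import Order.TTheory GRing.Theory Num.Theory numFieldNormedType.Exports.
Local Open Scope classical_set_scope.
Local Open Scope ring_scope.

Section S1.
Variable R : realType.
Local Notation leb := (@lebesgue_measure R).

(* integral over S^1 = [-pi,pi) w.r.t. the uniform probability dsigma = dtheta/(2 pi)
   (real-valued; only applied to nonnegative/integrable integrands below) *)
Definition sint (f : R -> R) : R :=
  (2 * pi)^-1 * fine (\int[leb]_(x in `[- pi, pi[%classic) (f x)%:E).

Definition L2sq (f : R -> R) : R := sint (fun x => f x ^+ 2).

Definition Lpsq (p : R) (f : R -> R) : R :=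
  (sint (fun x => `|f x| `^ p)) `^ (2 / p).

(* u : R -> R is a (real) element of H^1(S^1) with (weak) derivative g:
   u is 2pi-periodic, g is locally integrable with g in L^2(S^1), and u is
   the primitive of g (hence u is continuous, absolutely continuous). *)
Definition H1 (u g : R -> R) : Prop :=
  (forall x, u (x + 2 * pi) = u x) /\
  (forall s t, s <= t -> leb.-integrable `[s, t]%classic (fun x => (g x)%:E)) /\
  leb.-integrable `[- pi, pi[%classic (fun x => (g x ^+ 2)%R%:E) /\
  (forall s t, s <= t -> u t - u s = Rintegral leb `[s, t]%classic g).

(* ||u^{-1}||_{L^2}^{-2} = (int u^{-2} dsigma)^{-1}, set to 0 if u^{-2} is
   not integrable (in particular if u vanishes somewhere). *)
Definition invsq_int (u : R -> R) : \bar R :=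
  \int[leb]_(x in `[- pi, pi[%classic) ((u x ^+ 2)^-1)%R%:E.

Definition invL2 (u : R -> R) : R :=
  if `[< exists x, u x = 0 >] then 0 else
  if `[< (invsq_int u < +oo)%E >] then ((2 * pi)^-1 * fine (invsq_int u))^-1
  else 0.

(* complex psi = psi1 + i psi2 with derivative g1 + i g2:
   psi' - i a psi = (g1 + a psi2) + i (g2 - a psi1),  |psi|^2 = psi1^2 + psi2^2 *)
Definition cplx_lhs (a p mu : R) (psi1 g1 psi2 g2 : R -> R) : R :=
  sint (fun x => (g1 x + a * psi2 x) ^+ 2 + (g2 x - a * psi1 x) ^+ 2)
  + mu * (sint (fun x => (psi1 x ^+ 2 + psi2 x ^+ 2) `^ (p / 2))) `^ (2 / p).

Definition cplx_L2sq (psi1 psi2 : R -> R) : R :=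
  sint (fun x => psi1 x ^+ 2 + psi2 x ^+ 2).

Definition lambda_ap (a p mu : R) : R :=
  sup [set c : R | forall psi1 g1 psi2 g2, H1 psi1 g1 -> H1 psi2 g2 ->
         cplx_lhs a p mu psi1 g1 psi2 g2 >= c * cplx_L2sq psi1 psi2].

Definition real_lhs (a p mu : R) (u g : R -> R) : R :=
  L2sq g + a ^+ 2 * invL2 u + mu * Lpsq p u.

End S1.

(* Main.v *)
(* For a positive function u on the circle write u = x + y with x of period pi and y
   antiperiodic under translation by pi. A two-point inequality on (x + y, x - y)
   replaces u by m with m^2 = x^2 + (p - 1) y^2 + ..., at the price of
   (2 - p) times the mean of y^2, which Wirtinger's inequality for antiperiodic
   functions controls. Rescaled to period 2 pi, m has at most half the energy of u, so
   iteration yields Beckner's inequality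
   |u|_2^2 - |u|_p^2 <= (2 - p) |u'|_2^2, and what is lost in the first step gives its
   rigidity. The magnetic term is handled by
   4 |u'|_2^2 + |u^-1|_2^-2 >= |u|_2^2, which is Wirtinger's inequality for
   u e^(i chi) where chi' is proportional to u^-2 and chi grows by pi over a period;
   a phase of winding number n only helps, because |n - a| >= a. Steklov averages pass
   from C^1 to H^1 without increasing the energies. Above the threshold the second
   variation at the constants is negative in the direction cos + 2 a i sin. *)

Require Import Defs.
From HB Require Import structures.
From mathcomp Require Import all_boot all_order all_algebra.
From mathcomp Require Import ring lra.
From mathcomp Require Import all_classical all_reals all_analysis measurable_realfun.
Set Implicit Arguments.
Unset Strict Implicit.
Unset Printing Implicit Defensive.
Import Order.TTheory GRing.Theory Num.Theory numFieldNormedType.Exports.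
Local Open Scope classical_set_scope.
Local Open Scope ring_scope.

(** With [m^2 = x^2 + k y^2] alone the fold would not close up: Wirtinger's inequality for [y] uses
    all of [y'^2], and nothing remains to pay for the share of [y'] in [m']. For small [t = y / x]
    the quartic correction replaces [y'^2] by about [y'^2 - (2/3) k^2 t^2 y'^2], and this gain
    exceeds the cost [k^2 t^2 y'^2 / 4] and the cross terms. A margin is left in both [x'^2] and
    [t^2 y'^2]; it is recorded as the deficit. The threshold appears because two estimates draw on
    the energy of the modulus: the inverse-square term takes the fraction [4 a^2], the entropy takes
    [mu (2 - p)], and both are affordable when the sum is at most 1. The fold needs a positive C^1
    function, whereas an extremal is only H^1 and might vanish. No regularity of extremals is
    proved: all estimates are quantitative, hold for regularized moduli with errors of order [e],
    and rigidity is read off from a deficit bounded by [C e]. *)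

Definition deriv_of (R : realType) (f f' : R -> R) : Prop :=
  forall x, is_derive x (1 : R) f (f' x).

(** * Rules for derivatives and continuity, with the tactics that apply them *)

Section Derivatives.
Variable R : realType.
Implicit Types (f g : R -> R) (x c : R).

Lemma isd_eq f x a b : is_derive x (1 : R) f a -> a = b -> is_derive x (1 : R) f b.
Proof. by move=> + <-. Qed.

Lemma isdC c x : is_derive x (1 : R) (fun _ : R => c) 0.
Proof. exact: is_derive_cst. Qed.

Lemma isdI x : is_derive x (1 : R) (fun y : R => y) 1.
Proof. exact: is_derive_id. Qed.

Lemma isdD f g x a b : is_derive x (1 : R) f a -> is_derive x (1 : R) g b ->
  is_derive x (1 : R) (fun y => f y + g y) (a + b).
Proof. by move=> *; exact: is_deriveD. Qed.

Lemma isdN f x a : is_derive x (1 : R) f a -> is_derive x (1 : R) (fun y => - f y) (- a).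
Proof. by move=> *; exact: is_deriveN. Qed.

Lemma isdM f g x a b : is_derive x (1 : R) f a -> is_derive x (1 : R) g b ->
  is_derive x (1 : R) (fun y => f y * g y) (a * g x + f x * b).
Proof.
move=> fa gb; apply: (isd_eq (is_deriveM fa gb)).
by rewrite /GRing.scale/=; ring.
Qed.

Lemma isdX f x a n : is_derive x (1 : R) f a ->
  is_derive x (1 : R) (fun y => f y ^+ n) (n%:R * f x ^+ n.-1 * a).
Proof.
move=> fa; have -> : (fun y => f y ^+ n) = f ^+ n by rewrite exprfctE.
exact: (is_deriveX n fa).
Qed.

Lemma isdV f x a : f x != 0 -> is_derive x (1 : R) f a ->
  is_derive x (1 : R) (fun y => (f y)^-1) (- a / f x ^+ 2).
Proof.
move=> f0 fa; apply: isd_eq (is_deriveV f0 fa) _.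
by rewrite /GRing.scale/=; field.
Qed.

Lemma isd_comp f g x a b : is_derive (g x) (1 : R) f a -> is_derive x (1 : R) g b ->
  is_derive x (1 : R) (fun y => f (g y)) (a * b).
Proof. exact: is_derive1_comp. Qed.

Lemma isd_of {f f' g x b} : deriv_of f f' -> is_derive x (1 : R) g b ->
  is_derive x (1 : R) (fun y => f (g y)) (f' (g x) * b).
Proof. by move=> ff; exact: isd_comp. Qed.

Lemma isd_sin : deriv_of (@sin R) cos.
Proof. by move=> x; exact: is_derive_sin. Qed.

Lemma isd_cos : deriv_of (@cos R) (fun x => - sin x).
Proof. by move=> x; exact: is_derive_cos. Qed.

Lemma isd_exp : deriv_of (@expR R) (@expR R).
Proof. by move=> x; exact: is_derive_expR. Qed.

Lemma isd_ln f x a : 0 < f x -> is_derive x (1 : R) f a ->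
  is_derive x (1 : R) (fun y => ln (f y)) (a / f x).
Proof.
move=> f0 fa; rewrite mulrC.
exact: (isd_comp (is_derive1_ln f0) fa).
Qed.

Lemma isd_sqrt f x a : 0 < f x -> is_derive x (1 : R) f a ->
  is_derive x (1 : R) (fun y => Num.sqrt (f y)) (a / (2 * Num.sqrt (f x))).
Proof.
move=> f0 fa; rewrite mulrC.
exact: (isd_comp (is_derive1_sqrt f0) fa).
Qed.

Lemma isd_powR f x a p : 0 < f x -> is_derive x (1 : R) f a ->
  is_derive x (1 : R) (fun y => f y `^ p) (p * f x `^ (p - 1) * a).
Proof.
by move=> f0 fa; exact: (isd_comp (is_derive1_powR p f0) fa).
Qed.

Lemma isd_continuous f x a : is_derive x (1 : R) f a -> {for x, continuous f}.
Proof.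
by case=> df _; exact/differentiable_continuous/derivable1_diffP.
Qed.

Lemma deriv_of_continuous {f f'} : deriv_of f f' -> continuous f.
Proof. by move=> ff x; exact: isd_continuous (ff x). Qed.

Lemma nondecreasing_of_deriv f (f' : R -> R) a b : a <= b ->
  (forall x, a <= x <= b -> is_derive x (1 : R) f (f' x)) ->
  (forall x, a <= x <= b -> 0 <= f' x) -> f a <= f b.
Proof.
move=> ab df f'0.
have [||c cab E] := @MVT_segment R f f' a b ab; last 1 first.
- rewrite -subr_ge0 E mulr_ge0 ?subr_ge0 //.
  by apply: f'0; move: cab; rewrite in_itv.
- by move=> x xab; apply: df; move: xab; rewrite in_itv /= => /andP[/ltW -> /ltW ->].
apply: derivable_within_continuous => x xab.
by have [] := df x; [move: xab; rewrite in_itv|].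
Qed.

Lemma le_of_deriv f g (f' g' : R -> R) a b : a <= b ->
  (forall x, is_derive x (1 : R) f (f' x)) -> (forall x, is_derive x (1 : R) g (g' x)) ->
  (forall x, a <= x <= b -> f' x <= g' x) -> f b - f a <= g b - g a.
Proof.
move=> ab df dg fg.
have := @nondecreasing_of_deriv (fun x => g x - f x) (fun x => g' x - f' x) a b ab.
have d x : is_derive x (1 : R) (fun x => g x - f x) (g' x - f' x).
  by apply: isdD => //; exact: isdN.
move=> /(_ (fun x _ => d x)) H.
have {}H : g a - f a <= g b - f b.
  by apply: H => x xab; rewrite subr_ge0 fg.
by lra.
Qed.

Lemma eq_of_deriv f g (f' : R -> R) a b :
  (forall x, is_derive x (1 : R) f (f' x)) -> (forall x, is_derive x (1 : R) g (f' x)) ->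
  f b - f a = g b - g a.
Proof.
move=> df dg; wlog ab : a b / a <= b => [H|].
  have [/H//|/ltW/H E] := leP a b.
  by apply: oppr_inj; rewrite !opprB.
by apply/eqP; rewrite eq_le !(@le_of_deriv _ _ f' f').
Qed.

End Derivatives.
Arguments isd_of {R f f' g x b}.

(** The derivative is an existential variable, filled in by following the shape of the function.
    [derive] then leaves the side conditions and the comparison with the expected derivative. The
    constant rule comes first, so that terms free of the variable are not taken apart. *)
Ltac isd1 :=
  match goal with
  | |- is_derive _ _ (fun _ => ?c) _ => eapply isdC
  | |- is_derive _ _ (fun y => y) _ => eapply isdI
  | H : deriv_of ?f _ |- is_derive _ _ ?f _ => exact (H _)
  | H : deriv_of ?f _ |- is_derive _ _ (fun y => ?f y) _ => exact (H _)
  | H : deriv_of ?f _ |- is_derive _ _ (fun y => ?f (@?g y)) _ => eapply (isd_of H)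
  | |- is_derive _ _ (fun y => @?f y + @?g y) _ => eapply isdD
  | |- is_derive _ _ (fun y => - @?f y) _ => eapply isdN
  | |- is_derive _ _ (fun y => @?f y * @?g y) _ => eapply isdM
  | |- is_derive _ _ (fun y => @?f y ^+ _) _ => eapply isdX
  | |- is_derive _ _ (fun y => (@?f y)^-1) _ => eapply isdV
  | |- is_derive _ _ (fun y => sin (@?f y)) _ => eapply (isd_of (@isd_sin _))
  | |- is_derive _ _ (fun y => cos (@?f y)) _ => eapply (isd_of (@isd_cos _))
  | |- is_derive _ _ (fun y => expR (@?f y)) _ => eapply (isd_of (@isd_exp _))
  | |- is_derive _ _ (fun y => ln (@?f y)) _ => eapply isd_ln
  | |- is_derive _ _ (fun y => Num.sqrt (@?f y)) _ => eapply isd_sqrt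
  | |- is_derive _ _ (fun y => (@?f y) `^ _) _ => eapply isd_powR
  | |- is_derive _ _ (GRing.mul ?c) _ => eapply (isdM (isdC c _) (isdI _))
  | |- is_derive _ _ (GRing.add ?c) _ => eapply (isdD (isdC c _) (isdI _))
  | |- is_derive _ _ GRing.opp _ => eapply (isdN (isdI _))
  | |- is_derive _ _ sin _ => eapply isd_sin
  | |- is_derive _ _ cos _ => eapply isd_cos
  | |- is_derive _ _ expR _ => eapply isd_exp
  end.
Ltac isd := repeat isd1.

Ltac derive := eapply isd_eq; [isd | rewrite /=].

Section Continuity.
Variable R : realType.
Implicit Types (f g : R -> R) (x c : R).

Lemma ctsC c : continuous (fun _ : R => c).
Proof. by move=> x; exact: cvg_cst. Qed.

Lemma ctsI : continuous (fun x : R => x).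
Proof. by move=> x; exact: cvg_id. Qed.

Lemma ctsD f g : continuous f -> continuous g -> continuous (fun x => f x + g x).
Proof. by move=> cf cg x; apply: continuousD; [exact: cf|exact: cg]. Qed.

Lemma ctsN f : continuous f -> continuous (fun x => - f x).
Proof. by move=> cf x; apply: continuousN; exact: cf. Qed.

Lemma ctsM f g : continuous f -> continuous g -> continuous (fun x => f x * g x).
Proof. by move=> cf cg x; apply: continuousM; [exact: cf|exact: cg]. Qed.

Lemma cts_comp f g : continuous f -> continuous g -> continuous (fun x => f (g x)).
Proof. by move=> cf cg x; apply: continuous_comp; [exact: cg|exact: cf]. Qed.

Lemma ctsX f n : continuous f -> continuous (fun x => f x ^+ n).
Proof. by move=> cf; apply: (cts_comp (@exprn_continuous R n) cf). Qed.

Lemma ctsV f : (forall x, f x != 0) -> continuous f ->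
  continuous (fun x => (f x)^-1).
Proof. by move=> f0 cf x; apply: continuousV => //; exact: cf. Qed.

Lemma cts_norm f : continuous f -> continuous (fun x => `|f x|).
Proof. by move=> cf x; apply: (continuous_comp (cf x)); exact: norm_continuous. Qed.

Lemma cts_sqrt f : continuous f -> continuous (fun x => Num.sqrt (f x)).
Proof. by move=> cf; exact: (cts_comp (@sqrt_continuous R)). Qed.

Lemma cts_powR f p : 0 < p -> (forall x, 0 <= f x) -> continuous f ->
  continuous (fun x => f x `^ p).
Proof.
move=> p0 f0 cf x; have := f0 x; rewrite le_eqVlt => /predU1P[fx0|fx0].
  (* At a zero of [f] the power need not be differentiable; there [f t < e^(1/p)] near [x] gives the
     bound directly. *)
  rewrite /continuous_at -fx0 powR0 ?gt_eqF //.
  apply/cvgrPdist_lt => e e0.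
  have /cvgrPdist_lt/(_ (e `^ p^-1)) H := cf x.
  have {}H : \forall t \near x, f t < e `^ p^-1.
    have /H : 0 < e `^ p^-1 by exact: powR_gt0.
    by apply: filterS => t; rewrite -fx0 sub0r normrN ger0_norm.
  near=> t.
  rewrite sub0r normrN ger0_norm ?powR_ge0 //.
  have ft : f t < e `^ p^-1 by near: t.
  have : f t `^ p < (e `^ p^-1) `^ p by apply: gt0_ltr_powR; rewrite // nnegrE ?powR_ge0.
  by rewrite -powRrM mulVf ?gt_eqF // powRr1 // ltW.
have c1 : {for f x, continuous (fun a => a `^ p)}.
  exact: isd_continuous (is_derive1_powR p fx0).
exact: (continuous_comp (cf x) c1).
Unshelve. all: by end_near. Qed.

End Continuity.

Ltac cts1 :=
  match goal with
  | |- continuous (fun _ => ?c) => exact: ctsC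
  | |- continuous (fun y => y) => exact: ctsI
  | H : continuous ?f |- continuous ?f => exact: H
  | H : deriv_of ?f _ |- continuous ?f => exact: (deriv_of_continuous H)
  | |- continuous (fun y => @?f y + @?g y) => apply: ctsD
  | |- continuous (fun y => - @?f y) => apply: ctsN
  | |- continuous (fun y => @?f y * @?g y) => apply: ctsM
  | |- continuous (fun y => @?f y ^+ _) => apply: ctsX
  | |- continuous (fun y => (@?f y)^-1) => apply: ctsV
  | |- continuous (fun y => `|@?f y|) => apply: cts_norm
  | |- continuous (GRing.mul ?c) => apply: (ctsM (@ctsC _ c) (@ctsI _))
  | |- continuous (GRing.add ?c) => apply: (ctsD (@ctsC _ c) (@ctsI _))
  | |- continuous GRing.opp => apply: (ctsN (@ctsI _))
  | |- continuous (fun y => sin (@?f y)) => apply: (cts_comp (@continuous_sin _))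
  | |- continuous (fun y => cos (@?f y)) => apply: (cts_comp (@continuous_cos _))
  | |- continuous (fun y => expR (@?f y)) => apply: (cts_comp (@continuous_expR _))
  | |- continuous (fun y => Num.sqrt (@?f y)) => apply: cts_sqrt
  | |- continuous (fun y => (@?f y) `^ _) => apply: cts_powR
  | H : continuous ?f |- continuous (fun y => ?f (@?g y)) => apply: (cts_comp H)
  | H : deriv_of ?f _ |- continuous (fun y => ?f (@?g y)) =>
      apply: (cts_comp (deriv_of_continuous H))
  end.
Ltac cts := repeat cts1.

(** * Primitives of continuous functions and means over the circle *)

Section Primitive.
Variable R : realType.
Local Notation leb := (@lebesgue_measure R).
Implicit Types (f g F G : R -> R).

Lemma integrable_cts f a b : continuous f -> leb.-integrable `[a, b] (EFin \o f).
Proof.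
move=> cf; apply: continuous_compact_integrable; first exact: segment_compact.
exact: continuous_subspaceT.
Qed.

(** The fundamental theorem of calculus concerns integrals from a fixed base point. To cover the
    whole line the base point [N x] moves to the left with [x], and subtracting the value at 0 makes
    the result independent of it. *)
Lemma ex_primitive f : continuous f -> exists F, deriv_of F f.
Proof.
move=> cf; pose J a x := \int[leb]_(t in `[a, x]) f t.
have JB (a b x : R) : a <= b -> b <= x -> J a x - J a b = J b x.
  move=> ab bx; rewrite /J Rintegral_itvB ?bnd_simp //; last exact: integrable_cts.
  rewrite Rintegral_itv_obnd_cbnd //.
  apply: integrableS (integrable_cts b x cf) => //.
  by apply: subset_itvr; rewrite bnd_simp.
have dJ (a x : R) : a < x -> is_derive x (1 : R) (J a) (f x).
  move=> ax; have xx : x < x + 1 by rewrite ltrDl.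
  have [d e] := continuous_FTC1_closed xx (integrable_cts a (x + 1) cf) ax (cf x).
  by apply: DeriveDef; [exact: d|rewrite -derive1E; exact: e].
pose N (x : R) := - (`|x| + 1).
exists (fun x => J (N x) x - J (N x) 0) => x.
have E (a y : R) : a <= N y -> J (N y) y - J (N y) 0 = J a y - J a 0.
  move=> aN.
  have N0 : N y <= 0 by rewrite oppr_le0 addr_ge0.
  have Ny : N y <= y.
    by rewrite /N lerNl; have := ler_norm (- y); rewrite normrN; lra.
  by rewrite -(JB a (N y) y) // -(JB a (N y) 0) //; ring.
pose a := - (`|x| + 3).
apply: (@near_eq_is_derive _ _ _ (fun y => J a y - J a 0)).
- near=> y; apply/esym/E; rewrite /a /N lerN2.
  have : `|x - y| < 1.
    by near: y; apply: (@cvgr_dist_lt _ _ _ _ _ (@id R)) => //; exact: cvg_id.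
  move=> xy; have := ler_normB x (x - y); rewrite subKr => h.
  rewrite (le_trans (lerD h (lexx 1))) //; lra.
- have ax : a < x by rewrite /a; have := ler_norm (- x); rewrite normrN; lra.
  have dJa : is_derive x (1 : R) (J a) (f x) := dJ _ _ ax.
  by apply: isd_eq (isdD dJa (isdN (isdC (J a 0) x))) _; rewrite subr0.
Unshelve. all: by end_near. Qed.

Lemma Rintegral_deriv F f a b : a <= b -> continuous f -> deriv_of F f ->
  \int[leb]_(x in `[a, b]) f x = F b - F a.
Proof.
rewrite le_eqVlt => /predU1P[<- _ _|ab cf dF]; first by rewrite set_itv1 Rintegral_set1 subrr.
rewrite /Rintegral (@continuous_FTC2 R f F a b) //.
- exact: continuous_subspaceT.
- have cF := deriv_of_continuous dF.
  split=> [x _||]; first by have [] := dF x.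
  + exact/cvg_at_right_filter/cF.
  + exact/cvg_at_left_filter/cF.
- by move=> x _; rewrite derive1E; have [_ ->] := dF x.
Qed.

(** The gateway from Lebesgue integrals to calculus: for continuous integrands, linearity,
    monotonicity and translation of [sint] are all obtained by comparing primitives. *)
Lemma sint_deriv F f : continuous f -> deriv_of F f ->
  sint f = (2 * pi)^-1 * (F pi - F (- pi)).
Proof.
move=> cf dF; have pipi : - pi <= pi :> R by rewrite ge0_cp ?pi_ge0.
rewrite /sint -(Rintegral_deriv pipi cf dF); congr (_ * _).
apply: Rintegral_itv_bndo_bndc.
apply: integrableS (integrable_cts (- pi) pi cf) => //.
by apply: subset_itvl; rewrite bnd_simp.
Qed.

End Primitive.

(* [lra] unfolds [pi] and compares the integrands when it collects atoms. *)
Ltac sint_lra :=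
  repeat match goal with
  | |- context [sint ?f] => generalize (sint f); intro
  | |- context [@pi ?R] => generalize (@pi R); intro
  end; clear; lra.

Section CircleMean.
Variable R : realType.
Implicit Types (f g h F G : R -> R).

Lemma twopi_gt0 : 0 < 2 * pi :> R.
Proof. by rewrite mulr_gt0 ?pi_gt0. Qed.

Lemma le_Npi_pi : - pi <= pi :> R.
Proof. by rewrite ge0_cp ?pi_ge0. Qed.

Lemma eq_sint f g : f =1 g -> sint f = sint g.
Proof. by move=> /funext ->. Qed.

Lemma sintD f g : continuous f -> continuous g ->
  sint (fun x => f x + g x) = sint f + sint g.
Proof.
move=> cf cg; have [[F dF] [G dG]] := (ex_primitive cf, ex_primitive cg).
rewrite (sint_deriv cf dF) (sint_deriv cg dG).
rewrite (@sint_deriv _ (fun x => F x + G x)); [by ring|by cts|].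
by move=> x; isd.
Qed.

Lemma sintZ c f : continuous f -> sint (fun x => c * f x) = c * sint f.
Proof.
move=> cf; have [F dF] := ex_primitive cf.
rewrite (sint_deriv cf dF) (@sint_deriv _ (fun x => c * F x)); [by ring|by cts|].
by move=> x; derive; ring.
Qed.

Lemma sintB f g : continuous f -> continuous g ->
  sint (fun x => f x - g x) = sint f - sint g.
Proof.
move=> cf cg; rewrite sintD //; last by cts.
congr (_ + _); rewrite -mulN1r -sintZ //.
by apply: eq_sint => x; rewrite mulN1r.
Qed.

Lemma sint_cst c : sint (fun _ : R => c) = c.
Proof.
rewrite (@sint_deriv _ (fun x => c * x)); [|exact: ctsC|by move=> x; derive; ring].
by move: (@pi R) (pi_gt0 R) => q q0; field; rewrite gt_eqF.
Qed.

Lemma le_sint f g : continuous f -> continuous g ->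
  (forall x, - pi <= x <= pi -> f x <= g x) -> sint f <= sint g.
Proof.
move=> cf cg fg; have [[F dF] [G dG]] := (ex_primitive cf, ex_primitive cg).
rewrite (sint_deriv cf dF) (sint_deriv cg dG).
rewrite ler_pM2l ?invr_gt0 ?twopi_gt0 //.
exact: (le_of_deriv le_Npi_pi dF dG fg).
Qed.

Lemma sint_ge0 f : continuous f -> (forall x, 0 <= f x) -> 0 <= sint f.
Proof.
move=> cf f0; rewrite -(sint_cst 0); by apply: le_sint => [||x _] //; exact: ctsC.
Qed.

Lemma sint_gt0 f : continuous f -> (forall x, 0 < f x) -> 0 < sint f.
Proof.
move=> cf f0.
have [c _ cmin] := @EVT_min R f (- pi) pi le_Npi_pi (continuous_subspaceT cf).
apply: (lt_le_trans (f0 c)); rewrite -[leLHS]sint_cst.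
apply: le_sint => [||x xpi]; [exact: ctsC|exact: cf|].
by apply: cmin; rewrite in_itv.
Qed.

Lemma sint_deriv_periodic F f : continuous f -> deriv_of F f ->
  (forall x, F (x + 2 * pi) = F x) -> sint f = 0.
Proof.
move=> cf dF Fp; rewrite (sint_deriv cf dF).
have E : pi = - pi + 2 * pi :> R by ring.
by have := Fp (- pi); rewrite -E => ->; rewrite subrr mulr0.
Qed.

Lemma primitive_periodic F f T : deriv_of F f -> (forall x, f (x + T) = f x) ->
  forall x y, F (x + T) - F x = F (y + T) - F y.
Proof.
move=> dF fT x y.
have := @eq_of_deriv R (fun z => F (z + T)) F f x y.
have d : deriv_of (fun z => F (z + T)) f by move=> z; derive; rewrite fT; ring.
by move=> /(_ d dF) E; lra.
Qed.

Lemma sint_deriv_from F f s : continuous f -> deriv_of F f ->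
  (forall x, f (x + 2 * pi) = f x) ->
  F (s + 2 * pi) - F s = 2 * pi * sint f.
Proof.
move=> cf dF fp; rewrite (sint_deriv cf dF) mulrA divff ?gt_eqF ?twopi_gt0 // mul1r.
by rewrite (primitive_periodic dF fp s (- pi)); congr (F _ - _); ring.
Qed.

Lemma sint_shift f c : continuous f -> (forall x, f (x + 2 * pi) = f x) ->
  sint (fun x => f (x + c)) = sint f.
Proof.
move=> cf fp; have [F dF] := ex_primitive cf.
rewrite (@sint_deriv _ (fun x => F (x + c))); [|by cts|by move=> x; derive; ring].
have -> : pi + c = (- pi + c) + 2 * pi by ring.
rewrite (sint_deriv_from _ cf dF fp) mulrA mulVf ?mul1r //.
by rewrite gt_eqF ?twopi_gt0.
Qed.

(** This carries the mass, the [p]-norm and the energy of the fold, which has period pi, over to its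
    rescaling to period 2 pi. *)
Lemma sint_half f : continuous f -> (forall x, f (x + pi) = f x) ->
  sint (fun x => f (x / 2)) = sint f.
Proof.
move=> cf fp; have [F dF] := ex_primitive cf.
rewrite (sint_deriv cf dF) (@sint_deriv _ (fun x => 2 * F (x / 2))); first last.
- by move=> x; derive; field.
- by apply: (cts_comp cf); cts.
have E1 := primitive_periodic dF fp (- pi / 2) 0.
have E2 := primitive_periodic dF fp (- pi) 0.
move: E1 E2; rewrite add0r addNr (_ : - pi / 2 + pi = pi / 2); last by field.
by move=> E1 E2; congr (_ * _); lra.
Qed.

Lemma discriminant_le (A B C : R) : 0 <= C ->
  (forall t, 0 <= A + 2 * t * B + t ^+ 2 * C) -> B ^+ 2 <= A * C.
Proof.
rewrite le_eqVlt => /predU1P[<- H|C0 H].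
  have [->|B0] := eqVneq B 0; first by rewrite expr0n mulr0.
  have A0 := H 0; rewrite mulr0 mul0r expr0n mul0r !addr0 in A0.
  (* For [C = 0] the polynomial is affine in [t], and this [t] gives it the value -1. *)
  have := H (- (A + 1) / (2 * B)).
  by rewrite (_ : _ + _ + _ = - 1); [lra|field].
have := H (- B / C); rewrite (_ : _ + _ + _ = (A * C - B ^+ 2) / C).
  by rewrite pmulr_lge0 ?invr_gt0 // subr_ge0.
by field; rewrite gt_eqF.
Qed.

Lemma sint_cauchy_schwarz f g : continuous f -> continuous g ->
  sint (fun x => f x * g x) ^+ 2 <=
  sint (fun x => f x ^+ 2) * sint (fun x => g x ^+ 2).
Proof.
move=> cf cg; apply: discriminant_le.
  by apply: sint_ge0 => [|x]; [cts|exact: sqr_ge0].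
move=> t; rewrite -sintZ; last by cts.
rewrite -sintZ; last by cts.
rewrite -sintD; [|by cts|by cts].
rewrite -sintD; [|by cts|by cts].
apply: sint_ge0; [by cts|move=> x].
by rewrite (_ : _ + _ = (f x + t * g x) ^+ 2) ?sqr_ge0 //; ring.
Qed.

Lemma sqr_incr_le h (h' G : R -> R) a b : deriv_of h h' ->
  deriv_of G (fun x => h' x ^+ 2) -> a <= b ->
  (h b - h a) ^+ 2 <= (b - a) * (G b - G a).
Proof.
move=> dh dG ab; rewrite mulrC; apply: discriminant_le; first by rewrite subr_ge0.
move=> t.
have d : deriv_of (fun x => G x + 2 * t * h x + t ^+ 2 * x) (fun x => (h' x + t) ^+ 2).
  by move=> x; derive; ring.
have := @nondecreasing_of_deriv _ _ _ a b ab (fun x _ => d x) (fun x _ => sqr_ge0 _).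
by rewrite -subr_ge0 => h0; apply: (le_trans h0); rewrite le_eqVlt; apply/orP; left; apply/eqP; ring.
Qed.

Lemma sqr_osc_le h (h' : R -> R) x : deriv_of h h' -> continuous h' ->
  - pi <= x <= pi ->
  (h x - h (- pi)) ^+ 2 <= (2 * pi) ^+ 2 * sint (fun x => h' x ^+ 2).
Proof.
move=> dh ch' /andP[x0 x1].
have c2 : continuous (fun x => h' x ^+ 2) by cts.
have [G dG] := ex_primitive c2.
apply: (le_trans (sqr_incr_le dh dG x0)).
rewrite expr2 -mulrA.
have -> : 2 * pi * sint (fun x => h' x ^+ 2) = G pi - G (- pi).
  by rewrite (sint_deriv c2 dG) mulrA divff ?mul1r // gt_eqF ?twopi_gt0.
have Gx : G x <= G pi.
  by apply: (nondecreasing_of_deriv x1 (fun y _ => dG y)) => y _; exact: sqr_ge0.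
have G0 : G (- pi) <= G x.
  by apply: (nondecreasing_of_deriv x0 (fun y _ => dG y)) => y _; exact: sqr_ge0.
by apply: ler_pM; rewrite ?subr_ge0 //; lra.
Qed.

Lemma sint_variance_le f c : continuous f ->
  sint (fun x => f x ^+ 2) - sint f ^+ 2 <= sint (fun x => (f x - c) ^+ 2).
Proof.
move=> cf.
rewrite [leRHS](@eq_sint _ (fun x => f x ^+ 2 + (- (2 * c) * f x + c ^+ 2)));
  last by move=> x; ring.
rewrite sintD; [|by cts|by cts]; rewrite sintD; [|by cts|by cts].
rewrite sintZ // sint_cst.
by have := sqr_ge0 (sint f - c); lra.
Qed.

End CircleMean.

(** * The two-point inequality *)

Section TwoPoint.
Variable R : realType.
Implicit Types k t : R.

(* [s] is the Taylor polynomial of [tanh (k * atanh t)], a lower bound of it. *)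
Lemma artanh_lower k t : 0 < k < 1 -> 0 <= t < 1 ->
  let s := k * t + k * (1 - k ^+ 2) / 3 * t ^+ 3 in
  s < 1 /\ ln (1 + s) - ln (1 - s) <= k * (ln (1 + t) - ln (1 - t)).
Proof.
move=> /andP[k0 k1] /andP[t0 t1] s.
pose b := k * (1 - k ^+ 2) / 3.
have k2 : k ^+ 2 < 1 by rewrite expr_lt1 // ltW.
have b0 : 0 <= b by rewrite divr_ge0 // mulr_ge0 ?subr_ge0 // ltW.
have b1 : b <= (1 - k ^+ 2) / 3.
  by rewrite ler_wpM2r // ler_piMl ?subr_ge0 // ltW.
have kb1 : k + b < 1.
  have : 0 < (1 - k) * (3 - k - k ^+ 2) by rewrite mulr_gt0 ?subr_gt0 //; nra.
  by rewrite /b; lra.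
pose S x := k * x + b * x ^+ 3.
have S0 x : 0 <= x -> 0 <= S x 
  by move=> x0; rewrite addr_ge0 //; apply: mulr_ge0; rewrite ?exprn_ge0 ?(ltW k0).
have Sle x : 0 <= x <= 1 -> S x <= (k + b) * x.
  move=> /andP[x0 x1]; have : x ^+ 3 <= x by rewrite -[leRHS]mulr1 exprS ler_wpM2l // expr_le1.
  by rewrite /S; nra.
have S1 x : 0 <= x <= 1 -> S x < 1.
  move=> x01; apply: (le_lt_trans (Sle _ x01)); apply: le_lt_trans kb1.
  by case/andP: x01 => _ x1; rewrite ler_piMr // addr_ge0 // ltW.
split; first by apply: S1; lra.
pose h x := k * (ln (1 + x) - ln (1 - x)) - (ln (1 + S x) - ln (1 - S x)).
pose h' x := k * (1 / (1 + x) + 1 / (1 - x)) -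
  (k + 3 * b * x ^+ 2) * (1 / (1 + S x) + 1 / (1 - S x)).
suff : h 0 <= h t.
  rewrite /h /S expr0n /= !mulr0 !addr0 subr0 ln1 !subrr mulr0 subrr.
  by rewrite subr_ge0.
apply: (@nondecreasing_of_deriv _ h h' _ _ t0) => x /andP[x0 xt].
  have x1 : x < 1 by lra.
  have Sx0 := S0 x x0.
  have Sx1 : S x < 1 by apply: S1; lra.
  have dS : is_derive x (1 : R) S (k + 3 * b * x ^+ 2).
    by rewrite /S; derive; ring.
  have d1 : is_derive x (1 : R) (fun y : R => ln (1 + y)) (1 / (1 + x)).
    by derive; [lra|congr (_ / _); ring].
  have d2 : is_derive x (1 : R) (fun y : R => ln (1 - y)) (- 1 / (1 - x)).
    by derive; [lra|congr (_ / _); ring].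
  have d3 := isd_ln _ (isdD (isdC 1 x) dS).
  have d4 := isd_ln _ (isdD (isdC 1 x) (isdN dS)).
  have {}d3 := d3 ltac:(lra).
  have {}d4 := d4 ltac:(lra).
  apply: isd_eq (isdD (isdM (isdC k x) (isdD d1 (isdN d2))) (isdN (isdD d3 (isdN d4)))) _.
  by rewrite /h' /=; field; apply/and4P; split; rewrite gt_eqF //; lra.
have x1 : x < 1 by lra.
have Sx0 := S0 x x0.
have Sx1 : S x < 1 by apply: S1; lra.
have -> : h' x = 2 * (k * (1 - S x ^+ 2) - (k + 3 * b * x ^+ 2) * (1 - x ^+ 2))
    / ((1 - x ^+ 2) * (1 - S x ^+ 2)).
  rewrite /h'; field; apply/and5P; split; rewrite ?gt_eqF //; nra.
rewrite divr_ge0 //; last by rewrite mulr_ge0 //; nra.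
rewrite mulr_ge0 // subr_ge0.
have -> : 3 * b = k * (1 - k ^+ 2) by rewrite /b; field.
(* Since [S' = k + k (1 - k^2) x^2], the difference [k (1 - S^2) - S' (1 - x^2)] is exactly [k]
   times the right side of [key] minus [S^2]. *)
have key : S x ^+ 2 <= k ^+ 2 * x ^+ 2 + (1 - k ^+ 2) * x ^+ 4.
  have -> : S x ^+ 2 = k ^+ 2 * x ^+ 2 + (2 * k * b + b ^+ 2 * x ^+ 2) * x ^+ 4.
    by rewrite /S; ring.
  rewrite lerD2l ler_wpM2r ?exprn_ge0 //.
  have x2 : x ^+ 2 <= 1 by rewrite expr_le1 // ltW.
  have : b ^+ 2 * x ^+ 2 <= b ^+ 2 by rewrite ler_piMr ?sqr_ge0.
  nra.
nra.
Qed.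

End TwoPoint.

(* The two coefficients are calibrated so that [x^2 + y^2 - m^2 = (1 - k) W^2] for
   [m^2 = x^2 + k y^2 + c y^4 / x^2] and [W^2 = y^2 - beta y^4 / x^2]; the quartic
   terms pay for the derivative of [m] in the contraction estimate. *)
Definition bk (R : realType) (k : R) : R := 2 * k ^+ 2 / 9.
Definition ck (R : realType) (k : R) : R := (1 - k) * bk k.

Section TwoPointInequality.
Variable R : realType.
Implicit Types k t : R.

(** Equality holds at [t = 0], so it is enough to compare logarithmic derivatives. In these the
    quotient [(A - B) / (A + B)] is [tanh (k * artanh x)], and [artanh_lower] reduces the claim to a
    polynomial inequality. *)
Lemma two_point_ge0 k t : 0 < k < 1 -> 0 <= t < 1 ->
  (1 + k * t ^+ 2 + ck k * t ^+ 4) `^ ((k + 1) / 2) <=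
  ((1 + t) `^ (k + 1) + (1 - t) `^ (k + 1)) / 2.
Proof.
move=> k01 /andP[t0 t1]; have /andP[k0 k1] := k01.
set p := k + 1; have p0 : 0 < p by rewrite addr_gt0.
have c0 : 0 <= ck k.
  by rewrite /ck /bk; apply: mulr_ge0; [lra|rewrite divr_ge0 // mulr_ge0 // sqr_ge0].
pose M x : R := 1 + k * x ^+ 2 + ck k * x ^+ 4.
have M1 x : 1 <= M x.
  by rewrite /M -addrA lerDl addr_ge0 // mulr_ge0 ?exprn_even_ge0 // ltW.
pose N x := (1 + x) `^ p + (1 - x) `^ p.
have N0 x : -1 < x < 1 -> 0 < N x.
  by move=> x1; rewrite /N addr_gt0 // powR_gt0 //; lra.
pose g x := 2 / p * ln (N x) - ln (M x).
pose A x := (1 + x) `^ k.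
pose B x := (1 - x) `^ k.
pose g' x := 2 * (A x - B x) / N x - (2 * k * x + 4 * ck k * x ^+ 3) / M x.
have NE x : -1 < x < 1 -> N x = A x * (1 + x) + B x * (1 - x).
  move=> x1; rewrite /N /p !powRD; last 2 first.
  - by apply/implyP => _; rewrite gt_eqF //; lra.
  - by apply/implyP => _; rewrite gt_eqF //; lra.
  by rewrite !powRr1 //; lra.
have : g 0 <= g t.
  apply: (@nondecreasing_of_deriv _ g g' _ _ t0) => x /andP[x0 xt].
    have x1 : -1 < x < 1 by lra.
    have dN : is_derive x (1 : R) N (p * (A x - B x)).
      rewrite /N; derive; [lra|lra|].
      by rewrite /p addrK -/(A x) -/(B x); ring.
    have d1 := isd_ln (N0 x x1) dN.
    have dM : is_derive x (1 : R) M (2 * k * x + 4 * ck k * x ^+ 3).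
      by rewrite /M; derive; ring.
    have d2 := isd_ln (lt_le_trans ltr01 (M1 x)) dM.
    rewrite /g; apply: isd_eq (isdD (isdM (isdC _ x) d1) (isdN d2)) _.
    have n0 := N0 _ x1; have m0 := M1 x.
    rewrite /g'; field; rewrite !gt_eqF //; lra.
  have x1 : -1 < x < 1 by lra.
  have A0 : 0 < A x by rewrite powR_gt0; lra.
  have B0 : 0 < B x by rewrite powR_gt0; lra.
  pose b := k * (1 - k ^+ 2) / 3.
  pose s := k * x + b * x ^+ 3.
  have s0 : 0 <= s.
    have k2 : k ^+ 2 < 1 by rewrite expr_lt1 // ltW.
    rewrite /s /b addr_ge0 // mulr_ge0 ?exprn_ge0 ?(ltW k0) //.
    by rewrite divr_ge0 // mulr_ge0 ?subr_ge0 // ltW.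
  have x01 : 0 <= x < 1 by lra.
  have [s1 slog] := artanh_lower k01 x01; rewrite -/b -/s in s1 slog.
  have sAB : s * (A x + B x) <= A x - B x.
    have : ln ((1 + s) * B x) <= ln ((1 - s) * A x).
      by rewrite !lnM ?posrE //; [rewrite /A /B !ln_powR; lra|lra|lra].
    by rewrite ler_ln ?posrE ?mulr_gt0 //; [nra|lra|lra].
  have n0 := N0 _ x1; have m1 := M1 x; have m0 : 0 < M x by lra.
  rewrite /g' (_ : _ - _ = (2 * (A x - B x) * M x -
     (2 * k * x + 4 * ck k * x ^+ 3) * N x) / (N x * M x)); last first.
    by field; rewrite !gt_eqF.
  rewrite divr_ge0 //; last by rewrite mulr_ge0 // ltW.
  rewrite NE //.
  have -> : 2 * (A x - B x) * M x -
    (2 * k * x + 4 * ck k * x ^+ 3) * (A x * (1 + x) + B x * (1 - x)) =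
    2 * ((A x - B x) * (1 - ck k * x ^+ 4) -
        (k * x + 2 * ck k * x ^+ 3) * (A x + B x)).
    by rewrite /M; ring.
  have x4 : 0 <= x ^+ 4 <= 1 by rewrite exprn_ge0 //= exprn_ile1 // ltW //; case/andP: x1.
  have c1 : ck k <= 1 by rewrite /ck /bk; nra.
  have cx1 : ck k * x ^+ 4 <= 1 by nra.
  rewrite mulr_ge0 // subr_ge0.
  apply: (@le_trans _ _ (s * (A x + B x) * (1 - ck k * x ^+ 4))); last first.
    by rewrite ler_wpM2r // subr_ge0.
  rewrite [leRHS]mulrAC ler_pM2r ?addr_gt0 //.
  rewrite -subr_ge0 (_ : _ - _ = x ^+ 3 * (b - 2 * ck k - k * ck k * x ^+ 2 - b * ck k * x ^+ 4)); last first.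
    by rewrite /s; ring.
  have x2 : 0 <= x ^+ 2 <= 1 by rewrite exprn_ge0 //= exprn_ile1 // ltW //; case/andP: x1.
  rewrite mulr_ge0 ?exprn_ge0 //.
  have b0 : 0 <= b.
    have k2 : k ^+ 2 < 1 by rewrite expr_lt1 // ltW.
    by rewrite /b divr_ge0 // mulr_ge0 ?subr_ge0 // ltW.
  have kc0 : 0 <= k * ck k by rewrite mulr_ge0 // ltW.
  have bc0 : 0 <= b * ck k by rewrite mulr_ge0.
  have h1 : k * ck k * x ^+ 2 <= k * ck k by rewrite ler_piMr //; case/andP: x2.
  have h2 : b * ck k * x ^+ 4 <= b * ck k by rewrite ler_piMr //; case/andP: x4.
  (* The worst case is [x = 1]. There [b - (2 + k) ck = k (1 - k)^2 (3 + 2 k) / 9]: with the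
     coefficient 2/9 in [bk], the two sides balance to leading order as [k] tends to 1. *)
  apply: (@le_trans _ _ (b - 2 * ck k - k * ck k - b * ck k)); last by lra.
  rewrite (_ : _ - _ = (1 - k) ^+ 2 * k / 9 * (3 + 2 * k - 2 / 3 * k ^+ 2 * (1 + k))).
    apply: mulr_ge0; first by rewrite divr_ge0 // mulr_ge0 ?sqr_ge0 // ltW.
    have k2 : 0 <= k ^+ 2 <= 1 by rewrite sqr_ge0 /= exprn_ile1 // ltW.
    nra.
  by rewrite /b /ck /bk; field.
have n0 : 0 < N t by apply: N0; lra.
have m1 := M1 t; have m0 : 0 < M t by lra.
have -> : g 0 = 2 / p * ln 2.
  rewrite /g /N /M addr0 subr0 powR1 !expr0n /= !mulr0 !addr0 ln1 subr0.
  by congr (_ * ln _).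
rewrite /g => gt.
rewrite -ler_ln ?posrE; last 2 first.
- exact: powR_gt0.
- by rewrite divr_gt0.
rewrite ln_powR ln_div ?posrE // -/(N t) -/(M t).
have : p / 2 * (2 / p * ln 2) <= p / 2 * (2 / p * ln (N t) - ln (M t)).
  by rewrite ler_pM2l // divr_gt0.
rewrite mulrBr !mulrA (_ : p / 2 * 2 / p = 1) ?mul1r; last by field; rewrite gt_eqF.
lra.
Qed.

Lemma two_point k t : 0 < k < 1 -> -1 < t < 1 ->
  (1 + k * t ^+ 2 + ck k * t ^+ 4) `^ ((k + 1) / 2) <=
  ((1 + t) `^ (k + 1) + (1 - t) `^ (k + 1)) / 2.
Proof.
move=> k01 /andP[t1 t2]; have [t0|t0] := leP 0 t.
  by apply: two_point_ge0 => //; rewrite t0.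
have := @two_point_ge0 k (- t) k01; rewrite opprK.
rewrite (_ : (- t) ^+ 2 = t ^+ 2); last by ring.
rewrite (_ : (- t) ^+ 4 = t ^+ 4); last by ring.
by rewrite [X in _ <= X / 2]addrC; apply; lra.
Qed.

End TwoPointInequality.

(** * Contraction of the energy under the fold *)

Section Contraction.
Variable R : realType.
Implicit Types k t X Y : R.

Lemma bk_itv k : 0 < k < 1 -> 0 < bk k /\ bk k <= 2 / 9.
Proof.
move=> /andP[k0 k1]; have k2 : k ^+ 2 < 1 by rewrite expr_lt1 // ltW.
by have := exprn_gt0 2 k0; rewrite /bk; lra.
Qed.

Lemma ck_itv k : 0 < k < 1 -> 0 < ck k /\ ck k <= 2 / 9.
Proof.
move=> k01; have [b0 b1] := bk_itv k01; move: k01 => /andP[k0 k1].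
by rewrite /ck; split; [rewrite mulr_gt0 // subr_gt0|nra].
Qed.

Lemma sqr_itv t : -1 < t < 1 -> 0 <= t ^+ 2 /\ t ^+ 2 < 1.
Proof.
move=> t1; rewrite sqr_ge0 -real_normK ?num_real // expr_lt1 //; split => //.
by rewrite ltr_norml.
Qed.

(** For [X = x'] and [Y = y'] the bracket on the left is [m' * sqrt M] with [m = x * sqrt M], so
    that the claim is [|m'| <= |x'| + k |t y'|]. It holds because the coefficients [p] of [X] and
    [q] of [k t Y] satisfy [p^2, p q, q^2 <= M]. *)
Lemma fold_sqr_le k t X Y : 0 < k < 1 -> -1 < t < 1 ->
  ((1 - ck k * t ^+ 4) * X + (k * t + 2 * ck k * t ^+ 3) * Y) ^+ 2 <=
  (1 + k * t ^+ 2 + ck k * t ^+ 4) * (`|X| + `|k * t * Y|) ^+ 2.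
Proof.
move=> k01 t1; have [c0 c1] := ck_itv k01; have [s0 s1] := sqr_itv t1.
have /andP[k0 k1] := k01.
pose s := t ^+ 2; pose W := k * t * Y.
pose q := 1 + 4 / 9 * (k * (1 - k)) * s.
pose p := 1 - ck k * s ^+ 2.
pose M := 1 + k * s + ck k * s ^+ 2.
have s2 : 0 <= s ^+ 2 <= 1 by rewrite sqr_ge0 /= exprn_ile1 // ltW.
have -> : (1 - ck k * t ^+ 4) * X + (k * t + 2 * ck k * t ^+ 3) * Y = p * X + q * W.
  by rewrite /p /q /W /s /ck /bk; field.
have -> : 1 + k * t ^+ 2 + ck k * t ^+ 4 = M by rewrite /M /s; ring.
have cs : 0 <= ck k * s ^+ 2 <= 2 / 9.
  by rewrite mulr_ge0 ?(ltW c0) ?sqr_ge0 //= -[leRHS]mulr1 ler_pM ?(ltW c0) ?sqr_ge0 //; case/andP: s2.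
have p0 : 0 <= p by rewrite /p; lra.
have kk : 0 <= k * (1 - k) <= 1 / 4.
  by apply/andP; split; [rewrite mulr_ge0 ?subr_ge0 // ltW|have := sqr_ge0 (k - 1 / 2); lra].
have y0 : 0 <= k * (1 - k) * s <= 1 / 4.
  by rewrite mulr_ge0 //= /s; [nra|case/andP: kk].
have q0 : 0 <= q by rewrite /q; lra.
have ks : 0 <= k * s by rewrite mulr_ge0 // ltW.
have pM : p ^+ 2 <= M.
  by apply: (@le_trans _ _ 1); [rewrite exprn_ile1 // /p; lra|rewrite /M; lra].
have qM : q ^+ 2 <= M.
  have yk : k * (1 - k) * s <= k * s.
    have -> : k * (1 - k) * s = k * s - k * (k * s) by ring.
    by rewrite gerBl mulr_ge0 // ltW.
  rewrite /q; set y := k * (1 - k) * s in y0 yk *.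
  have : y ^+ 2 <= y * (1 / 4) by rewrite expr2 ler_wpM2l //; case/andP: y0.
  rewrite (_ : (1 + _) ^+ 2 = 1 + 8 / 9 * y + 16 / 81 * y ^+ 2); last by rewrite /y; field.
  by rewrite /M; lra.
have pqM : p * q <= M by have := sqr_ge0 (p - q); lra.
have XW : p * X * (q * W) <= p * q * (`|X| * `|W|).
  by rewrite mulrACA -normrM ler_wpM2l ?mulr_ge0 // ler_norm.
have XW0 : 0 <= `|X| * `|W| by rewrite mulr_ge0.
have -> : (p * X + q * W) ^+ 2 = p ^+ 2 * X ^+ 2 + 2 * (p * X * (q * W)) + q ^+ 2 * W ^+ 2.
  by ring.
have -> : M * (`|X| + `|W|) ^+ 2 = M * X ^+ 2 + 2 * (M * (`|X| * `|W|)) + M * W ^+ 2.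
  by rewrite -(real_normK (num_real X)) -(real_normK (num_real W)); ring.
apply: lerD; last by rewrite ler_wpM2r ?sqr_ge0.
apply: lerD; first by rewrite ler_wpM2r ?sqr_ge0.
rewrite ler_pM2l //; apply: (le_trans XW).
by rewrite ler_wpM2r.
Qed.

(** The factor 2, against the factor 1/4 that comes from the rescaling, is what halves the energy in
    each fold. *)
Lemma fold_sqr_le2 k t X Y : 0 < k < 1 -> -1 < t < 1 ->
  ((1 - ck k * t ^+ 4) * X + (k * t + 2 * ck k * t ^+ 3) * Y) ^+ 2 /
  (1 + k * t ^+ 2 + ck k * t ^+ 4) <= 2 * (X ^+ 2 + Y ^+ 2).
Proof.
move=> k01 t1; have [c0 c1] := ck_itv k01; have [s0 s1] := sqr_itv t1.
have /andP[k0 k1] := k01.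
have M0 : 0 < 1 + k * t ^+ 2 + ck k * t ^+ 4.
  by rewrite -addrA ltr_wpDr // addr_ge0 // mulr_ge0 ?exprn_even_ge0 // ltW.
rewrite ler_pdivrMr // [leRHS]mulrC; apply: (le_trans (fold_sqr_le X Y k01 t1)).
rewrite ler_pM2l //.
rewrite -(real_normK (num_real X)) -(real_normK (num_real Y)).
have : `|k * t * Y| <= `|Y|.
  rewrite normrM ler_piMl // normrM (gtr0_norm k0).
  by rewrite mulr_ile1 // ?ltW // ltr_norml.
have := normr_ge0 X; have := normr_ge0 (k * t * Y).
by have := sqr_ge0 (`|X| - `|k * t * Y|); nra.
Qed.

(** The second term is the squared derivative of [y * sqrt (1 - bk t^2)]. Expanded, it is [Y^2]
    minus at least [38/63 (k t Y)^2], up to terms with [X]; this gain absorbs the [Y] part of the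
    first term. What remains is a positive definite form in [|X|] and [|k t Y|], whose small margin
    leaves room for the factor 1/100. *)
Lemma fold_contraction k t X Y : 0 < k < 1 -> -1 < t < 1 ->
  ((1 - ck k * t ^+ 4) * X + (k * t + 2 * ck k * t ^+ 3) * Y) ^+ 2 /
    (1 + k * t ^+ 2 + ck k * t ^+ 4) / 4 +
  (Y * (1 - 2 * bk k * t ^+ 2) + bk k * t ^+ 3 * X) ^+ 2 / (1 - bk k * t ^+ 2) +
  (X ^+ 2 + k ^+ 2 * (t * Y) ^+ 2) / 100 <= X ^+ 2 + Y ^+ 2.
Proof.
move=> k01 t1; have [c0 c1] := ck_itv k01; have [s0 s1] := sqr_itv t1.
have [b0 b1] := bk_itv k01.
have /andP[k0 k1] := k01.
have M0 : 0 < 1 + k * t ^+ 2 + ck k * t ^+ 4.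
  by rewrite -addrA ltr_wpDr // addr_ge0 // mulr_ge0 ?exprn_even_ge0 // ltW.
have := fold_sqr_le X Y k01 t1.
rewrite [leRHS]mulrC -ler_pdivrMr //.
set T1 := _ / (1 + _ + _) => T1le.
pose W := k * t * Y; rewrite -/W in T1le.
pose z := bk k * t ^+ 2.
have z0 : 0 <= z by rewrite mulr_ge0 // ltW.
have z1 : z <= 2 / 9 by rewrite /z; nra.
pose e := 2 / 9 * k * t ^+ 2.
have e0 : 0 <= e by rewrite /e mulr_ge0 // mulr_ge0 ?(ltW k0) //; lra.
have e1 : e <= 2 / 9.
  have kt : k * t ^+ 2 <= 1 by rewrite mulr_ile1 // ltW.
  by rewrite /e; lra.
have -> : (Y * (1 - 2 * bk k * t ^+ 2) + bk k * t ^+ 3 * X) ^+ 2 / (1 - bk k * t ^+ 2)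
  = Y ^+ 2 - 2 / 9 * ((3 - 4 * z) / (1 - z)) * W ^+ 2
    + 2 * ((1 - 2 * z) / (1 - z)) * e * (X * W) + z ^+ 2 * t ^+ 2 / (1 - z) * X ^+ 2.
  rewrite /e /z /W /bk; field.
  by rewrite gt_eqF //; move: z1; rewrite /z /bk; lra.
have i0 : 0 < 1 - z by lra.
have h1 : 19 / 7 <= (3 - 4 * z) / (1 - z) by rewrite ler_pdivlMr //; lra.
have h2 : 0 <= (1 - 2 * z) / (1 - z) <= 1.
  by apply/andP; split; [apply: divr_ge0; lra|rewrite ler_pdivrMr //; lra].
have h3 : z ^+ 2 * t ^+ 2 / (1 - z) <= 4 / 63.
  have z2 : z ^+ 2 <= 4 / 81 by have := ler_pM z0 z0 z1 z1; rewrite -expr2; lra.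
  have zt : z ^+ 2 * t ^+ 2 <= z ^+ 2 by rewrite ler_piMr ?sqr_ge0 // ltW.
  by rewrite ler_pdivrMr //; lra.
set f1 := (3 - 4 * z) / (1 - z) in h1 *.
set f2 := (1 - 2 * z) / (1 - z) in h2 *.
set f3 := _ / (1 - z) in h3 *.
have -> : k ^+ 2 * (t * Y) ^+ 2 = W ^+ 2 by rewrite /W; ring.
have X2 := sqr_ge0 X; have W2 := sqr_ge0 W.
have p1 : 2 / 9 * f1 * W ^+ 2 >= 38 / 63 * W ^+ 2 by rewrite ler_wpM2r //; lra.
have p3 : f3 * X ^+ 2 <= 4 / 63 * X ^+ 2 by rewrite ler_wpM2r.
have fe : 0 <= f2 * e <= 2 / 9 by move: h2 => /andP[? ?]; nra.
have p2 : 2 * f2 * e * (X * W) <= 4 / 9 * (`|X| * `|W|).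
  rewrite -normrM; apply: (@le_trans _ _ (2 * f2 * e * `|X * W|)).
    by rewrite ler_wpM2l ?ler_norm // -mulrA; lra.
  by rewrite ler_wpM2r // -mulrA; lra.
rewrite -(real_normK (num_real X)) -(real_normK (num_real W)) in p1 p3 *.
move: T1le p1 p2 p3; move: (normr_ge0 X) (normr_ge0 W) => x0 w0.
(* The remaining form is nearly degenerate at [|X| = 0.7 |W|]; this square and the one with 5/7
   vanish close to that ratio. *)
have := sqr_ge0 (`|X| * 6 / 5 - `|W| * 5 / 6).
set x := `|X|; set w := `|W|.
rewrite sqrrD.
have : 0 <= x ^+ 2 by rewrite sqr_ge0.
have : 0 <= w ^+ 2 by rewrite sqr_ge0.
have : 0 <= (5 / 7 * w - x) ^+ 2 by rewrite sqr_ge0.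
by nra.
Qed.

End Contraction.

(** * Wirtinger's inequality *)

Section Wirtinger.
Variable R : realType.
Implicit Types (y F G : R -> R).

Lemma le_of_small (A B C : R) :
  (forall e, 0 < e < 1 -> A - e * C <= B) -> A <= B.
Proof.
move=> H; rewrite leNgt; apply/negP => BA.
pose e := Num.min (1 / 2) ((A - B) / (2 * (`|C| + 1))).
have C1 : 0 < `|C| + 1 by rewrite ltr_wpDl.
have e0 : 0 < e by rewrite lt_min; apply/andP; split; [lra|rewrite divr_gt0 //; lra].
have e1 : e < 1 by rewrite gt_min; apply/orP; left; lra.
have e2 : e * (2 * (`|C| + 1)) <= A - B.
  by rewrite -ler_pdivlMr ?mulr_gt0 // ge_min lexx orbT.
have := H e; rewrite e0 e1 => /(_ isT).
have := ler_wpM2l (ltW e0) (ler_norm C); nra.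
Qed.

Lemma deriv_tan_aff (om c x : R) : cos (om * (x - c)) != 0 ->
  is_derive x (1 : R) (fun t => tan (om * (t - c)))
    ((1 + tan (om * (x - c)) ^+ 2) * om).
Proof.
move=> c0; have d : is_derive x (1 : R) (fun t => om * (t - c)) om.
  by derive; ring.
apply: isd_eq (@isd_comp _ tan (fun t => om * (t - c)) x _ _ (is_derive_tan c0) d) _.
congr (_ * _); rewrite /tan.
rewrite (_ : 1 + _ = (cos (om * (x - c)) ^+ 2 + sin (om * (x - c)) ^+ 2) /
  cos (om * (x - c)) ^+ 2); last by field.
by rewrite cos2Dsin2 div1r.
Qed.

(* [omega tan (omega (x - mid)) y^2] calibrates [y'^2 - omega^2 y^2]: their sum is a
   square, and the boundary terms vanish. *)
Lemma dirichlet_poincare y (y' F G : R -> R) z L : 0 < L ->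
  deriv_of y y' -> deriv_of F (fun x => y x ^+ 2) ->
  deriv_of G (fun x => y' x ^+ 2) -> y z = 0 -> y (z + L) = 0 ->
  (pi / L) ^+ 2 * (F (z + L) - F z) <= G (z + L) - G z.
Proof.
move=> L0 dy dF dG yz yzL.
have zL : z <= z + L by rewrite lerDl ltW.
have F0 : 0 <= F (z + L) - F z.
  rewrite subr_ge0; apply: (nondecreasing_of_deriv zL (fun x _ => dF x)) => x _.
  exact: sqr_ge0.
(* At the frequency [pi / L] the tangent is infinite at both end points. The factor [1 - e] keeps it
   finite and costs a relative error below [2 e]. *)
apply: (@le_of_small _ _ (2 * ((pi / L) ^+ 2 * (F (z + L) - F z)))) => e /andP[e0 e1].
have p0 := pi_gt0 R.
pose om := (1 - e) * (pi / L).
have om0 : 0 < om by rewrite mulr_gt0 ?divr_gt0 ?subr_gt0.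
pose c := z + L / 2.
have ang x : z <= x <= z + L -> 0 < cos (om * (x - c)).
  move=> /andP[x1 x2]; apply: cos_gt0_pihalf.
  have omL : om * (L / 2) < pi / 2.
    rewrite /om (_ : _ * (L / 2) = (1 - e) * (pi / 2)); last by move: (@pi R) => q; field; rewrite gt_eqF.
    by rewrite gtr_pMl ?divr_gt0 //; lra.
  have h1 : om * (x - c) <= om * (L / 2) by rewrite ler_pM2l // /c; lra.
  have h2 : om * (- (L / 2)) <= om * (x - c) by rewrite ler_pM2l // /c; lra.
  lra.
pose T x := tan (om * (x - c)).
have key := @nondecreasing_of_deriv _
  (fun x => G x - om ^+ 2 * F x + om * (T x * y x ^+ 2))
  (fun x => (y' x + om * T x * y x) ^+ 2) _ _ zL.
have : om ^+ 2 * (F (z + L) - F z) <= G (z + L) - G z.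
  suff : G z - om ^+ 2 * F z + om * (T z * y z ^+ 2) <=
      G (z + L) - om ^+ 2 * F (z + L) + om * (T (z + L) * y (z + L) ^+ 2).
    by rewrite yz yzL expr0n /= !mulr0 !addr0; lra.
  apply: key => [x xz|x _]; last exact: sqr_ge0.
  have dT := @deriv_tan_aff om c x (lt0r_neq0 (ang _ xz)).
  have d2 : is_derive x (1 : R) (fun x => y x ^+ 2) (2 * y x * y' x) by derive.
  apply: isd_eq (isdD (isdD (dG x) (isdN (isdM (isdC _ x) (dF x))))
                  (isdM (isdC om x) (isdM dT d2))) _.
  by rewrite /= /T; ring.
apply: le_trans.
rewrite /om (exprMn _ (1 - e)) -subr_ge0.
set A := (pi / L) ^+ 2; set D := F _ - F _.
have AD : 0 <= A * D by rewrite mulr_ge0 ?sqr_ge0.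
rewrite [leRHS](_ : _ = e ^+ 2 * (A * D)); last by ring.
by rewrite mulr_ge0 ?sqr_ge0.
Qed.

(** An antiperiodic function has a zero [z] and vanishes again at [z + L]. The squares of [y] and
    [y'] have period [L], so both integrals may start at [z] instead of [s], and the Dirichlet case
    applies. *)
Lemma wirtinger_antiperiodic y (y' F G : R -> R) s L : 0 < L ->
  deriv_of y y' -> deriv_of F (fun x => y x ^+ 2) ->
  deriv_of G (fun x => y' x ^+ 2) ->
  (forall x, y (x + L) = - y x) -> (forall x, y' (x + L) = - y' x) ->
  (pi / L) ^+ 2 * (F (s + L) - F s) <= G (s + L) - G s.
Proof.
move=> L0 dy dF dG ya y'a.
have sL : s <= s + L by rewrite lerDl ltW.
have [||z _ yz] := @IVT R y s (s + L) 0 sL.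
- exact/continuous_subspaceT/(deriv_of_continuous dy).
- rewrite ya; case: (leP 0 (y s)) => ys.
    by rewrite ge_min le_max ys oppr_le0 ys orbT.
  by rewrite ge_min le_max (ltW ys) oppr_ge0 (ltW ys) orbT.
have -> : F (s + L) - F s = F (z + L) - F z.
  by apply: (primitive_periodic dF) => x; rewrite ya sqrrN.
have -> : G (s + L) - G s = G (z + L) - G z.
  by apply: (primitive_periodic dG) => x; rewrite y'a sqrrN.
by apply: (dirichlet_poincare L0 dy) => //; rewrite ya yz oppr0.
Qed.

Lemma sint_wirtinger y (y' : R -> R) : deriv_of y y' -> continuous y' ->
  (forall x, y (x + pi) = - y x) -> (forall x, y' (x + pi) = - y' x) ->
  sint (fun x => y x ^+ 2) <= sint (fun x => y' x ^+ 2).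
Proof.
move=> dy cy' ya y'a.
have c1 : continuous (fun x => y x ^+ 2) by cts.
have c2 : continuous (fun x => y' x ^+ 2) by cts.
have [[F dF] [G dG]] := (ex_primitive c1, ex_primitive c2).
rewrite (sint_deriv c1 dF) (sint_deriv c2 dG) ler_pM2l ?invr_gt0 ?twopi_gt0 //.
have := @wirtinger_antiperiodic _ _ _ _ (- pi) _ (pi_gt0 R) dy dF dG ya y'a.
have := @wirtinger_antiperiodic _ _ _ _ 0 _ (pi_gt0 R) dy dF dG ya y'a.
rewrite divff ?gt_eqF ?pi_gt0 // expr1n !mul1r add0r addNr; lra.
Qed.

End Wirtinger.

(** * Tangent lines of power functions *)

Section Powers.
Variable R : realType.
Implicit Types r w m : R.

(** Young's inequality for the product [w * 1], multiplied by [r]. *)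
Lemma bernoulli_powR r w : 1 < r -> 0 <= w -> 1 + r * (w - 1) <= w `^ r.
Proof.
move=> r1 w0; have r0 : 0 < r by lra.
have := @conjugate_powR R w 1 r (r / (r - 1)) w0 ler01 r0.
rewrite powR1 mulr1 => /(_ ltac:(rewrite divr_gt0 //; lra)).
have -> : r^-1 + (r / (r - 1))^-1 = 1 by field; rewrite ?gt_eqF //; lra.
move=> /(_ erefl).
rewrite (_ : 1 / (r / (r - 1)) = (r - 1) / r); last by field; rewrite ?gt_eqF //; lra.
by rewrite -mulrDl ler_pdivlMr //; lra.
Qed.

Lemma powR_tangent r w m : 1 < r -> 0 <= w -> 0 < m ->
  m `^ r + r * m `^ (r - 1) * (w - m) <= w `^ r.
Proof.
move=> r1 w0 m0; have wm0 := divr_ge0 w0 (ltW m0).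
have := bernoulli_powR r1 wm0.
rewrite -(ler_pM2l (powR_gt0 r m0)) -powRM ?(ltW m0) //.
rewrite (_ : m * (w / m) = w); last by field; rewrite gt_eqF.
apply: le_trans; rewrite le_eqVlt; apply/orP; left; apply/eqP.
rewrite -(mulr_powRB1 (ltW m0) (lt_trans ltr01 r1)).
by field; rewrite gt_eqF.
Qed.

End Powers.

(** * Beckner's inequality *)

Section Entropy.
Variable R : realType.
Implicit Types (u v : R -> R) (p k : R).

Definition entp p u : R := sint (fun x => u x ^+ 2) - (sint (fun x => u x `^ p)) `^ (2 / p).

Lemma is_derive_unique (f : R -> R) x a b :
  is_derive x (1 : R) f a -> is_derive x (1 : R) f b -> a = b.
Proof. by move=> [_ <-] [_ <-]. Qed.

(** Used with [e = 1] for periodic and with [e = -1] for antiperiodic functions. *)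
Lemma deriv_translate u (u' : R -> R) T (e : R) : deriv_of u u' ->
  (forall x, u (x + T) = e * u x) -> forall x, u' (x + T) = e * u' x.
Proof.
move=> du uT x; apply: (@is_derive_unique (fun y => e * u y) x); last first.
  by derive; ring.
rewrite (_ : (fun y => e * u y) = (fun y => u (y + T))); last by apply/funext => y; rewrite uT.
by derive; ring.
Qed.

Lemma sint_symmetrize u : continuous u -> (forall x, u (x + 2 * pi) = u x) ->
  sint u = sint (fun x => (u x + u (x + pi)) / 2).
Proof.
move=> cu up; rewrite [RHS](@eq_sint _ _ (fun x => 2^-1 * (u x + u (x + pi)))); last first.
  by move=> x; rewrite mulrC.
by rewrite sintZ; [rewrite sintD ?sint_shift //; [field|cts]|cts].
Qed.

Lemma sqr_powR (w p : R) : 0 <= w -> p != 0 -> (w `^ p) `^ (2 / p) = w ^+ 2.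
Proof.
move=> w0 p0; rewrite -powRrM (_ : p * (2 / p) = 2%:R); first by rewrite powR_mulrn.
by field.
Qed.

(** Jensen's inequality, obtained by integrating the tangent line of the power at the mean of
    [u]. *)
Lemma sqr_mean_le u p : 1 < p -> (forall x, 0 < u x) -> continuous u ->
  sint u ^+ 2 <= (sint (fun x => u x `^ p)) `^ (2 / p).
Proof.
move=> p1 u0 cu; have m0 := sint_gt0 cu u0; have p0 : 0 < p by lra.
have cp : continuous (fun x => u x `^ p) by cts => // x; exact/ltW.
rewrite -(@sqr_powR _ p) ?(ltW m0) ?gt_eqF //.
apply: ge0_ler_powR; rewrite ?nnegrE ?powR_ge0 //.
- by rewrite divr_ge0 // ltW.
- by apply: sint_ge0 => // x; exact: powR_ge0.
set m := sint u.
have -> : m `^ p = sint (fun x => m `^ p + p * m `^ (p - 1) * (u x - m)).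
  rewrite sintD; [|by cts|by cts]; rewrite sint_cst sintZ; last by cts.
  by rewrite sintB; [|by cts|by cts]; rewrite sint_cst /m subrr mulr0 addr0.
by apply: le_sint => [|//|x _]; [by cts|apply: powR_tangent => //; exact: ltW].
Qed.

(** A crude start for the iteration: the entropy is at most the variance, which the oscillation of
    [u] bounds. The size of the constant is harmless, since [beckner_iter] divides it by
    [2 ^+ n]. *)
Lemma entp_le_energy u (u' : R -> R) p : 1 < p -> deriv_of u u' -> continuous u' ->
  (forall x, 0 < u x) -> entp p u <= (2 * pi) ^+ 2 * sint (fun x => u' x ^+ 2).
Proof.
move=> p1 du cu' u0; have cu := deriv_of_continuous du.
apply: le_trans (le_trans (sint_variance_le (u (- pi)) cu) _).
  by rewrite /entp lerD2l lerN2; exact: sqr_mean_le.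
rewrite -[leRHS]sint_cst; apply: le_sint => [||x xpi]; [by cts|by cts|].
exact: sqr_osc_le.
Qed.

End Entropy.

Section BecknerStep.
Variable R : realType.
Implicit Types (u v : R -> R) (k : R).

Definition evp u : R -> R := fun x => (u x + u (x + pi)) / 2.
Definition odp u : R -> R := fun x => (u x - u (x + pi)) / 2.

(** The margin of [fold_contraction] at [X = x'], [Y = y'], [t = y / x]. Its two terms control the
    derivatives of [x] and of [y^2], so a vanishing deficit makes both of them constant. *)
Definition deficit k u (u' : R -> R) : R :=
  sint (fun x => (evp u' x ^+ 2 + k ^+ 2 * (odp u x / evp u x * odp u' x) ^+ 2) / 100).

Lemma deficit_cts k u (u' : R -> R) : continuous u -> continuous u' ->
  (forall x, 0 < u x) ->
  continuous (fun x => (evp u' x ^+ 2 + k ^+ 2 * (odp u x / evp u x * odp u' x) ^+ 2) / 100).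
Proof.
move=> cu cu' u0; rewrite /odp /evp; cts => x; rewrite gt_eqF //.
by rewrite divr_gt0 // addr_gt0.
Qed.

Lemma deficit_ge0 k u (u' : R -> R) : continuous u -> continuous u' ->
  (forall x, 0 < u x) -> 0 <= deficit k u u'.
Proof.
move=> cu cu' u0; rewrite /deficit; apply: sint_ge0 => [|x]; first exact: deficit_cts.
by rewrite divr_ge0 // addr_ge0 ?sqr_ge0 // mulr_ge0 ?sqr_ge0.
Qed.

(* The fold [m] of [u] has period [pi]; rescaling it to period [2 pi] divides the
   energy by at least [2], while [entp] is unchanged. *)
Lemma beckner_step k u (u' : R -> R) : 0 < k < 1 ->
  deriv_of u u' -> continuous u' -> (forall x, 0 < u x) ->
  (forall x, u (x + 2 * pi) = u x) ->
  exists v v' : R -> R, [/\ deriv_of v v', continuous v', forall x, 0 < v x &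
    forall x, v (x + 2 * pi) = v x] /\
  (sint (fun x => v' x ^+ 2) <= sint (fun x => u' x ^+ 2) / 2 /\
   entp (k + 1) u - (1 - k) * sint (fun x => u' x ^+ 2) + (1 - k) * deficit k u u' <=
   entp (k + 1) v - (1 - k) * sint (fun x => v' x ^+ 2)).
Proof.
move=> k01 du cu' u0 up; have /andP[k0 k1] := k01.
have cu := deriv_of_continuous du.
have u'p x : u' (x + 2 * pi) = u' x.
  by rewrite (deriv_translate (e := 1) du) ?mul1r // => y; rewrite mul1r.
have pp x : x + pi + pi = x + 2 * pi by ring.
pose x := evp u; pose x' := evp u'; pose y := odp u; pose y' := odp u'.
have dx : deriv_of x x' by move=> z; rewrite /x /x' /evp; derive; field.
have dy : deriv_of y y' by move=> z; rewrite /y /y' /odp; derive; field.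
have cx : continuous x by exact: deriv_of_continuous dx.
have cy : continuous y by exact: deriv_of_continuous dy.
have cx' : continuous x' by rewrite /x' /evp; cts.
have cy' : continuous y' by rewrite /y' /odp; cts.
have x0 z : 0 < x z by rewrite /x /evp divr_gt0 // addr_gt0.
have xn0 z : x z != 0 by rewrite gt_eqF.
have xp z : x (z + pi) = x z by rewrite /x /evp pp up addrC.
have yp z : y (z + pi) = - y z by rewrite /y /odp pp up; field.
have x'p z : x' (z + pi) = x' z by rewrite /x' /evp pp u'p addrC.
have y'p z : y' (z + pi) = - y' z by rewrite /y' /odp pp u'p; field.
pose t z := y z / x z.
have t1 z : -1 < t z < 1.
  rewrite /t ltr_pdivrMr // ltr_pdivlMr // /x /y /evp /odp.
  by have := u0 z; have := u0 (z + pi); lra.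
have tp z : t (z + pi) = - t z by rewrite /t xp yp mulNr.
have dt : deriv_of t (fun z => (y' z - t z * x' z) / x z).
  by move=> z; rewrite /t; derive; [exact: xn0|field].
have ct : continuous t := deriv_of_continuous dt.
have [b0 b1] := bk_itv k01; have [c0 c1] := ck_itv k01.
pose M z := 1 + k * t z ^+ 2 + ck k * t z ^+ 4.
have M0 z : 0 < M z.
  by rewrite /M -addrA ltr_wpDr // addr_ge0 // mulr_ge0 ?exprn_even_ge0 // ltW.
have Mp z : M (z + pi) = M z.
  by rewrite /M tp; congr (_ + _ * _ + _ * _); ring.
have cM : continuous M by rewrite /M; cts.
pose B z := 1 - bk k * t z ^+ 2.
have B0 z : 0 < B z.
  by rewrite /B; have [s0 s1] := sqr_itv (t1 z); nra.
have Bp z : B (z + pi) = B z by rewrite /B tp; congr (_ - _ * _); ring.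
have cB : continuous B by rewrite /B; cts.
have dM : deriv_of M (fun z =>
    (2 * k * t z + 4 * ck k * t z ^+ 3) * ((y' z - t z * x' z) / x z)).
  by move=> z; rewrite /M; derive; ring.
have dB : deriv_of B (fun z => - (2 * bk k * t z * ((y' z - t z * x' z) / x z))).
  by move=> z; rewrite /B; derive; ring.
have sM z : Num.sqrt (M z) != 0 by rewrite gt_eqF // sqrtr_gt0.
have sB z : Num.sqrt (B z) != 0 by rewrite gt_eqF // sqrtr_gt0.
have sM2 z : Num.sqrt (M z) ^+ 2 = M z by rewrite sqr_sqrtr // ltW.
have sB2 z : Num.sqrt (B z) ^+ 2 = B z by rewrite sqr_sqrtr // ltW.
pose m z := x z * Num.sqrt (M z).
(* [nm] and [nW] result from [t' = (y' - t x') / x] once the square roots are factored out; the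
   division by [x] cancels. *)
pose nm z := (1 - ck k * t z ^+ 4) * x' z + (k * t z + 2 * ck k * t z ^+ 3) * y' z.
pose m' z := nm z / Num.sqrt (M z).
pose W z := y z * Num.sqrt (B z).
pose nW z := y' z * (1 - 2 * bk k * t z ^+ 2) + bk k * t z ^+ 3 * x' z.
pose W' z := nW z / Num.sqrt (B z).
have ty z : y z = t z * x z by rewrite /t divfK.
have dm : deriv_of m m'.
  move=> z; rewrite /m /m'; derive; first exact: M0.
  apply: (mulfI (sM z)); rewrite (mulrC _ (nm z / _)) divfK //.
  set r := Num.sqrt (M z).
  rewrite mulrDr (mulrCA r (x' z)) -expr2 sM2.
  rewrite (_ : r * (x z * (_ / (2 * r))) = (x z * (2 * k * t z + 4 * ck k * t z ^+ 3)
     * ((y' z - t z * x' z) / x z)) / 2); last by field; rewrite sM xn0.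
  by rewrite /nm /M; field; exact: xn0.
have dW : deriv_of W W'.
  move=> z; rewrite /W /W'; derive; first exact: B0.
  apply: (mulfI (sB z)); rewrite (mulrC _ (nW z / _)) divfK //.
  set r := Num.sqrt (B z).
  rewrite mulrDr (mulrCA r (y' z)) -expr2 sB2.
  rewrite (_ : r * (y z * (_ / (2 * r))) = - (y z * (2 * bk k * t z)
     * ((y' z - t z * x' z) / x z)) / 2); last by field; rewrite sB xn0.
  by rewrite /nW /B ty; field; exact: xn0.
have cm : continuous m := deriv_of_continuous dm.
have cW : continuous W := deriv_of_continuous dW.
have cm' : continuous m' by rewrite /m' /nm; cts; exact: sM.
have cW' : continuous W' by rewrite /W' /nW; cts; exact: sB.
have m0 z : 0 < m z by rewrite mulr_gt0 // sqrtr_gt0.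
have mp z : m (z + pi) = m z by rewrite /m xp Mp.
have m'p z : m' (z + pi) = m' z.
  by rewrite (deriv_translate (e := 1) dm) ?mul1r // => w; rewrite mul1r.
have Wp z : W (z + pi) = - W z by rewrite /W yp Bp mulNr.
have W'p z : W' (z + pi) = - W' z.
  by rewrite (deriv_translate (e := -1) dW) ?mulN1r // => w; rewrite mulN1r.
have p1 : 1 < k + 1 by lra.
have p0 : 0 < k + 1 by lra.
have cmp : continuous (fun z => m z `^ (k + 1)) by cts => // z; exact/ltW.
have cup : continuous (fun z => u z `^ (k + 1)) by cts => // z; exact/ltW.
have energy : sint (fun z => u' z ^+ 2) = sint (fun z => x' z ^+ 2 + y' z ^+ 2).
  rewrite sint_symmetrize; [|by cts|by move=> z; rewrite u'p].
  by apply: eq_sint => z; rewrite /x' /y' /evp /odp; field.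
have mass : sint (fun z => u z ^+ 2) = sint (fun z => x z ^+ 2 + y z ^+ 2).
  rewrite sint_symmetrize; [|by cts|by move=> z; rewrite up].
  by apply: eq_sint => z; rewrite /x /y /evp /odp; field.
(* Averaging over [z] and [z + pi] pairs the values [x (1 + t)] and [x (1 - t)] of [u], to which
   [two_point] applies pointwise. *)
have lp : sint (fun z => m z `^ (k + 1)) <= sint (fun z => u z `^ (k + 1)).
  rewrite (sint_symmetrize cup); last by move=> z; rewrite up.
  apply: le_sint => [//||z _].
    by apply: ctsM; [apply: ctsD => //; apply: (cts_comp cup); cts|exact: ctsC].
  have -> : u z = x z * (1 + t z) by rewrite mulrDr mulr1 (mulrC (x z)) -ty /x /y /evp /odp; field.
  have -> : u (z + pi) = x z * (1 - t z).
    by rewrite mulrDr mulr1 mulrN (mulrC (x z)) -ty /x /y /evp /odp; field.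
  have t1z := t1 z.
  have tz1 : 0 <= 1 + t z by lra.
  have tz2 : 0 <= 1 - t z by lra.
  have xz := ltW (x0 z).
  rewrite /m (powRM _ xz tz1) (powRM _ xz tz2) (powRM _ xz (sqrtr_ge0 _)).
  rewrite -mulrDr -[leRHS]mulrA ler_pM2l ?powR_gt0 //.
  rewrite -powR12_sqrt ?(ltW (M0 z)) // -powRrM (mulrC 2^-1).
  exact: two_point.
have Wm z : x z ^+ 2 + y z ^+ 2 - m z ^+ 2 = (1 - k) * W z ^+ 2.
  by rewrite /m /W (exprMn _ (x z)) (exprMn _ (y z)) sM2 sB2 /M /B ty /ck; ring.
have wirt := sint_wirtinger dW cW' Wp W'p.
pose v z := m (z / 2).
pose v' z := m' (z / 2) / 2.
have dv : deriv_of v v'.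
  by move=> z; rewrite /v /v'; derive; field.
have half z : (z + 2 * pi) / 2 = z / 2 + pi.
  by move: (@pi R) => q; field.
exists v, v'; split; first split => //.
- rewrite /v'; apply: ctsM; last exact: ctsC.
  by apply: (cts_comp cm'); cts.
- by move=> z; rewrite /v; exact: m0.
- by move=> z; rewrite /v half mp.
have vE : sint (fun z => v' z ^+ 2) = sint (fun z => m' z ^+ 2 / 4).
  rewrite -(@sint_half _ (fun z => m' z ^+ 2 / 4)); [|by cts|by move=> z; rewrite m'p].
  by apply: eq_sint => z; rewrite /v'; field.
have vmass : sint (fun z => v z ^+ 2) = sint (fun z => m z ^+ 2).
  by rewrite -(@sint_half _ (fun z => m z ^+ 2)); [|by cts|by move=> z; rewrite mp].
have vlp : sint (fun z => v z `^ (k + 1)) = sint (fun z => m z `^ (k + 1)).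
  by rewrite -(@sint_half _ (fun z => m z `^ (k + 1))) // => z; rewrite mp.
have m'2 z : m' z ^+ 2 = nm z ^+ 2 / M z by rewrite /m' expr_div_n sM2.
have W'2 z : W' z ^+ 2 = nW z ^+ 2 / B z by rewrite /W' expr_div_n sB2.
split.
  rewrite vE energy mulrC -sintZ; last by cts.
  apply: le_sint => [||z _]; [by cts|by cts|].
  have h : nm z ^+ 2 / M z <= 2 * (x' z ^+ 2 + y' z ^+ 2) :=
    fold_sqr_le2 (x' z) (y' z) k01 (t1 z).
  rewrite -(m'2 z) in h.
  by move: (m' z ^+ 2) (x' z ^+ 2) (y' z ^+ 2) h => a1 a2 a3 h; clear -h; lra.
pose D z := (evp u' z ^+ 2 + k ^+ 2 * (odp u z / evp u z * odp u' z) ^+ 2) / 100.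
have cD : continuous D by rewrite /D -/x -/y -/x' -/y'; cts.
have sum : sint (fun z => m' z ^+ 2 / 4) + sint (fun z => W' z ^+ 2) + sint D
    <= sint (fun z => u' z ^+ 2).
  rewrite -sintD; [|by cts|by cts]; rewrite -sintD; [|by cts|by cts].
  rewrite energy; apply: le_sint => [||z _]; [by cts|by cts|].
  rewrite (m'2 z) (W'2 z); exact: (fold_contraction (x' z) (y' z) k01 (t1 z)).
have cut : sint (fun z => u z ^+ 2) - sint (fun z => m z ^+ 2) =
    (1 - k) * sint (fun z => W z ^+ 2).
  rewrite mass -sintB; [|by cts|by cts]; rewrite -sintZ; last by cts.
  exact: eq_sint.
have lp2 : (sint (fun z => m z `^ (k + 1))) `^ (2 / (k + 1)) <=
    (sint (fun z => u z `^ (k + 1))) `^ (2 / (k + 1)).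
  apply: ge0_ler_powR; last exact: lp.
  - exact: divr_ge0 (ler0n R 2) (ltW p0).
  - by rewrite nnegrE; apply: (sint_ge0 cmp) => z; exact: powR_ge0.
  - by rewrite nnegrE; apply: (sint_ge0 cup) => z; exact: powR_ge0.
(* The mass lost by the fold is [1 - k] times the mean of [W^2], hence at most [1 - k] times that of
   [W'^2]; by [sum] the latter is at most the energy of [u] minus that of [v] minus the deficit. *)
have k1' : 0 <= 1 - k by rewrite subr_ge0 ltW.
have := ler_wpM2l k1' wirt; have := ler_wpM2l k1' sum.
move: cut lp2; rewrite /entp vE vmass vlp /deficit -/D.
sint_lra.
Qed.

End BecknerStep.

Section Beckner.
Variable R : realType.
Implicit Types (u : R -> R) (k : R).

(** The left side does not decrease from one fold to the next, while the energy is halved. The crude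
    bound, applied after [n] folds, therefore carries the factor [2 ^- n]. *)
Lemma beckner_iter k n u (u' : R -> R) : 0 < k < 1 ->
  deriv_of u u' -> continuous u' -> (forall x, 0 < u x) ->
  (forall x, u (x + 2 * pi) = u x) ->
  entp (k + 1) u - (1 - k) * sint (fun x => u' x ^+ 2) <=
  (2 * pi) ^+ 2 * sint (fun x => u' x ^+ 2) / 2 ^+ n.
Proof.
move=> k01; have /andP[k0 k1] := k01.
have p1 : 1 < k + 1 by lra.
elim: n u u' => [|n IH] u u' du cu' u0 up.
  rewrite expr0 divr1; apply: le_trans (entp_le_energy p1 du cu' u0).
  by rewrite gerBl mulr_ge0 ?subr_ge0 ?(ltW k1) // sint_ge0 // => [|x]; [cts|exact: sqr_ge0].
have [v [v' [[dv cv' v0 vp] [vu step]]]] := beckner_step k01 du cu' u0 up.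
have D0 : 0 <= (1 - k) * deficit k u u'.
  rewrite mulr_ge0 ?subr_ge0 ?(ltW k1) //.
  exact: deficit_ge0 (deriv_of_continuous du) cu' u0.
have : (2 * pi) ^+ 2 * sint (fun x => v' x ^+ 2) / 2 ^+ n <=
   (2 * pi) ^+ 2 * (sint (fun x => u' x ^+ 2) / 2) / 2 ^+ n.
  by rewrite ler_pM2r ?invr_gt0 ?exprn_gt0 // ler_wpM2l ?sqr_ge0.
rewrite (_ : _ * (_ / 2) / 2 ^+ n = (2 * pi) ^+ 2 * sint (fun x => u' x ^+ 2) / 2 ^+ n.+1); last first.
  by rewrite (exprS 2 n) invfM !mulrA.
move: (IH v v' dv cv' v0 vp) step D0.
move: (entp _ u) (entp _ v) (deficit _ _ _) => e1 e2 d; sint_lra.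
Qed.

(** The first fold is made by hand to keep its deficit; the iteration, with [n] tending to infinity,
    takes over from the folded function. *)
Lemma beckner_C1 k u (u' : R -> R) : 0 < k < 1 ->
  deriv_of u u' -> continuous u' -> (forall x, 0 < u x) ->
  (forall x, u (x + 2 * pi) = u x) ->
  entp (k + 1) u + (1 - k) * deficit k u u' <= (1 - k) * sint (fun x => u' x ^+ 2).
Proof.
move=> k01 du cu' u0 up.
have [v [v' [[dv cv' v0 vp] [_ step]]]] := beckner_step k01 du cu' u0 up.
suff : entp (k + 1) v - (1 - k) * sint (fun x => v' x ^+ 2) <= 0.
  by move: step; move: (entp _ u) (entp _ v) (deficit _ _ _) => e1 e2 d; sint_lra.
set A := leLHS; set C := (2 * pi) ^+ 2 * sint (fun x => v' x ^+ 2).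
have H n : A <= C / 2 ^+ n := beckner_iter n k01 dv cv' v0 vp.
have C0 : 0 <= C.
  by rewrite mulr_ge0 ?sqr_ge0 // sint_ge0 // => [|x]; [cts|exact: sqr_ge0].
rewrite leNgt; apply/negP => A0.
have n2 n : (n%:R : R) <= 2 ^+ n.
  elim: n => // n IH; rewrite -natr1 exprS.
  have : 1 <= 2 ^+ n :> R by rewrite exprn_ege1 // ler1n.
  by move: IH; clear; lra.
have := H (Num.truncn (C / A)).+1.
rewrite ler_pdivlMr ?exprn_gt0 // leNgt => /negP; apply.
have := truncnS_gt (C / A).
by rewrite ltr_pdivrMr // => h; apply: (lt_le_trans h); rewrite mulrC ler_pM2l.
Qed.

End Beckner.

(** * The magnetic energy of smooth functions *)

Section MagneticC1.
Variable R : realType.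
Implicit Types (u f : R -> R).

(** The components [w1], [w2] of a function multiplied by a phase need not be periodic, only the
    modulus and the energy density are. The two hypotheses on primitives are met either by
    antiperiodicity or by a common zero at [s] and [s + 2 * pi]. *)
Lemma sint_wirtinger_2pi (w1 w2 w1' w2' : R -> R) s :
  deriv_of w1 w1' -> deriv_of w2 w2' -> continuous w1' -> continuous w2' ->
  (forall F G : R -> R, deriv_of F (fun x => w1 x ^+ 2) -> deriv_of G (fun x => w1' x ^+ 2) ->
    (pi / (2 * pi)) ^+ 2 * (F (s + 2 * pi) - F s) <= G (s + 2 * pi) - G s) ->
  (forall F G : R -> R, deriv_of F (fun x => w2 x ^+ 2) -> deriv_of G (fun x => w2' x ^+ 2) ->
    (pi / (2 * pi)) ^+ 2 * (F (s + 2 * pi) - F s) <= G (s + 2 * pi) - G s) ->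
  (forall x, w1 (x + 2 * pi) ^+ 2 + w2 (x + 2 * pi) ^+ 2 = w1 x ^+ 2 + w2 x ^+ 2) ->
  (forall x, w1' (x + 2 * pi) ^+ 2 + w2' (x + 2 * pi) ^+ 2 = w1' x ^+ 2 + w2' x ^+ 2) ->
  sint (fun x => w1 x ^+ 2 + w2 x ^+ 2) <= 4 * sint (fun x => w1' x ^+ 2 + w2' x ^+ 2).
Proof.
move=> d1 d2 c1' c2' H1 H2 pw pw'.
have c1 := deriv_of_continuous d1; have c2 := deriv_of_continuous d2.
have [F1 dF1] : exists F, deriv_of F (fun x => w1 x ^+ 2) by apply: ex_primitive; cts.
have [F2 dF2] : exists F, deriv_of F (fun x => w2 x ^+ 2) by apply: ex_primitive; cts.
have [G1 dG1] : exists F, deriv_of F (fun x => w1' x ^+ 2) by apply: ex_primitive; cts.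
have [G2 dG2] : exists F, deriv_of F (fun x => w2' x ^+ 2) by apply: ex_primitive; cts.
have dF : deriv_of (fun x => F1 x + F2 x) (fun x => w1 x ^+ 2 + w2 x ^+ 2).
  by move=> x; isd.
have dG : deriv_of (fun x => G1 x + G2 x) (fun x => w1' x ^+ 2 + w2' x ^+ 2).
  by move=> x; isd.
rewrite -(ler_pM2l (twopi_gt0 R)).
have := H1 _ _ dF1 dG1; have := H2 _ _ dF2 dG2.
have -> : (pi / (2 * pi)) ^+ 2 = 1 / 4 :> R.
  by move: (@pi R) (pi_gt0 R) => q q0; field; rewrite gt_eqF.
have cF : continuous (fun x => w1 x ^+ 2 + w2 x ^+ 2) by cts.
have cG : continuous (fun x => w1' x ^+ 2 + w2' x ^+ 2) by cts.
have /= := sint_deriv_from s cF dF pw; have /= := sint_deriv_from s cG dG pw'.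
set A := sint _; set B := sint _; clearbody A B.
move: (F1 (s + _)) (F1 s) (F2 (s + _)) (F2 s) (G1 (s + _)) (G1 s) (G2 (s + _)) (G2 s).
move: (@pi R); clear => q f1 f2 f3 f4 g1 g2 g3 g4.
lra.
Qed.

(* With [c = 1 / (2 I)] and [I] the mean of [u^-2], the phase of [u e^(i chi)],
   [chi' = c / u^2], grows by exactly [pi] over a period. *)
Lemma inverse_square_ineq u (u' : R -> R) : deriv_of u u' -> continuous u' ->
  (forall x, u x != 0) -> (forall x, u (x + 2 * pi) = u x) ->
  sint (fun x => u x ^+ 2) <=
  4 * sint (fun x => u' x ^+ 2) + (sint (fun x => (u x ^+ 2)^-1))^-1.
Proof.
move=> du cu' u0 up; have cu := deriv_of_continuous du.
have u'p x : u' (x + 2 * pi) = u' x.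
  by rewrite (deriv_translate (e := 1) du) ?mul1r // => y; rewrite mul1r.
have ci : continuous (fun x => (u x ^+ 2)^-1).
  by cts => x; rewrite expf_neq0.
set I := sint (fun x => (u x ^+ 2)^-1).
have I0 : 0 < I.
  by apply: sint_gt0 => // x; rewrite invr_gt0 exprn_even_gt0 //= u0.
pose c := (2 * I)^-1.
have [H dH] := ex_primitive ci.
pose chi x := c * H x.
have dchi : deriv_of chi (fun x => c / u x ^+ 2) by move=> x; rewrite /chi; derive; ring.
have aux (q h i : R) : 0 < i -> (2 * i)^-1 * (h + 2 * q * i) = (2 * i)^-1 * h + q.
  by move=> i0; field; rewrite gt_eqF.
have chip x : chi (x + 2 * pi) = chi x + pi.
  have := sint_deriv_from x ci dH (fun z => congr1 (fun w => (w ^+ 2)^-1) (up z)).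
  rewrite -/I => E; rewrite /chi (_ : H (x + 2 * pi) = H x + 2 * pi * I); last first.
    by move: E => <-; ring.
  exact: aux.
pose w1 x := u x * cos (chi x); pose w2 x := u x * sin (chi x).
pose w1' x := u' x * cos (chi x) - c / u x * sin (chi x).
pose w2' x := u' x * sin (chi x) + c / u x * cos (chi x).
have d1 : deriv_of w1 w1'.
  by move=> x; rewrite /w1 /w1'; derive; field; exact: u0.
have d2 : deriv_of w2 w2'.
  by move=> x; rewrite /w2 /w2'; derive; field; exact: u0.
have cchi := deriv_of_continuous dchi.
have c1' : continuous w1' by rewrite /w1'; cts.
have c2' : continuous w2' by rewrite /w2'; cts.
have w1p x : w1 (x + 2 * pi) = - w1 x by rewrite /w1 up chip cosDpi mulrN.
have w2p x : w2 (x + 2 * pi) = - w2 x by rewrite /w2 up chip sinDpi mulrN.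
have w1'p x : w1' (x + 2 * pi) = - w1' x.
  by rewrite /w1' u'p up chip cosDpi sinDpi; ring.
have w2'p x : w2' (x + 2 * pi) = - w2' x.
  by rewrite /w2' u'p up chip cosDpi sinDpi; ring.
have sq : (fun x => w1 x ^+ 2 + w2 x ^+ 2) = (fun x => u x ^+ 2).
  apply/funext => x; rewrite /w1 /w2 !exprMn -mulrDr cos2Dsin2 mulr1 //.
(* Radial and angular parts of the derivative are orthogonal, so no cross term appears. With
   [c = 1 / (2 I)] the angular part contributes [4 c^2 I = 1 / I]. *)
have sq' : (fun x => w1' x ^+ 2 + w2' x ^+ 2) = (fun x => u' x ^+ 2 + c ^+ 2 * (u x ^+ 2)^-1).
  apply/funext => x; rewrite /w1' /w2'.
  rewrite -[RHS]mulr1 -(cos2Dsin2 (chi x)).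
  by field; exact: u0.
have := @sint_wirtinger_2pi w1 w2 w1' w2' 0 d1 d2 c1' c2'.
rewrite sq sq' sintD; [|by cts|by cts => //; exact: ci].
rewrite sintZ // -/I.
have -> : 4 * (sint (fun x => u' x ^+ 2) + c ^+ 2 * I) = 4 * sint (fun x => u' x ^+ 2) + I^-1.
  by rewrite /c; field; rewrite gt_eqF.
apply.
- by move=> F G dF dG; exact: (wirtinger_antiperiodic _ (twopi_gt0 R) d1 dF dG w1p w1'p).
- by move=> F G dF dG; exact: (wirtinger_antiperiodic _ (twopi_gt0 R) d2 dF dG w2p w2'p).
- by move=> x; rewrite w1p w2p !sqrrN.
- by move=> x; rewrite w1'p w2'p !sqrrN.
Qed.

(** The counterpart of [inverse_square_ineq] for a function with a zero, for which the
    inverse-square term is 0 by convention. *)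
Lemma dirichlet_2pi u (u' : R -> R) z : deriv_of u u' -> continuous u' ->
  u z = 0 -> (forall x, u (x + 2 * pi) = u x) ->
  sint (fun x => u x ^+ 2) <= 4 * sint (fun x => u' x ^+ 2).
Proof.
move=> du cu' uz up.
have u'p x : u' (x + 2 * pi) = u' x.
  by rewrite (deriv_translate (e := 1) du) ?mul1r // => y; rewrite mul1r.
have d0 : deriv_of (fun _ : R => 0) (fun _ : R => 0) by move=> x; exact: isdC.
have := @sint_wirtinger_2pi u (fun => 0) u' (fun => 0) z du d0 cu' (@ctsC R 0).
have E (w : R -> R) : (fun x => w x ^+ 2 + 0 ^+ 2) = (fun x => w x ^+ 2).
  by apply/funext => x; rewrite expr0n addr0.
rewrite !E; apply.
- by move=> F G dF dG; apply: (dirichlet_poincare (twopi_gt0 R) du dF dG) => //; rewrite up.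
- move=> F G dF dG; apply: (dirichlet_poincare (twopi_gt0 R) d0 dF dG) => //.
- by move=> x; rewrite up.
- by move=> x; rewrite u'p.
Qed.

(** [f] is the derivative of the argument of [psi = psi1 + i psi2], so
    [c1 + i c2 = psi e^(-i Phi) / |psi|] is constant. As [psi] returns to its value, so does
    [e^(i Phi)], and the increment of [Phi] is a multiple of 2 pi. Excluding the open interval below
    is all that the estimate of [(n - a)^2] requires. *)
Lemma phase_winding (psi1 psi2 g1 g2 f Phi : R -> R) s :
  deriv_of psi1 g1 -> deriv_of psi2 g2 ->
  (forall x, 0 < psi1 x ^+ 2 + psi2 x ^+ 2) ->
  (forall x, f x = (psi1 x * g2 x - psi2 x * g1 x) / (psi1 x ^+ 2 + psi2 x ^+ 2)) ->
  deriv_of Phi f ->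
  psi1 (s + 2 * pi) = psi1 s -> psi2 (s + 2 * pi) = psi2 s ->
  ~~ (0 < Phi (s + 2 * pi) - Phi s < 2 * pi).
Proof.
move=> d1 d2 r0 fE dPhi p1 p2; set T := _ - _.
pose r x := Num.sqrt (psi1 x ^+ 2 + psi2 x ^+ 2).
have rn0 x : r x != 0 by rewrite gt_eqF // sqrtr_gt0.
have r2 x : r x ^+ 2 = psi1 x ^+ 2 + psi2 x ^+ 2 by rewrite sqr_sqrtr // ltW.
pose r' x := (psi1 x * g1 x + psi2 x * g2 x) / r x.
have dr : deriv_of r r'.
  move=> x; rewrite /r /r'; derive; first exact: r0.
  by rewrite -/(r x); field; exact: rn0.
have fE' x : f x * r x ^+ 2 = psi1 x * g2 x - psi2 x * g1 x.
  by rewrite fE r2 divfK // gt_eqF.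
pose c1 x := (psi1 x * cos (Phi x) + psi2 x * sin (Phi x)) / r x.
pose c2 x := (psi2 x * cos (Phi x) - psi1 x * sin (Phi x)) / r x.
have num1 x : (g1 x + psi2 x * f x) * r x ^+ 2 = psi1 x * (r' x * r x).
  by rewrite mulrDl -mulrA fE' r2 /r' divfK //; ring.
have num2 x : (g2 x - psi1 x * f x) * r x ^+ 2 = psi2 x * (r' x * r x).
  by rewrite mulrBl -mulrA fE' r2 /r' divfK //; ring.
have g1E x : g1 x = psi1 x * r' x / r x - psi2 x * f x.
  apply: (mulIf (expf_neq0 2 (rn0 x))); apply: (addIr (psi2 x * f x * r x ^+ 2)).
  by rewrite -mulrDl num1; field; exact: rn0.
have g2E x : g2 x = psi2 x * r' x / r x + psi1 x * f x.
  apply: (mulIf (expf_neq0 2 (rn0 x))); apply: (subIr (psi1 x * f x * r x ^+ 2)).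
  by rewrite -mulrBl num2; field; exact: rn0.
have dc1 : deriv_of c1 (fun=> 0).
  by move=> x; rewrite /c1; derive; [exact: rn0|rewrite g1E g2E; field; exact: rn0].
have dc2 : deriv_of c2 (fun=> 0).
  by move=> x; rewrite /c2; derive; [exact: rn0|rewrite g1E g2E; field; exact: rn0].
have cst1 : c1 (s + 2 * pi) = c1 s.
  exact: (@is_derive_0_is_cst _ c1 _ _ dc1).
have cst2 : c2 (s + 2 * pi) = c2 s.
  exact: (@is_derive_0_is_cst _ c2 _ _ dc2).
have rp : r (s + 2 * pi) = r s by rewrite /r p1 p2.
have cosE x : cos (Phi x) = (psi1 x * c1 x + psi2 x * c2 x) / r x.
  rewrite (_ : _ / _ = cos (Phi x) * (psi1 x ^+ 2 + psi2 x ^+ 2) / r x ^+ 2).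
    by rewrite r2 mulfK // gt_eqF.
  by rewrite /c1 /c2; field; exact: rn0.
have sinE x : sin (Phi x) = (psi2 x * c1 x - psi1 x * c2 x) / r x.
  rewrite (_ : _ / _ = sin (Phi x) * (psi1 x ^+ 2 + psi2 x ^+ 2) / r x ^+ 2).
    by rewrite r2 mulfK // gt_eqF.
  by rewrite /c1 /c2; field; exact: rn0.
have cosT : cos T = 1.
  rewrite /T cosB (cosE (s + _)) (sinE (s + _)) p1 p2 rp cst1 cst2 -cosE -sinE -!expr2.
  exact: cos2Dsin2.
apply/negP => /andP[T0 T2].
have : 0 < sin (T / 2) by apply: sin_gt0_pi; move: T0 T2; clear; lra.
move: cosT; rewrite {1}(_ : T = T / 2 + T / 2); last by field.
by rewrite cosD -!expr2 cos2sin2; nra.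
Qed.

(* When [psi] does not vanish this interpolates between the diamagnetic inequality
   ([a = 0]) and [inverse_square_ineq]; a winding number [n] costs
   [(n - a)^2 >= a^2]. *)
Lemma magnetic_C1 (psi1 psi2 g1 g2 : R -> R) a d : 0 < a < 1 / 2 -> 0 < d ->
  deriv_of psi1 g1 -> deriv_of psi2 g2 -> continuous g1 -> continuous g2 ->
  (forall x, psi1 (x + 2 * pi) = psi1 x) -> (forall x, psi2 (x + 2 * pi) = psi2 x) ->
  (1 - 4 * a ^+ 2) * sint (fun x => ((psi1 x * g1 x + psi2 x * g2 x) /
      Num.sqrt (psi1 x ^+ 2 + psi2 x ^+ 2 + d ^+ 2)) ^+ 2) +
    a ^+ 2 * sint (fun x => psi1 x ^+ 2 + psi2 x ^+ 2) <=
  sint (fun x => (g1 x + a * psi2 x) ^+ 2 + (g2 x - a * psi1 x) ^+ 2).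
Proof.
move=> /andP[a0 a1] d0 d1 d2 cg1 cg2 p1 p2.
have c1 := deriv_of_continuous d1; have c2 := deriv_of_continuous d2.
have p1' x : g1 (x + 2 * pi) = g1 x.
  by rewrite (deriv_translate (e := 1) d1) ?mul1r // => y; rewrite mul1r.
have p2' x : g2 (x + 2 * pi) = g2 x.
  by rewrite (deriv_translate (e := 1) d2) ?mul1r // => y; rewrite mul1r.
have a2 : 0 < 1 - 4 * a ^+ 2 by nra.
pose P x := psi1 x ^+ 2 + psi2 x ^+ 2.
(* The shift [d] keeps the modulus smooth and positive where [psi] vanishes, as Beckner's inequality
   for C^1 functions demands. *)
pose Rd x := Num.sqrt (P x + d ^+ 2).
have P0 x : 0 <= P x by rewrite addr_ge0 ?sqr_ge0.
have Pd0 x : 0 < P x + d ^+ 2 by rewrite ltr_wpDl // exprn_gt0.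
have Rd0 x : Rd x != 0 by rewrite gt_eqF // sqrtr_gt0.
have Rd2 x : Rd x ^+ 2 = P x + d ^+ 2 by rewrite sqr_sqrtr // ltW.
have cP : continuous P by rewrite /P; cts.
have cRd : continuous Rd by rewrite /Rd; cts.
pose A x := (g1 x + a * psi2 x) ^+ 2 + (g2 x - a * psi1 x) ^+ 2.
have A0 x : 0 <= A x by rewrite addr_ge0 ?sqr_ge0.
have cA : continuous A by rewrite /A; cts.
pose S x := psi1 x * g1 x + psi2 x * g2 x.
have cS : continuous S by rewrite /S; cts.
change ((1 - 4 * a ^+ 2) * sint (fun x => (S x / Rd x) ^+ 2) + a ^+ 2 * sint P <= sint A).
(* If [psi] has a zero [z], the gauge [w = e^(-i a x) psi] turns [psi' - i a psi] into [w']. It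
   destroys periodicity, but [w] still vanishes at [z] and at [z + 2 * pi]. *)
have [[z /eqP Pz]|nz] := pselect (exists z, P z == 0).
  have [z1 z2] : psi1 z = 0 /\ psi2 z = 0.
    move: Pz => /eqP; rewrite /P paddr_eq0 ?sqr_ge0 // !sqrf_eq0 => /andP[/eqP -> /eqP ->].
    by [].
  pose w1 x := cos (a * x) * psi1 x + sin (a * x) * psi2 x.
  pose w2 x := cos (a * x) * psi2 x - sin (a * x) * psi1 x.
  pose w1' x := cos (a * x) * (g1 x + a * psi2 x) + sin (a * x) * (g2 x - a * psi1 x).
  pose w2' x := cos (a * x) * (g2 x - a * psi1 x) - sin (a * x) * (g1 x + a * psi2 x).
  have dw1 : deriv_of w1 w1' by move=> x; rewrite /w1 /w1'; derive; ring.
  have dw2 : deriv_of w2 w2' by move=> x; rewrite /w2 /w2'; derive; ring.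
  have cw1' : continuous w1' by rewrite /w1'; cts.
  have cw2' : continuous w2' by rewrite /w2'; cts.
  have sq : (fun x => w1 x ^+ 2 + w2 x ^+ 2) = P.
    apply/funext => x; rewrite -[RHS]mul1r -(cos2Dsin2 (a * x)) /w1 /w2 /P; ring.
  have sq' : (fun x => w1' x ^+ 2 + w2' x ^+ 2) = A.
    apply/funext => x; rewrite -[RHS]mul1r -(cos2Dsin2 (a * x)) /w1' /w2' /A; ring.
  have w1z x : P x = 0 -> w1 x = 0 /\ w2 x = 0.
    move=> /eqP; rewrite /P paddr_eq0 ?sqr_ge0 // !sqrf_eq0 /w1 /w2 => /andP[/eqP -> /eqP ->].
    by rewrite !mulr0 subr0 addr0.
  have Pp x : P (x + 2 * pi) = P x by rewrite /P p1 p2.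
  have [z3 z4] := w1z _ Pz.
  have [z5 z6] : w1 (z + 2 * pi) = 0 /\ w2 (z + 2 * pi) = 0 by apply: w1z; rewrite Pp.
  have := @sint_wirtinger_2pi w1 w2 w1' w2' z dw1 dw2 cw1' cw2'.
  rewrite sq sq' => W.
  have LA : sint P <= 4 * sint A.
    apply: W.
    - move=> F G dF dG; exact: (dirichlet_poincare (twopi_gt0 R) dw1 dF dG z3 z5).
    - move=> F G dF dG; exact: (dirichlet_poincare (twopi_gt0 R) dw2 dF dG z4 z6).
    - move=> x; have := congr1 (fun h => h (x + 2 * pi)) sq; rewrite /= => ->.
      by have := congr1 (fun h => h x) sq; rewrite /= => ->.
    - move=> x; have := congr1 (fun h => h (x + 2 * pi)) sq'; rewrite /= => ->.
      have := congr1 (fun h => h x) sq'; rewrite /= => ->.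
      by rewrite /A p1 p2 p1' p2'.
  (* The diamagnetic inequality: by Lagrange's identity [A P - S^2] is a square. Its share
     [1 - 4 a^2] is then combined with the share [4 a^2] of [LA]. *)
  have DA : sint (fun x => (S x / Rd x) ^+ 2) <= sint A.
    apply: le_sint => [||x _]; [by cts|by []|].
    rewrite expr_div_n Rd2 ler_pdivrMr //.
    apply: (@le_trans _ _ (A x * P x)); last by rewrite ler_wpM2l // lerDl sqr_ge0.
    rewrite -subr_ge0 (_ : _ - _ =
      (psi1 x * (g2 x - a * psi1 x) - psi2 x * (g1 x + a * psi2 x)) ^+ 2) ?sqr_ge0 //.
    by rewrite /A /P /S; ring.
  have := ler_wpM2l (ltW a2) DA; have := ler_wpM2l (sqr_ge0 a) LA.
  by sint_lra.
have Pgt x : 0 < P x.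
  by rewrite lt_neqAle P0 andbT eq_sym; apply/negP => Px; apply: nz; exists x.
pose r x := Num.sqrt (P x).
have rn0 x : r x != 0 by rewrite gt_eqF // sqrtr_gt0.
have r2 x : r x ^+ 2 = P x by rewrite sqr_sqrtr // ltW.
have dr : deriv_of r (fun x => S x / r x).
  move=> x; rewrite /r /P /S; derive; first exact: Pgt.
  by field; exact: rn0.
have cr := deriv_of_continuous dr.
have rp x : r (x + 2 * pi) = r x by rewrite /r /P p1 p2.
have cr' : continuous (fun x => S x / r x) by cts.
pose f x := (psi1 x * g2 x - psi2 x * g1 x) / P x.
have cf : continuous f by rewrite /f; cts => x; rewrite gt_eqF.
have fp x : f (x + 2 * pi) = f x by rewrite /f /P p1 p2 p1' p2'.
have [Phi dPhi] := ex_primitive cf.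
have := @phase_winding psi1 psi2 g1 g2 f Phi 0 d1 d2 Pgt (fun=> erefl) dPhi (p1 0) (p2 0).
rewrite (sint_deriv_from 0 cf dPhi fp) => wind.
(* The mean of [f] is at most 0 or at least 1, and [a < 1/2]. *)
have sf : a ^+ 2 <= (sint f - a) ^+ 2.
  have tp := twopi_gt0 R.
  have : sint f <= 0 \/ 1 <= sint f.
    move: wind; rewrite -{3}[2 * pi]mulr1 pmulr_rgt0 // ltr_pM2l // negb_and -!leNgt.
    by move=> /orP[]; [left|right].
  by move=> [s0|s1]; nra.
have ehl := inverse_square_ineq dr cr' rn0 rp.
have E1 : sint (fun x => r x ^+ 2) = sint P by apply: eq_sint => x; rewrite r2.
rewrite E1 in ehl.
set I := sint (fun x => (r x ^+ 2)^-1) in ehl.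
have I0 : 0 < I.
  apply: sint_gt0 => [|x]; first by cts => x; rewrite expf_neq0.
  by rewrite invr_gt0 exprn_even_gt0 //= rn0.
(* Cauchy-Schwarz for the factors [r (f - a)] and [1 / r] bounds the angular energy below by
   [(sint f - a)^2 / I]. *)
have cs := @sint_cauchy_schwarz _ (fun x => r x * (f x - a)) (fun x => (r x)^-1)
  ltac:(cts) ltac:(cts).
have E2 : sint (fun x => r x * (f x - a) * (r x)^-1) = sint f - a.
  rewrite -[X in _ - X](sint_cst a) -sintB; [|by cts|by cts].
  by apply: eq_sint => x; field; exact: rn0.
have E3 : sint (fun x => (r x)^-1 ^+ 2) = I by apply: eq_sint => x; rewrite exprVn.
rewrite E2 E3 in cs.
(* Polar coordinates: [|psi' - i a psi|^2 = r'^2 + r^2 (f - a)^2]. *)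
have split_A : sint A = sint (fun x => (S x / r x) ^+ 2) + sint (fun x => (r x * (f x - a)) ^+ 2).
  rewrite -sintD; [|by cts|by cts]; apply: eq_sint => x.
  have P1 : P x != 0 by rewrite gt_eqF.
  rewrite expr_div_n (exprMn _ (r x)) !r2 /f /A /S; move: P1; rewrite /P => P1; field.
  exact: P1.
have DD : sint (fun x => (S x / Rd x) ^+ 2) <= sint (fun x => (S x / r x) ^+ 2).
  apply: le_sint => [||x _]; [by cts|by cts|].
  rewrite !expr_div_n r2 Rd2 ler_wpM2l ?sqr_ge0 // lef_pV2 ?posrE //.
  by rewrite lerDl sqr_ge0.
have K : a ^+ 2 * I^-1 <= sint (fun x => (r x * (f x - a)) ^+ 2).
  by rewrite ler_pdivrMr //; exact: (le_trans sf (cs rn0)).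
have := ler_wpM2l (ltW a2) DD; have := ler_wpM2l (sqr_ge0 a) ehl.
move: K; rewrite split_A; move: (I^-1) => J; sint_lra.
Qed.

End MagneticC1.

(** * Regularization of H^1 functions *)

Section RealIntegrable.
Variable R : realType.
Local Notation leb := (@lebesgue_measure R).
Implicit Types (f g w W : R -> R).

Definition rintegrable (D : set R) f : Prop := leb.-integrable D (fun x => (f x)%:E).

Lemma rintegrableD (i : interval R) f g :
  rintegrable [set` i] f -> rintegrable [set` i] g ->
  rintegrable [set` i] (fun x => f x + g x).
Proof. by move=> fi gi; apply: (@integrableD _ _ _ leb [set` i] _ (EFin \o f) (EFin \o g)). Qed.

Lemma rintegrableZ (i : interval R) c f : rintegrable [set` i] f ->
  rintegrable [set` i] (fun x => c * f x).
Proof. by move=> fi; apply: (@integrableZl _ _ _ leb [set` i] _ c (EFin \o f)). Qed.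

Lemma rintegrable_cst a b c : rintegrable `[a, b] (fun=> c).
Proof. exact: integrable_cts (@ctsC R c). Qed.

Lemma Rintegral_cst_itv a b c : a <= b -> \int[leb]_(x in `[a, b]) c = c * (b - a).
Proof.
move=> ab; rewrite (@Rintegral_deriv _ (fun x => c * x) _ _ _ ab).
- by ring.
- exact: ctsC.
- by move=> x; derive; ring.
Qed.

Lemma rintegrable_sqr_closed w : rintegrable `[- pi, pi[ (fun x => w x ^+ 2) ->
  rintegrable `[- pi, pi] (fun x => w x ^+ 2).
Proof.
move=> /integrableP[mw wi]; apply/integrableP; split.
  by apply/measurable_EFinP/measurable_fun_itv_bndo_bndcP/measurable_EFinP.
rewrite -integral_itv_bndo_bndc //.
exact/measurableT_comp.
Qed.

Lemma sub_itv_cc (a b c d : R) : a <= c -> d <= b -> `[c, d]%classic `<=` `[a, b]%classic.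
Proof. by move=> ac db; apply: subset_itv; rewrite bnd_simp. Qed.

Lemma Rintegral_chasles f a b c : a <= b -> b <= c -> rintegrable `[a, c] f ->
  \int[leb]_(x in `[a, c]) f x - \int[leb]_(x in `[a, b]) f x =
  \int[leb]_(x in `[b, c]) f x.
Proof.
move=> ab bc fi; rewrite Rintegral_itvB ?bnd_simp // Rintegral_itv_obnd_cbnd //.
apply: integrableS fi => //; apply: subset_itvr.
by rewrite bnd_simp.
Qed.

(** Cauchy-Schwarz for the increment of a primitive, left as a polynomial in [t]: in this form the
    estimates on two intervals can simply be added. *)
Lemma incr_quadratic w a b t : a <= b -> rintegrable `[a, b] w ->
  rintegrable `[a, b] (fun x => w x ^+ 2) ->
  0 <= \int[leb]_(x in `[a, b]) (w x ^+ 2) + 2 * t * \int[leb]_(x in `[a, b]) w x +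
       t ^+ 2 * (b - a).
Proof.
move=> ab wi w2i.
rewrite -(Rintegral_cst_itv (t ^+ 2) ab) -RintegralZl // -RintegralD //; last first.
  exact: (rintegrableZ (2 * t) wi).
rewrite -RintegralD //; last 2 first.
- exact: (rintegrableD w2i (rintegrableZ (2 * t) wi)).
- exact: rintegrable_cst.
apply: Rintegral_ge0 => x _.
by rewrite (_ : _ + _ = (w x + t) ^+ 2) ?sqr_ge0 //; ring.
Qed.

Lemma clamp_continuous (J : R -> R) a b : a <= b ->
  {within `[a, b], continuous J} -> continuous (fun x => J (Num.min (Num.max x a) b)).
Proof.
move=> ab /subspace_continuousP cJ x.
set c := fun y : R => Num.min (Num.max y a) b.
have cin y : `[a, b]%classic (c y).
  by rewrite /= in_itv /= /c le_min ge_min lexx orbT !andbT le_max lexx orbT ab.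
have cc : c y @[y --> x] --> c x.
  apply: (@continuous_min R R (fun y => Num.max y a) (fun=> b)).
    apply: (@continuous_max R R (fun y => y) (fun=> a)); first exact: cvg_id.
    exact: cvg_cst.
  exact: cvg_cst.
apply: cvg_trans (cJ _ (cin x)).
move=> S HS; have HS' : nbhs (c x) (fun z => `[a, b]%classic z -> S (J z)) := HS.
have H := cc _ HS'; rewrite !nbhs_simpl /= in H *.
by apply: filterS H => y /=; apply; exact: cin.
Qed.

End RealIntegrable.

Section Regularization.
Variable R : realType.
Local Notation leb := (@lebesgue_measure R).
Implicit Types (u g w W : R -> R).

Lemma periodic_ind (Q : R -> Prop) : (forall x, Q x <-> Q (x + 2 * pi)) ->
  (forall x, - pi <= x <= pi -> Q x) -> forall x, Q x.
Proof.
move=> Qp Q0 x.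
have up n y : - pi <= y <= pi + n%:R * (2 * pi) -> Q y.
  elim: n y => [|n IH] y /andP[y1 y2].
    by apply: Q0; rewrite y1 /=; move: y2; rewrite mul0r addr0.
  have [yp|yp] := leP y pi; first by apply: Q0; rewrite y1.
  rewrite -(subrK (2 * pi) y); apply: (proj1 (Qp _)); apply: IH.
  move: y2; rewrite -natr1 mulrDl mul1r; move: (n%:R * _) yp => z yp y2.
  by move: (@pi R) yp y2; clear => q yp y2; lra.
have down n y : - pi - n%:R * (2 * pi) <= y -> Q y.
  elim: n y => [|n IH] y y1.
    have [m ym] : exists m : nat, y <= m%:R * (2 * pi).
      exists (Num.truncn (y / (2 * pi))).+1.
      by rewrite -ler_pdivrMr ?twopi_gt0 // ltW // truncnS_gt.
    apply: (up m); move: y1; rewrite mul0r subr0 => -> /=.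
    by apply: (le_trans ym); rewrite lerDr pi_ge0.
  apply: (proj2 (Qp _)); apply: IH; move: y1; rewrite -natr1 mulrDl mul1r; move: (n%:R * _) => z.
  by move: (@pi R); clear => q; lra.
have [m xm] : exists m : nat, - x <= m%:R * (2 * pi).
  exists (Num.truncn (- x / (2 * pi))).+1.
  by rewrite -ler_pdivrMr ?twopi_gt0 // ltW // truncnS_gt.
apply: (down m); move: xm (pi_ge0 R); move: (m%:R * _) => z; move: (@pi R); clear => q; lra.
Qed.

Lemma sint_sqr_Rintegral w : rintegrable `[- pi, pi[ (fun x => w x ^+ 2) ->
  2 * pi * sint (fun x => w x ^+ 2) = \int[leb]_(x in `[- pi, pi]) (w x ^+ 2).
Proof.
move=> wi; rewrite /sint mulrA divff ?mul1r ?gt_eqF ?twopi_gt0 //.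
exact: Rintegral_itv_bndo_bndc.
Qed.

(** Only the increment of [W] over a period is constant. Periodicity itself would be too much:
    [u + c * P], with [P] a primitive of a periodic function of nonzero mean, does not have it. *)
Definition primitive_L2 W w : Prop :=
  [/\ forall s t, s <= t -> rintegrable `[s, t] w,
      rintegrable `[- pi, pi[ (fun x => w x ^+ 2),
      forall s t, s <= t -> W t - W s = \int[leb]_(x in `[s, t]) w x &
      forall x y, W (x + 2 * pi) - W x = W (y + 2 * pi) - W y].

(* [w] is only square integrable on one period, so its energy is transported to the
   next period through the increments of [W]. *)
Lemma energy_profile W w : primitive_L2 W w -> exists G : R -> R,
  [/\ continuous G, {homo G : x y / x <= y},
      forall x, - pi <= x <= pi -> G (x + 2 * pi) - G x = 2 * pi * sint (fun x => w x ^+ 2) &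
      forall x h, - pi <= x <= pi -> 0 <= h <= 2 * pi ->
        (W (x + h) - W x) ^+ 2 <= (G (x + h) - G x) * h].
Proof.
move=> [wi w2i Ww Wp].
have w2c := rintegrable_sqr_closed w2i.
have pp := le_Npi_pi R.
pose J x := \int[leb]_(t in `[- pi, x]) (w t ^+ 2).
have JB s t : - pi <= s -> s <= t -> t <= pi ->
    J t - J s = \int[leb]_(x in `[s, t]) (w x ^+ 2).
  move=> s1 st t1; apply: Rintegral_chasles => //.
  by apply: integrableS w2c => //; exact: sub_itv_cc.
have Jmono s t : - pi <= s -> s <= t -> t <= pi -> J s <= J t.
  move=> s1 st t1; rewrite -subr_ge0 JB //.
  by apply: Rintegral_ge0 => x _; exact: sqr_ge0.
have J0 : J (- pi) = 0 by rewrite /J set_itv1 Rintegral_set1.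
(* [w^2] is known to be integrable on one period only; clamping extends its cumulated energy [J] to
   a continuous monotone function on the line. *)
pose cl x : R := Num.min (Num.max x (- pi)) pi.
have clin x : - pi <= cl x <= pi.
  by rewrite /cl le_min ge_min lexx orbT !andbT le_max lexx orbT pp.
have cl_id x : - pi <= x <= pi -> cl x = x.
  by move=> /andP[x1 x2]; rewrite /cl (max_idPl x1) (min_idPl x2).
have cl_lo x : x <= - pi -> cl x = - pi.
  by move=> x1; rewrite /cl (max_idPr x1) (min_idPl pp).
have cl_hi x : pi <= x -> cl x = pi.
  by move=> x1; rewrite /cl (max_idPl (le_trans pp x1)) (min_idPr x1).
have cl_mono x y : x <= y -> cl x <= cl y.
  by move=> xy; rewrite /cl; apply: le_min2 => //; exact: le_max2.
pose gam x := J (cl x).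
have cgam : continuous gam.
  apply: clamp_continuous => //.
  exact: parameterized_integral_continuous.
have gmono x y : x <= y -> gam x <= gam y.
  move=> xy; rewrite /gam; have /andP[a1 a2] := clin x; have /andP[b1 b2] := clin y.
  by apply: Jmono => //; exact: cl_mono.
have incr s t e : - pi <= s -> s <= t -> t <= pi ->
    0 <= (J t - J s) + 2 * e * (W t - W s) + e ^+ 2 * (t - s).
  move=> s1 st t1; rewrite JB // Ww //; apply: incr_quadratic => //; first exact: wi.
  by apply: integrableS w2c => //; exact: sub_itv_cc.
(* The second copy continues the first over [[pi, 3 pi]], which contains every [x + h] beyond
   [pi]. *)
exists (fun x => gam x + gam (x - 2 * pi)); split.
- by cts.
- by move=> x y xy; apply: lerD; apply: gmono => //; rewrite lerD2r.
- move=> x /andP[x1 x2]; rewrite addrK sint_sqr_Rintegral //.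
  have p0 := pi_ge0 R.
  have -> : gam (x + 2 * pi) = J pi.
    by rewrite /gam cl_hi //; move: (@pi R) x1 p0; clear => q; lra.
  have -> : gam (x - 2 * pi) = 0.
    by rewrite /gam cl_lo ?J0 //; move: (@pi R) x2 p0; clear => q; lra.
  by rewrite /J; ring.
- move=> x h /andP[x1 x2] /andP[h0 h1].
  rewrite mulrC [leRHS]mulrC; apply: discriminant_le => // e.
  have p0 := pi_ge0 R.
  have g0 : gam (x - 2 * pi) = 0.
    by rewrite /gam cl_lo ?J0 //; move: (@pi R) x2 p0; clear => q; lra.
  have gx : gam x = J x by rewrite /gam cl_id // x1.
  rewrite g0 gx addr0.
  have [hp|hp] := leP (x + h) pi.
    have -> : gam (x + h - 2 * pi) = 0.
      by rewrite /gam cl_lo ?J0 //; move: (@pi R) hp p0; clear => q; lra.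
    have xh : x <= x + h by rewrite lerDl.
    rewrite addr0 {1}/gam cl_id ?hp ?andbT; last by exact: le_trans xh.
    by have := incr x (x + h) e x1 xh hp; rewrite (_ : x + h - x = h) //; ring.
  (* The interval crosses [pi]. The part beyond it is moved back by a period, and the two quadratic
     estimates are added. *)
  have y1 : - pi <= x + h - 2 * pi by move: (@pi R) hp; clear => q; lra.
  have y2 : x + h - 2 * pi <= pi by move: (@pi R) x2 h1; clear => q; lra.
  have -> : gam (x + h) = J pi by rewrite /gam cl_hi // ltW.
  have -> : gam (x + h - 2 * pi) = J (x + h - 2 * pi) by rewrite /gam cl_id // y1.
  have := incr _ _ e x1 x2 (lexx pi).
  have := incr _ _ e (lexx (- pi)) y1 y2; rewrite J0 subr0.
  have := Wp (- pi) (x + h - 2 * pi).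
  rewrite subrK (_ : - pi + 2 * pi = pi); last by ring.
  move: (W pi) (W (- pi)) (W (x + h)) (W x) (W (x + h - 2 * pi)) (J pi) (J x) (J _).
  move: (@pi R); clear => q a b c d f j1 j2 j3; move=> E A B.
  have := addr_ge0 A B; rewrite (_ : f = c - (a - b)); last by move: E; clear; lra.
  by congr (_ <= _); ring.
Qed.

End Regularization.

(** * Steklov averages *)

Section Steklov.
Variable R : realType.
Local Notation leb := (@lebesgue_measure R).
Implicit Types (u g w W : R -> R).

Lemma sint_sqr_ge0 w : 0 <= sint (fun x => w x ^+ 2).
Proof.
rewrite /sint mulr_ge0 ?invr_ge0 ?(ltW (twopi_gt0 R)) // fine_ge0 //.
by apply: integral_ge0 => x _; rewrite lee_fin sqr_ge0.
Qed.

Lemma primitive_L2_hoelder W w h x : primitive_L2 W w -> 0 <= h <= 2 * pi ->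
  (W (x + h) - W x) ^+ 2 <= 2 * pi * sint (fun x => w x ^+ 2) * h.
Proof.
move=> Ww h01; have [G [_ Gm GI Gh]] := energy_profile Ww.
have [_ _ _ Wp] := Ww.
pattern x; apply: periodic_ind => {}x.
  have := Wp (x + h) x; rewrite (addrAC x h) => E.
  rewrite (_ : W (x + 2 * pi + h) - W (x + 2 * pi) = W (x + h) - W x) //.
  by move: E; clear; lra.
move=> x1; apply: (le_trans (Gh x h x1 h01)).
apply: ler_wpM2r; first by case/andP: h01.
by rewrite -(GI x x1) lerD2r; apply: Gm; rewrite lerD2l; case/andP: h01.
Qed.

Lemma primitive_L2_dist W w (e : R) : primitive_L2 W w -> 0 < e ->
  exists d, [/\ 0 < d, d <= 2 * pi &
    forall x y, `|y - x| <= d -> `|W y - W x| <= e].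
Proof.
move=> Ww e0; set C := 2 * pi * sint (fun x => w x ^+ 2).
have C0 : 0 <= C by rewrite mulr_ge0 ?sint_sqr_ge0 // ltW // twopi_gt0.
have C1 : 0 < C + 1 by rewrite ltr_wpDl.
pose d := Num.min (2 * pi) (e ^+ 2 / (C + 1)).
have d0 : 0 < d by rewrite lt_min twopi_gt0 divr_gt0 // exprn_gt0.
exists d; split => //; first by rewrite ge_min lexx.
suff H x h : 0 <= h <= d -> `|W (x + h) - W x| <= e.
  move=> x y; have [xy|xy] := leP x y => xyd.
    rewrite -(subrKC x y); apply: H; rewrite subr_ge0 xy /=.
    by move: xyd; rewrite ger0_norm // subr_ge0.
  rewrite distrC -(subrKC y x); apply: H.
  rewrite subr_ge0 (ltW xy) /=.
  by move: xyd; rewrite distrC gtr0_norm // subr_gt0.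
move=> /andP[h0 h1]; rewrite -(@ler_pXn2r _ 2) ?nnegrE ?normr_ge0 ?(ltW e0) //.
rewrite real_normK ?num_real //.
apply: (le_trans (primitive_L2_hoelder x Ww _)).
  by rewrite h0 (le_trans h1) // ge_min lexx.
have hd : h <= e ^+ 2 / (C + 1) by rewrite (le_trans h1) // ge_min lexx orbT.
rewrite -/C; move: hd; rewrite ler_pdivlMr // => hd.
by apply: le_trans hd; rewrite mulrC ler_wpM2l // lerDl.
Qed.

Lemma primitive_L2_continuous W w : primitive_L2 W w -> continuous W.
Proof.
move=> Ww x; apply/cvgrPdist_le => e e0.
have [d [d0 _ H]] := primitive_L2_dist Ww e0.
near=> y; apply: H; near: y.
exact: (@cvgr_dist_le _ _ _ _ _ (@id R) _ cvg_id).
Unshelve. all: by end_near. Qed.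

(** Pointwise the squared difference quotient is at most [(G (x + h) - G x) / h]. The mean of this
    over a period can also be written as an average over [k] in [[0, h]] of the increments of [G]
    from [- pi + k] to [pi + k], all of which equal the full energy. *)
Lemma steklov_energy W w h : primitive_L2 W w -> 0 < h <= 2 * pi ->
  sint (fun x => ((W (x + h) - W x) / h) ^+ 2) <= sint (fun x => w x ^+ 2).
Proof.
move=> Ww /andP[h0 h1]; have cW := primitive_L2_continuous Ww.
have [G [cG _ GI Gh]] := energy_profile Ww.
have p0 := pi_ge0 R.
apply: (@le_trans _ _ (sint (fun x => h^-1 * (G (x + h) - G x)))).
  apply: le_sint => [||x xpi]; [by cts|by cts|].
  rewrite expr_div_n ler_pdivrMr ?exprn_gt0 //.
  rewrite [leRHS](_ : _ = (G (x + h) - G x) * h); last by field; rewrite gt_eqF.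
  by apply: Gh => //; rewrite h1 ltW.
have [P dP] := ex_primitive cG.
rewrite (@sint_deriv _ (fun x => h^-1 * (P (x + h) - P x))); first last.
- by move=> x; derive; ring.
- by cts.
set I := sint _ in GI *.
(* Its derivative vanishes on [[0, h]]; this performs the exchange of the two averages without a
   double integral. *)
pose D k := P (pi + k) - P (- pi + k) - 2 * pi * I * k.
have dD k : is_derive k (1 : R) D (G (pi + k) - G (- pi + k) - 2 * pi * I).
  by rewrite /D; derive; ring.
have D0 k : 0 <= k <= h -> G (pi + k) - G (- pi + k) - 2 * pi * I = 0.
  move=> /andP[k0 kh]; rewrite -(GI (- pi + k)).
    by rewrite (_ : - pi + k + 2 * pi = pi + k) ?subrr //; ring.
  by move: k0 kh h1; move: (@pi R); clear => q; lra.
have Dle : D h <= D 0.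
  rewrite -lerN2; apply: (nondecreasing_of_deriv (ltW h0) (fun k _ => isdN (dD k))) => k kh.
  by rewrite D0 // oppr0.
move: Dle; rewrite /D !addr0 mulr0 subr0 => Dle.
rewrite -mulrBr mulrCA ler_pdivrMl // ler_pdivrMl ?twopi_gt0 //.
by rewrite mulrA mulrC; move: Dle; clear; lra.
Qed.

Lemma H1_primitive_L2 u g : H1 u g -> primitive_L2 u g.
Proof.
move=> [up [gi [g2 ug]]]; split => // x y.
by rewrite !up !subrr.
Qed.

(** Both components of [psi' - i a psi], namely [g1 + a psi2] and [g2 - a psi1], are derivatives of
    such functions. The magnetic energy is thus a sum of two plain energies, to which
    [steklov_energy] applies without any commutator. *)
Lemma H1_magnetic_primitive (c : R) u g v gv : H1 u g -> H1 v gv -> 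
  exists2 P, deriv_of P v &
  primitive_L2 (fun x => u x + c * P x) (fun x => g x + c * v x).
Proof.
move=> Hu Hv; have cv := primitive_L2_continuous (H1_primitive_L2 Hv).
move: Hu Hv => [up [gi [g2 ug]]] [vp _].
have [P dP] := ex_primitive cv; exists P => //.
have vi s t : rintegrable `[s, t] (fun x => c * v x).
  by apply: integrable_cts; cts.
split.
- by move=> s t st; apply: rintegrableD; [exact: gi|exact: vi].
- have dom : rintegrable `[- pi, pi[ (fun x => 2 * g x ^+ 2 + 2 * (c * v x) ^+ 2).
    apply: rintegrableD; first exact: rintegrableZ.
    have iv : rintegrable `[- pi, pi] (fun x => 2 * (c * v x) ^+ 2).
      by apply: integrable_cts; cts.
    by apply: integrableS iv => //; apply: subset_itvl; rewrite bnd_simp.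
  apply: le_integrable dom => //.
    apply/measurable_EFinP/measurable_funX/measurable_funD.
      have /integrableP[/measurable_EFinP mg _] := gi _ _ (le_Npi_pi R).
      apply: measurable_funS mg => //.
      by apply: subset_itvl; rewrite bnd_simp.
    by apply: measurable_funTS; apply: continuous_measurable_fun; cts.
  move=> x _ /=; rewrite lee_fin !ger0_norm ?sqr_ge0 //.
    by have := sqr_ge0 (g x - c * v x); lra.
  by rewrite addr_ge0 // mulr_ge0 ?sqr_ge0.
- move=> s t st; rewrite RintegralD //; last 2 first.
  + exact: gi.
  + exact: vi.
  rewrite -ug // (@Rintegral_deriv _ (fun x => c * P x) _ _ _ st).
  + by ring.
  + by cts.
  + by move=> x; derive; ring.
- move=> x y; rewrite !up.
  have E : P (x + 2 * pi) = P x + (P (y + 2 * pi) - P y).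
    by rewrite -(primitive_periodic dP vp x y) subrKC.
  by rewrite E; ring.
Qed.

Lemma steklov_periodic u (P : R -> R) (h x : R) : deriv_of P u ->
  (forall x, u (x + 2 * pi) = u x) ->
  (P (x + 2 * pi + h) - P (x + 2 * pi)) / h = (P (x + h) - P x) / h.
Proof.
move=> dP up; congr (_ / _); have := primitive_periodic dP up (x + h) x.
by rewrite (addrAC x h); move=> E; move: E; clear; lra.
Qed.

Lemma steklov_close u (P : R -> R) (h e x : R) : deriv_of P u -> 0 < h ->
  (forall y, x <= y <= x + h -> `|u y - u x| <= e) ->
  `|(P (x + h) - P x) / h - u x| <= e.
Proof.
move=> dP h0 H; rewrite -[u x](mulfK (lt0r_neq0 h0)) -mulrBl normrM normfV (gtr0_norm h0).
rewrite ler_pdivrMr //.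
have xh : x <= x + h by rewrite lerDl ltW.
rewrite ler_norml; apply/andP; split.
  have := @nondecreasing_of_deriv _ (fun y => P y - (u x - e) * y)
    (fun y => u y - (u x - e)) _ _ xh.
  move=> /(_ _ _); rewrite -subr_ge0 => K.
  rewrite -subr_ge0; apply: le_trans (K _ _) _.
  - by move=> y _; derive; ring.
  - by move=> y /H; rewrite ler_norml => /andP[]; lra.
  - by rewrite le_eqVlt; apply/orP; left; apply/eqP; ring.
have := @nondecreasing_of_deriv _ (fun y => (u x + e) * y - P y)
    (fun y => (u x + e) - u y) _ _ xh.
move=> /(_ _ _); rewrite -subr_ge0 => K.
rewrite -subr_ge0; apply: le_trans (K _ _) _.
- by move=> y _; derive; ring.
- by move=> y /H; rewrite ler_norml => /andP[]; lra.
- by rewrite le_eqVlt; apply/orP; left; apply/eqP; ring.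
Qed.

(** Averaging commutes with differentiation and with the magnetic term, so [v1' + a v2] is the
    difference quotient of [u1 + a P2], and likewise for the other component. *)
Lemma regularize a u1 g1 u2 g2 e : H1 u1 g1 -> H1 u2 g2 -> 0 < e ->
  exists v1 v2 v1' v2' : R -> R,
  [/\ [/\ deriv_of v1 v1', continuous v1' & forall x, v1 (x + 2 * pi) = v1 x],
      [/\ deriv_of v2 v2', continuous v2' & forall x, v2 (x + 2 * pi) = v2 x],
      forall x, `|v1 x - u1 x| <= e, forall x, `|v2 x - u2 x| <= e &
      sint (fun x => (v1' x + a * v2 x) ^+ 2 + (v2' x - a * v1 x) ^+ 2) <=
      sint (fun x => (g1 x + a * u2 x) ^+ 2 + (g2 x - a * u1 x) ^+ 2)].
Proof.
move=> Hu1 Hu2 e0.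
have L1 := H1_primitive_L2 Hu1; have L2 := H1_primitive_L2 Hu2.
have c1 := primitive_L2_continuous L1; have c2 := primitive_L2_continuous L2.
have [P2 dP2 M1] := H1_magnetic_primitive a Hu1 Hu2.
have [P1 dP1 M2] := H1_magnetic_primitive (- a) Hu2 Hu1.
have [up1 _] := Hu1; have [up2 _] := Hu2.
have [d1 [d10 d1p D1]] := primitive_L2_dist L1 e0.
have [d2 [d20 d2p D2]] := primitive_L2_dist L2 e0.
pose h := Num.min d1 d2.
have h0 : 0 < h by rewrite lt_min d10.
have hp : h <= 2 * pi by rewrite ge_min d1p.
have hn0 : h != 0 by rewrite gt_eqF.
exists (fun x => (P1 (x + h) - P1 x) / h), (fun x => (P2 (x + h) - P2 x) / h),
  (fun x => (u1 (x + h) - u1 x) / h), (fun x => (u2 (x + h) - u2 x) / h); split.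
- split; first by move=> x; derive; ring.
  + by cts.
  + by move=> x; exact: steklov_periodic.
- split; first by move=> x; derive; ring.
  + by cts.
  + by move=> x; exact: steklov_periodic.
- move=> x; apply: steklov_close => // y /andP[y0 y1]; apply: D1.
  rewrite ger0_norm ?subr_ge0 //; apply: (@le_trans _ _ h); last by rewrite ge_min lexx.
  by rewrite lerBlDl.
- move=> x; apply: steklov_close => // y /andP[y0 y1]; apply: D2.
  rewrite ger0_norm ?subr_ge0 //; apply: (@le_trans _ _ h); last by rewrite ge_min lexx orbT.
  by rewrite lerBlDl.
have hh : 0 < h <= 2 * pi by rewrite h0.
have S1 := steklov_energy M1 hh; have S2 := steklov_energy M2 hh.
have cP1 := deriv_of_continuous dP1; have cP2 := deriv_of_continuous dP2.
rewrite sintD; [|by cts|by cts].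
have -> : sint (fun x => (g1 x + a * u2 x) ^+ 2 + (g2 x - a * u1 x) ^+ 2) =
    sint (fun x => (g1 x + a * u2 x) ^+ 2) + sint (fun x => (g2 x + (- a) * u1 x) ^+ 2).
  have [_ I1 _ _] := M1; have [_ I2 _ _] := M2.
  rewrite /sint -mulrDr; congr (_ * _).
  rewrite -fineD; last 2 first.
  - exact: integrable_fin_num.
  - exact: integrable_fin_num.
  rewrite -integralD //; congr fine; apply: eq_integral => x _.
  by rewrite -EFinD mulNr.
apply: lerD.
- apply: le_trans S1; rewrite le_eqVlt; apply/orP; left; apply/eqP/eq_sint => x.
  by congr (_ ^+ 2); field.
- apply: le_trans S2; rewrite le_eqVlt; apply/orP; left; apply/eqP/eq_sint => x.
  by congr (_ ^+ 2); field.
Qed.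

End Steklov.

(** * Passage to H^1 *)

Section Stability.
Variable R : realType.
Implicit Types (r v : R -> R) (p e : R).

Lemma bounded_on_circle r : continuous r ->
  exists2 B : R, 0 <= B & forall x, - pi <= x <= pi -> r x <= B.
Proof.
move=> cr; have [c _ cmax] := @EVT_max R r (- pi) pi (le_Npi_pi R) (continuous_subspaceT cr).
exists (Num.max 0 (r c)); first by rewrite le_max lexx.
by move=> x xpi; rewrite le_max cmax ?orbT // in_itv.
Qed.

Lemma powR_incr_le p w z : 1 < p -> 0 <= w -> 0 < z ->
  (w + z) `^ p <= w `^ p + p * z * (w + z) `^ (p - 1) :> R.
Proof.
move=> p1 w0 z0; have wz : 0 < w + z by rewrite ltr_wpDl.
have := powR_tangent p1 w0 wz; rewrite opprD addNKr => h.
by rewrite -lerBlDr; apply: le_trans h; rewrite le_eqVlt; apply/orP; left; apply/eqP; ring.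
Qed.

(** One-sided on purpose: in the limit the [p]-norm only has to be bounded above and, in
    [mass_stable], the mass only below. The constant depends neither on [v] nor on [e], so the error
    disappears with [e]. *)
Lemma Lp_sqr_stable r p : 1 < p < 2 -> continuous r -> (forall x, 0 <= r x) ->
  exists2 C : R, 0 <= C & forall e v, 0 < e <= 1 -> continuous v ->
    (forall x, 0 <= v x <= r x + e) ->
    sint (fun x => v x `^ p) `^ (2 / p) <= sint (fun x => r x `^ p) `^ (2 / p) + C * e.
Proof.
move=> /andP[p1 p2] cr r0; have p0 : 0 < p by lra.
have [B B0 rB] := bounded_on_circle cr.
have crp : continuous (fun x => r x `^ p) by cts.
have q1 : 1 < 2 / p by rewrite ltr_pdivlMr // mul1r.
set S := sint (fun x => r x `^ p).
have S0 : 0 <= S by apply: sint_ge0 => // x; exact: powR_ge0.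
pose K := p * (B + 1) `^ (p - 1).
have K0 : 0 < K by rewrite mulr_gt0 // powR_gt0 // ltr_wpDl.
pose C := 2 / p * K * (S + K) `^ (2 / p - 1).
exists C; first by rewrite /C mulr_ge0 ?powR_ge0 // mulr_ge0 ?(ltW K0) // ltW // (lt_trans ltr01).
move=> e v /andP[e0 e1] cv vr.
have cvp : continuous (fun x => v x `^ p) by cts => // x; case/andP: (vr x).
have vS : sint (fun x => v x `^ p) <= S + K * e.
  rewrite -(sint_cst (K * e)) -sintD; [|by []|by cts].
  apply: le_sint => [//||x xpi]; first by cts.
  have /andP[v0 v1] := vr x.
  apply: (@le_trans _ _ ((r x + e) `^ p)).
    by apply: ge0_ler_powR; rewrite ?nnegrE ?(ltW p0) // addr_ge0 ?r0 // ltW.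
  apply: (le_trans (powR_incr_le p1 (r0 x) e0)); rewrite lerD2l /K -!mulrA ler_pM2l //.
  rewrite mulrC ler_pM2r //; apply: ge0_ler_powR; rewrite ?nnegrE ?subr_ge0 ?(ltW p1) //.
  - by rewrite addr_ge0 ?r0 // ltW.
  - by rewrite addr_ge0.
  - by apply: lerD => //; exact: rB.
have Ke0 : 0 < K * e by rewrite mulr_gt0.
apply: (@le_trans _ _ ((S + K * e) `^ (2 / p))).
  apply: ge0_ler_powR; last exact: vS.
  - exact: ltW (lt_trans ltr01 q1).
  - by rewrite nnegrE; apply: (sint_ge0 cvp) => x; exact: powR_ge0.
  - by rewrite nnegrE addr_ge0 // ltW.
apply: (le_trans (powR_incr_le q1 S0 Ke0)); rewrite lerD2l /C.
rewrite (mulrA (2 / p) K e) [leRHS]mulrAC ler_pM2l; last first.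
  by rewrite mulr_gt0 // mulr_gt0 // divr_gt0.
apply: ge0_ler_powR; rewrite ?nnegrE ?subr_ge0 ?(ltW q1) //.
- by rewrite addr_ge0 // ltW.
- by rewrite addr_ge0 // ltW.
- by rewrite lerD2l ger_pMr.
Qed.

Lemma mass_stable r : continuous r -> (forall x, 0 <= r x) ->
  exists2 C : R, 0 <= C & forall e v, 0 < e <= 1 -> continuous v ->
    (forall x, `|v x - r x| <= e) ->
    sint (fun x => r x ^+ 2) <= sint (fun x => v x ^+ 2) + C * e.
Proof.
move=> cr r0; have [B B0 rB] := bounded_on_circle cr.
exists (2 * (B + 1) + 1); first by rewrite addr_ge0 // mulr_ge0 // addr_ge0.
move=> e v /andP[e0 e1] cv vr.
rewrite -(sint_cst (_ * e)) -sintD; [|by cts|by cts].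
apply: le_sint => [||x xpi]; [by cts|by cts|].
have := vr x; rewrite ler_norml => /andP[v1 v2].
have rx0 := r0 x; have := rB x xpi => rxB.
have : (r x - v x) * (r x + v x) <= e * (2 * (B + 1)).
  apply: (le_trans (ler_norm _)); rewrite normrM; apply: ler_pM => //.
    by rewrite distrC.
  by rewrite ler_norml; apply/andP; split; move: v1 v2 rx0 rxB e0 e1; clear; lra.
have : 0 <= e * 1 by rewrite mulr1 ltW.
by clear; lra.
Qed.

End Stability.

Section Modulus.
Variable R : realType.
Implicit Types x y : R.

(** The triangle inequality in three dimensions: [(y1, y2, e)] and [(x1, x2, 0)] are at distance at
    most [sqrt 3 * e]. The two shifts [c] and [d] of [aux] allow it to serve in both directions. *)
Lemma modulus_close (x1 x2 y1 y2 e : R) : 0 < e ->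
  `|y1 - x1| <= e -> `|y2 - x2| <= e ->
  `|Num.sqrt (y1 ^+ 2 + y2 ^+ 2 + e ^+ 2) - Num.sqrt (x1 ^+ 2 + x2 ^+ 2)| <= 2 * e.
Proof.
move=> e0 h1 h2.
have aux (a1 a2 b1 b2 c d r s : R) : 0 <= s -> 0 <= c <= e -> 0 <= d <= e ->
    `|b1 - a1| <= e -> `|b2 - a2| <= e -> r ^+ 2 = b1 ^+ 2 + b2 ^+ 2 + c ^+ 2 ->
    s ^+ 2 = a1 ^+ 2 + a2 ^+ 2 + d ^+ 2 -> r <= s + 2 * e.
  move=> s0 /andP[c0 c1] /andP[d0 d1] H1 H2 rE sE.
  have s2e : 0 <= s + 2 * e by rewrite addr_ge0 // mulr_ge0 // ltW.
  apply: (le_trans (ler_norm r)); rewrite -(@ler_pXn2r _ 2) ?nnegrE //.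
  rewrite real_normK ?num_real // rE.
  have sq (a b : R) : `|b - a| <= e -> b ^+ 2 <= a ^+ 2 + 2 * e * `|a| + e ^+ 2.
    move=> H; have : `|b| <= `|a| + e.
      by rewrite -[b](subrK a) (le_trans (ler_normD _ _)) // addrC lerD2l.
    rewrite -(@ler_pXn2r _ 2) ?nnegrE ?addr_ge0 // ?(ltW e0) //.
    rewrite real_normK ?num_real // sqrrD real_normK ?num_real //.
    by move=> /le_trans; apply; rewrite le_eqVlt; apply/orP; left; apply/eqP; ring.
  have a1s : `|a1| <= s.
    rewrite -(@ler_pXn2r _ 2) ?nnegrE // real_normK ?num_real // sE.
    by rewrite -addrA lerDl addr_ge0 ?sqr_ge0.
  have a2s : `|a2| <= s.
    rewrite -(@ler_pXn2r _ 2) ?nnegrE // real_normK ?num_real // sE.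
    by rewrite addrAC lerDr addr_ge0 ?sqr_ge0.
  have c2 : c ^+ 2 <= e ^+ 2 by rewrite ler_pXn2r ?nnegrE // ltW.
  have m1 := ler_wpM2l (ltW e0) a1s; have m2 := ler_wpM2l (ltW e0) a2s.
  have k1 := sq _ _ H1; have k2 := sq _ _ H2.
  have d2 := sqr_ge0 d; have e2 := sqr_ge0 e.
  by rewrite sqrrD sE; move: c2 m1 m2 k1 k2 d2 e2; clear; lra.
have p1 : 0 <= y1 ^+ 2 + y2 ^+ 2 + e ^+ 2 by rewrite !addr_ge0 ?sqr_ge0.
have p2 : 0 <= x1 ^+ 2 + x2 ^+ 2 by rewrite !addr_ge0 ?sqr_ge0.
have e00 : 0 <= (0 : R) <= e by rewrite lexx ltW.
have ee : 0 <= e <= e by rewrite lexx ltW.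
set A := Num.sqrt (_ + e ^+ 2); set B := Num.sqrt _.
have H1 : B <= A + 2 * e.
  apply: (aux y1 y2 x1 x2 0 e); rewrite ?sqrtr_ge0 ?sqr_sqrtr ?expr0n ?addr0 //.
  - by rewrite distrC.
  - by rewrite distrC.
have H2 : A <= B + 2 * e.
  by apply: (aux x1 x2 y1 y2 e 0); rewrite ?sqrtr_ge0 ?sqr_sqrtr ?expr0n ?addr0.
rewrite ler_norml; move: H1 H2; clearbody A B; clear; lra.
Qed.

End Modulus.

Section SobolevInequalities.
Variable R : realType.
Implicit Types (u g v psi : R -> R) (a p mu e : R).

Lemma modulus_C1 v1 v2 (v1' v2' : R -> R) e : 0 < e ->
  deriv_of v1 v1' -> deriv_of v2 v2' -> continuous v1' -> continuous v2' ->
  let r x := Num.sqrt (v1 x ^+ 2 + v2 x ^+ 2 + e ^+ 2) in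
  let r' x := (v1 x * v1' x + v2 x * v2' x) / r x in
  [/\ deriv_of r r', continuous r' & forall x, 0 < r x].
Proof.
move=> e0 d1 d2 c1 c2 r r'.
have q0 x : 0 < v1 x ^+ 2 + v2 x ^+ 2 + e ^+ 2.
  by rewrite ltr_wpDl ?exprn_gt0 // addr_ge0 ?sqr_ge0.
have r0 x : 0 < r x by rewrite sqrtr_gt0.
have dr : deriv_of r r'.
  move=> x; rewrite /r /r'; derive; first exact: q0.
  rewrite -/(r x); have := r0 x; move: (r x) => s s0; field.
  by rewrite gt_eqF.
have cr := deriv_of_continuous dr.
have cv1 := deriv_of_continuous d1; have cv2 := deriv_of_continuous d2.
split => //; rewrite /r'; cts.
by move=> x; rewrite gt_eqF.
Qed.

Lemma eq_of_small (A B C : R) : 0 <= C ->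
  (forall e, 0 < e <= 1 -> A <= B + C * e) -> A <= B.
Proof.
move=> C0 H; apply: (@le_of_small _ _ _ C) => e /andP[e0 e1].
by have := H e; rewrite e0 ltW // => /(_ isT); clear; lra.
Qed.

(** Beckner's inequality times [mu] and [magnetic_C1] are added for the regularized modulus [rd].
    The energy [F] of [rd] enters both, with the factors [mu (2 - p)] and [1 - 4 a^2]. *)
Lemma magnetic_interpolation a p mu psi1 g1 psi2 g2 : 1 < p < 2 -> 0 < a < 1 / 2 -> 0 < mu ->
  mu * (2 - p) + 4 * a ^+ 2 <= 1 -> H1 psi1 g1 -> H1 psi2 g2 ->
  (a ^+ 2 + mu) * cplx_L2sq psi1 psi2 <= cplx_lhs a p mu psi1 g1 psi2 g2.
Proof.
move=> p12 a01 mu0 cond h1 h2; have /andP[p1 p2] := p12.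
have am0 : 0 <= a ^+ 2 + mu by rewrite addr_ge0 ?sqr_ge0 // ltW.
have c1 := primitive_L2_continuous (H1_primitive_L2 h1).
have c2 := primitive_L2_continuous (H1_primitive_L2 h2).
pose r x := Num.sqrt (psi1 x ^+ 2 + psi2 x ^+ 2).
have cr : continuous r by rewrite /r; cts.
have r0 x : 0 <= r x by exact: sqrtr_ge0.
have rE : cplx_L2sq psi1 psi2 = sint (fun x => r x ^+ 2).
  by apply: eq_sint => x; rewrite sqr_sqrtr // addr_ge0 ?sqr_ge0.
have rpE : sint (fun x => (psi1 x ^+ 2 + psi2 x ^+ 2) `^ (p / 2)) = sint (fun x => r x `^ p).
  apply: eq_sint => x; rewrite /r -powR12_sqrt ?addr_ge0 ?sqr_ge0 // -powRrM.
  by rewrite (mulrC 2^-1).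
have [C1 C10 stabP] := Lp_sqr_stable p12 cr r0.
have [C2 C20 stabM] := mass_stable cr r0.
rewrite /cplx_lhs rE rpE.
set A := sint (fun x => (g1 x + _) ^+ 2 + _); set P := _ `^ (2 / p) in stabP *.
set L := sint (fun x => r x ^+ 2) in stabM *.
apply: (@eq_of_small _ _ (mu * C1 + (a ^+ 2 + mu) * C2 + a ^+ 2)).
  exact: addr_ge0 (addr_ge0 (mulr_ge0 (ltW mu0) C10) (mulr_ge0 am0 C20)) (sqr_ge0 a).
move=> e /andP[e0 e1].
pose d := e / 2; have d0 : 0 < d by rewrite divr_gt0.
have ed : 2 * d = e by rewrite /d; field.
have [v1 [v2 [v1' [v2' [[dv1 cv1' vp1] [dv2 cv2' vp2] cl1 cl2 en]]]]] := regularize a h1 h2 d0.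
have cv1 := deriv_of_continuous dv1; have cv2 := deriv_of_continuous dv2.
have [dr cr' rd0] := modulus_C1 d0 dv1 dv2 cv1' cv2'.
have mag := magnetic_C1 a01 d0 dv1 dv2 cv1' cv2' vp1 vp2.
set rd := fun x => Num.sqrt (v1 x ^+ 2 + v2 x ^+ 2 + d ^+ 2) in dr cr' rd0 mag.
have crd := deriv_of_continuous dr.
have rdp x : rd (x + 2 * pi) = rd x by rewrite /rd vp1 vp2.
have rclose x : `|rd x - r x| <= e by rewrite -ed; exact: modulus_close.
have k01 : 0 < p - 1 < 1 by move: p1 p2; clear; lra.
have bk := beckner_C1 k01 dr cr' rd0 rdp; rewrite subrK in bk.
have D0 : 0 <= deficit (p - 1) rd (fun x => (v1 x * v1' x + v2 x * v2' x) / rd x).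
  exact: deficit_ge0 crd cr' rd0.
have e01 : 0 < e <= 1 by rewrite e0.
have sP : sint (fun x => rd x `^ p) `^ (2 / p) <= P + C1 * e.
  apply: (stabP e rd e01 crd) => x; rewrite (ltW (rd0 x)) /=; have := rclose x.
  by rewrite ler_norml => /andP[_]; clear; lra.
have sM : L <= sint (fun x => rd x ^+ 2) + C2 * e by exact: (stabM e rd e01 crd rclose).
have rdE : sint (fun x => v1 x ^+ 2 + v2 x ^+ 2) = sint (fun x => rd x ^+ 2) - d ^+ 2.
  rewrite -(sint_cst (d ^+ 2)) -sintB; [|by cts|by cts].
  by apply: eq_sint => x; rewrite sqr_sqrtr ?addrK // !addr_ge0 ?sqr_ge0.
rewrite rdE in mag.
have dd : d ^+ 2 <= e.
  have d2 : d <= 1 by rewrite /d; move: e0 e1; clear; lra.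
  by apply: (@le_trans _ _ d); [rewrite expr2 ger_pMl|rewrite /d; move: e0; clear; lra].
rewrite /entp in bk.
have b1 := ler_wpM2l (ltW mu0) bk.
set F := sint (fun x => (_ / _) ^+ 2) in b1 mag; set M := sint (fun x => rd x ^+ 2) in b1 mag sM.
have F0 : 0 <= F by apply: sint_ge0 => [|x]; [cts|exact: sqr_ge0].
(* The threshold condition enters here. *)
have cF : mu * ((1 - (p - 1)) * F) <= (1 - 4 * a ^+ 2) * F.
  rewrite mulrA ler_wpM2r //; move: cond; clear; lra.
have mD : 0 <= mu * ((1 - (p - 1)) * deficit (p - 1) rd (fun x => (v1 x * v1' x + v2 x * v2' x) / rd x)).
  by apply: (mulr_ge0 (ltW mu0) (mulr_ge0 _ D0)); rewrite subr_ge0 ltW; case/andP: k01.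
have m1 := ler_wpM2l (ltW mu0) sP.
have m2 := ler_wpM2l am0 sM.
have m3 := ler_wpM2l (sqr_ge0 a) dd.
have fin := le_trans mag en.
move: b1 cF mD m1 m2 m3 fin; rewrite -/A.
move: (deficit _ _ _) => DD; move: (_ `^ (2 / p)) => P'.
clearbody F M P L A.
clear; lra.
Qed.

Lemma regularize_real u g e : H1 u g -> 0 < e ->
  exists v v' : R -> R, [/\ deriv_of v v', continuous v',
    forall x, v (x + 2 * pi) = v x, forall x, `|v x - u x| <= e &
    sint (fun x => v' x ^+ 2) <= L2sq g].
Proof.
move=> h e0.
have z : H1 (fun _ : R => 0) (fun _ : R => 0).
  split; [by []|split; [by move=> s t st; exact: rintegrable_cst|split]].
    apply: (integrableS _ _ _ (rintegrable_cst (- pi) pi (0 ^+ 2))) => //.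
    by apply: subset_itvl; rewrite bnd_simp.
  by move=> s t st; rewrite Rintegral_cst_itv // mul0r subrr.
have [v1 [v2 [v1' [v2' [[dv1 cv1' vp1] [dv2 cv2' _] cl1 _ en]]]]] := regularize 0 h z e0.
have cv1 := deriv_of_continuous dv1; have cv2 := deriv_of_continuous dv2.
exists v1, v1'; split => //.
have -> : L2sq g = sint (fun x => (g x + 0 * 0) ^+ 2 + (0 - 0 * u x) ^+ 2).
  by apply: eq_sint => x; rewrite !mul0r subr0 expr0n !addr0.
apply: le_trans en; apply: le_sint => [||x _]; [by cts|by cts|].
by rewrite !mul0r addr0 lerDl sqr_ge0.
Qed.

Lemma regularize_abs u g e : H1 u g -> 0 < e ->
  exists v v' : R -> R, [/\ deriv_of v v', continuous v', forall x, 0 < v x,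
    forall x, v (x + 2 * pi) = v x & forall x, `|v x - `|u x| | <= e] /\
    sint (fun x => v' x ^+ 2) <= L2sq g.
Proof.
move=> h e0; pose d := e / 2; have d0 : 0 < d by rewrite divr_gt0.
have ed : 2 * d = e by rewrite /d; field.
have [v1 [v1' [dv1 cv1' vp1 cl1 en]]] := regularize_real h d0.
have cv1 := deriv_of_continuous dv1.
have dz : deriv_of (fun _ : R => 0) (fun _ : R => 0) by move=> x; exact: isdC.
have [dr cr' rd0] := modulus_C1 d0 dv1 dz cv1' (@ctsC R 0).
set rd := fun x => Num.sqrt (v1 x ^+ 2 + 0 ^+ 2 + d ^+ 2) in dr cr' rd0.
exists rd, (fun x => (v1 x * v1' x + 0 * 0) / rd x); split; first split => //.
- by move=> x; rewrite /rd vp1.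
- have z0 : `|(0 : R) - 0| <= d by rewrite subrr normr0 ltW.
  move=> x; rewrite -ed; have := modulus_close d0 (cl1 x) z0.
  by rewrite !expr0n !addr0 sqrtr_sqr /rd expr0n addr0.
apply: le_trans en; apply: le_sint => [||x _]; [by cts|by cts|].
rewrite mul0r addr0 expr_div_n ler_pdivrMr ?exprn_gt0 ?rd0 //.
rewrite sqr_sqrtr; last by rewrite !addr_ge0 ?sqr_ge0.
have : 0 <= v1' x ^+ 2 * d ^+ 2 by rewrite mulr_ge0 ?sqr_ge0.
by clear; lra.
Qed.

End SobolevInequalities.

(** * The inverse-square inequality in H^1 *)

Section InverseSquare.
Variable R : realType.
Local Notation leb := (@lebesgue_measure R).
Implicit Types (u g v : R -> R).

Lemma invL2E u : continuous u -> (forall x, u x != 0) ->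
  invL2 u = (sint (fun x => (u x ^+ 2)^-1))^-1.
Proof.
move=> cu u0; rewrite /invL2 asboolF; last first.
  by move=> [x /eqP]; rewrite (negPf (u0 x)).
rewrite asboolT //.
have ci : continuous (fun x => (u x ^+ 2)^-1) by cts => x; rewrite expf_neq0.
have : leb.-integrable `[- pi, pi[ (fun x => ((u x ^+ 2)^-1)%:E).
  by apply: integrableS (integrable_cts (- pi) pi ci) => //; apply: subset_itvl; rewrite bnd_simp.
move=> /integrableP[_]; apply: le_lt_trans.
rewrite /invsq_int le_eqVlt; apply/orP; left; apply/eqP/eq_integral => x _.
by rewrite gee0_abs // lee_fin invr_ge0 sqr_ge0.
Qed.

Lemma normr_away_from_0 u : continuous u -> (forall x, u (x + 2 * pi) = u x) ->
  (forall x, u x != 0) -> exists2 d : R, 0 < d & forall x, d <= `|u x|.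
Proof.
move=> cu up u0; have cn : continuous (fun x => `|u x|) by cts.
have [c _ cmin] := @EVT_min R _ (- pi) pi (le_Npi_pi R) (continuous_subspaceT cn).
exists `|u c|; first by rewrite normr_gt0.
apply: periodic_ind => [x|x xpi]; first by rewrite up.
by apply: cmin; rewrite in_itv.
Qed.

Lemma inverse_square_ineq_H1 u g : H1 u g -> L2sq u <= 4 * L2sq g + invL2 u.
Proof.
move=> h; have cu := primitive_L2_continuous (H1_primitive_L2 h).
have [up _] := h.
have cn : continuous (fun x => `|u x|) by cts.
have [C C0 stab] := mass_stable cn (fun x => normr_ge0 (u x)).
have uE : L2sq u = sint (fun x => `|u x| ^+ 2).
  by apply: eq_sint => x; rewrite real_normK ?num_real.
have close (a b e : R) : `|a - b| <= e -> `| `|a| - `|b| | <= e.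
  by move=> ab; apply: le_trans (ler_dist_dist _ _) ab.
have [[x0 ux0]|nz] := pselect (exists x, u x = 0).
  have -> : invL2 u = 0 by rewrite /invL2 asboolT //; exists x0.
  rewrite addr0 uE; apply: (@eq_of_small _ _ _ C) => // e /andP[e0 e1].
  have d0 : 0 < e / 2 by rewrite divr_gt0.
  have [v [v' [dv cv' vp cl en]]] := regularize_real h d0.
  (* The regularization of [u] may miss the zero [x0]; subtracting [v x0] restores it and leaves the
     derivative unchanged. *)
  pose w x := v x - v x0.
  have dw : deriv_of w v' by move=> x; rewrite /w; derive; ring.
  have cw := deriv_of_continuous dw.
  have cnw : continuous (fun x => `|w x|) by cts.
  have e01 : 0 < e <= 1 by rewrite e0.
  have := stab e _ e01 cnw; move=> /(_ _)/le_trans; apply.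
    move=> x; apply: close; rewrite /w.
    have := cl x; have := cl x0; rewrite ux0 !ler_norml.
    by move=> /andP[? ?] /andP[? ?]; lra.
  rewrite lerD2r (@eq_sint _ _ (fun x => w x ^+ 2)); last first.
    by move=> x; rewrite real_normK ?num_real.
  apply: le_trans (dirichlet_2pi (z := x0) dw cv' _ _) _.
  - by rewrite /w subrr.
  - by move=> x; rewrite /w vp.
  - by rewrite ler_pM2l.
have u0 x : u x != 0 by apply/eqP => ux; apply: nz; exists x.
have [d d0 du] := normr_away_from_0 cu up u0.
rewrite (invL2E cu u0).
have ci : continuous (fun x => (u x ^+ 2)^-1) by cts => x; rewrite expf_neq0.
set I := sint (fun x => (u x ^+ 2)^-1).
have I0 : 0 < I by apply: sint_gt0 => // x; rewrite invr_gt0 exprn_even_gt0 //= u0.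
have K0 : 0 <= C + 3 * (d^-1 + d^-1 ^+ 2) * I^-1.
  by rewrite addr_ge0 // mulr_ge0 ?invr_ge0 ?(ltW I0) // mulr_ge0 // addr_ge0 ?sqr_ge0 // invr_ge0 ltW.
rewrite uE; apply: (@eq_of_small _ _ _ _ K0) => e /andP[e0 e1].
(* Staying within [d / 2] of [u], where [d] bounds [|u|] from below, keeps [v] away from 0. *)
pose t := Num.min e (d / 2).
have t0 : 0 < t by rewrite lt_min e0 divr_gt0.
have te : t <= e by rewrite ge_min lexx.
have td : t <= d / 2 by rewrite ge_min lexx orbT.
have [v [v' [dv cv' vp cl en]]] := regularize_real h t0.
have cv := deriv_of_continuous dv.
have cnv : continuous (fun x => `|v x|) by cts.
have e01 : 0 < e <= 1 by rewrite e0.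
have cle x : `| `|v x| - `|u x| | <= t by apply: close; exact: cl.
have v0 x : v x != 0.
  rewrite -normr_gt0; have := cle x; have := du x.
  by rewrite ler_norml => h1 /andP[h2 _]; move: h1 h2 td d0; clear; lra.
have S := stab e _ e01 cnv (fun x => le_trans (cle x) te).
apply: (le_trans S).
rewrite (@eq_sint _ (fun x => `|v x| ^+ 2) (fun x => v x ^+ 2)); last first.
  by move=> x; rewrite real_normK ?num_real.
have V := inverse_square_ineq dv cv' v0 vp.
(* As [t <= e <= (e / d) |u|], one has [v^2 <= q u^2], which compares the integrals of the inverse
   squares. *)
pose q := (1 + e / d) ^+ 2.
have ed0 : 0 < 1 + e / d by rewrite addr_gt0 // divr_gt0.
have q0 : 0 < q by rewrite exprn_gt0.
have civ : continuous (fun x => (v x ^+ 2)^-1) by cts => x; rewrite expf_neq0.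
have Iv : I <= q * sint (fun x => (v x ^+ 2)^-1).
  rewrite -sintZ //; apply: le_sint => [//||x _]; first by cts.
  rewrite -[leLHS]mul1r ler_pdivrMr ?exprn_even_gt0 //= ?u0 //.
  rewrite mulrAC ler_pdivlMr ?exprn_even_gt0 //= ?v0 // mul1r.
  rewrite -(real_normK (num_real (v x))) -(real_normK (num_real (u x))) /q -exprMn.
  rewrite ler_pXn2r ?nnegrE //; last by rewrite mulr_ge0 // ltW.
  have := cle x; rewrite ler_norml => /andP[_ h2].
  have : t <= e / d * `|u x|.
    by rewrite mulrAC ler_pdivlMr //; apply: ler_pM => //; rewrite ltW.
  by move: h2; rewrite mulrDl mul1r; clear; lra.
have Iv0 : 0 < sint (fun x => (v x ^+ 2)^-1).
  by apply: sint_gt0 => // x; rewrite invr_gt0 exprn_even_gt0 //= v0.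
have Ivi : (sint (fun x => (v x ^+ 2)^-1))^-1 <= q * I^-1.
  by rewrite ler_pdivlMr // mulrC ler_pdivrMr.
have qe : q <= 1 + 3 * (d^-1 + d^-1 ^+ 2) * e.
  rewrite /q; have D0 : 0 < d^-1 by rewrite invr_gt0.
  move: (d^-1) D0 => D D0.
  have : e * e * D ^+ 2 <= e * D ^+ 2 by rewrite ler_wpM2r ?sqr_ge0 // ger_pMr.
  have : 0 <= e * D by rewrite mulr_ge0 // ltW.
  have : 0 <= e * D ^+ 2 by rewrite mulr_ge0 ?sqr_ge0 // ltW.
  by clear; lra.
have qI : q * I^-1 <= (1 + 3 * (d^-1 + d^-1 ^+ 2) * e) * I^-1.
  by rewrite ler_wpM2r // invr_ge0 ltW.
move: V Ivi qI en; move: (sint (fun x => v x ^+ 2)) (sint _) (sint _) (I^-1) (d^-1).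
move: (L2sq g); clear => ? ? ? ? ? ? ? ?; lra.
Qed.

End InverseSquare.

(** * Rigidity *)

Section Rigidity.
Variable R : realType.
Implicit Types (u g r v : R -> R) (p k e : R).

Lemma entp_abs p u : entp p (fun x => `|u x|) = L2sq u - Lpsq p u.
Proof.
congr (_ - _); apply: eq_sint => x.
by rewrite real_normK ?num_real.
Qed.

(* Running the regularisations of an extremal through [beckner_C1] forces their
   deficits to vanish in the limit. *)
Lemma deficit_small p u g : 1 < p < 2 -> H1 u g ->
  (2 - p) * L2sq g <= entp p (fun x => `|u x|) ->
  exists2 C : R, 0 <= C & forall e, 0 < e <= 1 -> exists v v' : R -> R,
    [/\ deriv_of v v', continuous v', forall x, 0 < v x,
        forall x, `|v x - `|u x| | <= e & deficit (p - 1) v v' <= C * e].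
Proof.
move=> p12 h ext; have /andP[p1 p2] := p12.
have cu := primitive_L2_continuous (H1_primitive_L2 h).
have cr : continuous (fun x => `|u x|) by cts.
have r0 x : 0 <= `|u x| by exact: normr_ge0.
have [C1 C10 stabP] := Lp_sqr_stable p12 cr r0.
have [C2 C20 stabM] := mass_stable cr r0.
have k0 : 0 < 2 - p by rewrite subr_gt0.
exists ((C1 + C2) / (2 - p)); first exact: divr_ge0 (addr_ge0 C10 C20) (ltW k0).
move=> e e01; have /andP[e0 e1] := e01.
have [v [v' [[dv cv' v0 vp cl] en]]] := regularize_abs h e0.
exists v, v'; split => //.
have cv := deriv_of_continuous dv.
have k01 : 0 < p - 1 < 1 by move: p1 p2; clear; lra.
have bk := beckner_C1 k01 dv cv' v0 vp; rewrite subrK in bk.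
have sP := stabP e v e01 cv.
have sM := stabM e v e01 cv cl.
have {}sP := sP (fun x => introT andP (conj (ltW (v0 x)) _)).
rewrite mulrAC ler_pdivlMr // mulrC.
have m := ler_wpM2l (ltW k0) en.
have {}sP : sint (fun x => v x `^ p) `^ (2 / p) <=
    sint (fun x => `|u x| `^ p) `^ (2 / p) + C1 * e.
  apply: sP => x; have := cl x; rewrite ler_norml => /andP[_].
  by clear; lra.
move: ext bk sM sP m; rewrite /entp.
move: (_ `^ (2 / p)) (_ `^ (2 / p)) (deficit _ _ _) => P1 P2 D.
move: (L2sq g) => G; sint_lra.
Qed.

Lemma sqr_near_le (A B X Y e : R) : 0 <= e -> `|A - X| <= e -> `|B - Y| <= e ->
  (A - B) ^+ 2 <= 2 * (X - Y) ^+ 2 + 8 * e ^+ 2.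
Proof.
move=> e0 h1 h2.
have : `|(A - X) - (B - Y)| <= 2 * e.
  by apply: le_trans (ler_normB _ _) _; lra.
rewrite -(@ler_pXn2r _ 2) ?nnegrE ?mulr_ge0 // real_normK ?num_real // => h3.
have := sqr_ge0 ((A - X) - (B - Y) - (X - Y)).
move: h3; clear; lra.
Qed.

(** A deficit of order [e] bounds the oscillations of [x] and of [y^2] for the approximations of
    [|u|]. In the limit both are constant; the antiperiodic [y] has a zero, hence [y = 0] and
    [|u| = x]. *)
Lemma abs_constant p u g : 1 < p < 2 -> H1 u g ->
  (2 - p) * L2sq g <= entp p (fun x => `|u x|) ->
  exists c : R, forall x, `|u x| = c.
Proof.
move=> p12 h ext; have [C C0 approx] := deficit_small p12 h ext.
have /andP[p1 p2] := p12; have [up _] := h.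
have cu := primitive_L2_continuous (H1_primitive_L2 h).
pose r (x : R) : R := `|u x|.
have cr : continuous r by rewrite /r; cts.
have rp x : r (x + 2 * pi) = r x by rewrite /r up.
have [B B0 rB0] := bounded_on_circle cr.
have rB : forall x, r x <= B by apply: periodic_ind => // x; rewrite rp.
set k := p - 1 in approx; have k0 : 0 < k by rewrite subr_gt0.
have sqk : 0 < k ^+ 2 by rewrite exprn_gt0.
(* The leading [0 +] gives the bounds the shape that [eq_of_small] expects. *)
have main s e : - pi <= s <= pi -> 0 < e <= 1 ->
   (evp r s - evp r (- pi)) ^+ 2 <= 0 + (2 * ((2 * pi) ^+ 2 * (100 * C)) + 8) * e /\
   (odp r s ^+ 2 - odp r (- pi) ^+ 2) ^+ 2 <= 0 +
     (2 * ((2 * pi) ^+ 2 * ((2 * (B + 1)) ^+ 2 / k ^+ 2 * (100 * C))) + 8 * (2 * (B + 1)) ^+ 2) * e.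
  move=> spi e01; have /andP[e0 e1] := e01.
  have [v [v' [dv cv' v0 cl D]]] := approx e e01.
  have cv := deriv_of_continuous dv.
  have vB x : v x <= B + 1.
    have := cl x; rewrite ler_norml => /andP[_]; have := rB x; rewrite /r.
    by move: e1; clear; lra.
  have dX : deriv_of (evp v) (evp v') by move=> z; rewrite /evp; derive; field.
  have dY : deriv_of (odp v) (odp v') by move=> z; rewrite /odp; derive; field.
  have cX' : continuous (evp v') by rewrite /evp; cts.
  have cY' : continuous (odp v') by rewrite /odp; cts.
  have cX := deriv_of_continuous dX; have cY := deriv_of_continuous dY.
  have X0 x : 0 < evp v x by rewrite /evp divr_gt0 // addr_gt0.
  have XB x : evp v x <= B + 1.
    by have := vB x; have := vB (x + pi); rewrite /evp; lra.
  have clX x : `|evp r x - evp v x| <= e.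
    have := cl x; have := cl (x + pi); rewrite !ler_norml /evp -/(r x) -/(r (x + pi)).
    by move=> /andP[? ?] /andP[? ?]; lra.
  have clY x : `|odp r x - odp v x| <= e.
    have := cl x; have := cl (x + pi); rewrite !ler_norml /odp -/(r x) -/(r (x + pi)).
    by move=> /andP[? ?] /andP[? ?]; lra.
  have YB x : `|odp v x| <= B + 1.
    have := vB x; have := vB (x + pi); have := v0 x; have := v0 (x + pi).
    by rewrite ler_norml /odp; lra.
  have rYB x : `|odp r x| <= B + 1.
    have n0 z : 0 <= r z by exact: normr_ge0.
    rewrite ler_norml /odp; have := rB x; have := rB (x + pi); have := n0 x; have := n0 (x + pi).
    by move: B0; move: (r x) (r (x + pi)); clear => s1 s2; lra.
  have cD : continuous (fun x =>
      (evp v' x ^+ 2 + k ^+ 2 * (odp v x / evp v x * odp v' x) ^+ 2) / 100).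
    exact: deficit_cts.
  have ee : e ^+ 2 <= e by rewrite expr2 ger_pMr.
  have p2e : 0 <= (2 * pi) ^+ 2 :> R by exact: sqr_ge0.
  split.
    have E1 : sint (fun x => evp v' x ^+ 2) <= 100 * deficit k v v'.
      rewrite /deficit -sintZ //; apply: le_sint => [||x _]; [by cts|by apply: ctsM => //; exact: ctsC|].
      have := sqr_ge0 (k * (odp v x / evp v x * odp v' x)); rewrite exprMn; lra.
    have O := sqr_osc_le dX cX' spi.
    apply: (le_trans (sqr_near_le (ltW e0) (clX s) (clX (- pi)))).
    have Q : (2 * pi) ^+ 2 * sint (fun x => evp v' x ^+ 2) <= (2 * pi) ^+ 2 * (100 * (C * e)).
      by rewrite ler_wpM2l // (le_trans E1) // ler_pM2l.
    move: O Q ee; move: (_ ^+ 2) ((2 * pi) ^+ 2) (sint _) (e ^+ 2); clear => ? ? ? ?.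
    lra.
  have E2 : sint (fun x => (2 * odp v x * odp v' x) ^+ 2) <=
      (2 * (B + 1)) ^+ 2 / k ^+ 2 * (100 * deficit k v v').
    rewrite /deficit mulrA -sintZ //; apply: le_sint => [||x _]; [by cts|by apply: ctsM => //; exact: ctsC|].
    have -> : (2 * odp v x * odp v' x) ^+ 2 =
        4 * evp v x ^+ 2 * (odp v x / evp v x * odp v' x) ^+ 2.
      by field; rewrite gt_eqF.
    have -> : (2 * (B + 1)) ^+ 2 / k ^+ 2 * 100 *
      ((evp v' x ^+ 2 + k ^+ 2 * (odp v x / evp v x * odp v' x) ^+ 2) / 100) =
      4 * (B + 1) ^+ 2 * (odp v x / evp v x * odp v' x) ^+ 2 +
      (2 * (B + 1)) ^+ 2 / k ^+ 2 * evp v' x ^+ 2.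
      by field; rewrite !gt_eqF.
    (* The weight [1 / evp v] in the deficit is handled by the upper bound on [evp v] alone: [u] may
       vanish, so a lower bound uniform in [e] is not at hand. *)
    apply: (@le_trans _ _ (4 * (B + 1) ^+ 2 * (odp v x / evp v x * odp v' x) ^+ 2)).
      rewrite ler_wpM2r ?sqr_ge0 // ler_pM2l // ler_pXn2r ?nnegrE ?(ltW (X0 x)) //.
      by rewrite addr_ge0.
    by rewrite lerDl mulr_ge0 ?sqr_ge0 // divr_ge0 ?sqr_ge0.
  have dY2 : deriv_of (fun x => odp v x ^+ 2) (fun x => 2 * odp v x * odp v' x).
    by move=> x; derive.
  have cY2' : continuous (fun x => 2 * odp v x * odp v' x) by cts.
  have O := sqr_osc_le dY2 cY2' spi.
  have clY2 x : `|odp r x ^+ 2 - odp v x ^+ 2| <= 2 * (B + 1) * e.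
    rewrite subr_sqr normrM mulrC; apply: ler_pM => //.
    by apply: le_trans (ler_normD _ _) _; have := YB x; have := rYB x; lra.
  have Be0 : 0 <= 2 * (B + 1) * e by rewrite mulr_ge0 ?(ltW e0) // mulr_ge0 // addr_ge0.
  apply: (le_trans (sqr_near_le Be0 (clY2 s) (clY2 (- pi)))).
  have K0 : 0 <= (2 * (B + 1)) ^+ 2 / k ^+ 2 by rewrite divr_ge0 ?sqr_ge0.
  have Q : (2 * pi) ^+ 2 * sint (fun x => (2 * odp v x * odp v' x) ^+ 2) <=
      (2 * pi) ^+ 2 * ((2 * (B + 1)) ^+ 2 / k ^+ 2 * (100 * (C * e))).
    by rewrite ler_wpM2l // (le_trans E2) // ler_wpM2l // ler_pM2l.
  have Q2 : (2 * (B + 1) * e) ^+ 2 <= (2 * (B + 1)) ^+ 2 * e.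
    by rewrite exprMn ler_wpM2l ?sqr_ge0.
  move: (le_trans O Q) Q2; clear; lra.
have P0 : 0 <= 2 * ((2 * pi) ^+ 2 * (100 * C)) + 8 :> R.
  by rewrite addr_ge0 // mulr_ge0 // mulr_ge0 ?sqr_ge0 // mulr_ge0.
have P1 : 0 <= 2 * ((2 * pi) ^+ 2 * ((2 * (B + 1)) ^+ 2 / k ^+ 2 * (100 * C))) +
    8 * (2 * (B + 1)) ^+ 2 :> R.
  rewrite addr_ge0 //; last by rewrite mulr_ge0 ?sqr_ge0.
  rewrite mulr_ge0 // mulr_ge0 ?sqr_ge0 // mulr_ge0 ?divr_ge0 ?sqr_ge0 //.
  by rewrite mulr_ge0.
have sq0 (w : R) : w ^+ 2 <= 0 -> w = 0.
  by move=> w0; apply/eqP; rewrite -sqrf_eq0 eq_le w0 sqr_ge0.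
have evc s : - pi <= s <= pi -> evp r s = evp r (- pi).
  move=> spi; apply/eqP; rewrite -subr_eq0; apply/eqP/sq0.
  by apply: (eq_of_small P0) => e e01; have [] := main s e spi e01.
have odc s : - pi <= s <= pi -> odp r s ^+ 2 = odp r (- pi) ^+ 2.
  move=> spi; apply/eqP; rewrite -subr_eq0; apply/eqP/sq0.
  by apply: (eq_of_small P1) => e e01; have [] := main s e spi e01.
have pi0 := pi_ge0 R.
have co : continuous (odp r) by rewrite /odp; cts.
have npi0 : - pi <= (0 : R) by rewrite oppr_le0.
have odneg : odp r 0 = - odp r (- pi).
  rewrite /odp add0r addNr (_ : r (- pi) = r pi); first by field.
  by rewrite -(rp (- pi)); congr r; ring.
(* [odp r] takes opposite values at [- pi] and 0, so it has a zero, and the constant [odp r ^+ 2]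
   must be 0. *)
have [|z zpi oz] := @IVT R (odp r) (- pi) 0 0 npi0 (continuous_subspaceT co).
  rewrite odneg; case: (leP 0 (odp r (- pi))) => q.
    by rewrite ge_min le_max q oppr_le0 q orbT.
  by rewrite ge_min le_max (ltW q) oppr_ge0 (ltW q) orbT.
have od0 : odp r (- pi) ^+ 2 = 0.
  rewrite -(odc z) ?oz ?expr0n //; move: zpi; rewrite in_itv /= => /andP[-> z0].
  exact: le_trans z0 pi0.
exists (evp r (- pi)); apply: periodic_ind => [x|x xpi]; first by rewrite up.
rewrite -/(r x) -(evc x xpi) (_ : r x = evp r x + odp r x).
  suff -> : odp r x = 0 by rewrite addr0.
  by apply: sq0; rewrite (odc x xpi) od0.
by rewrite /evp /odp; field.
Qed.

Lemma constant_of_abs u c : continuous u -> (forall x, `|u x| = c) -> forall x, u x = u 0.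
Proof.
move=> cu uc x.
have [c0|c0] := eqVneq c 0.
  have z y : u y = 0 by apply/eqP; rewrite -normr_eq0 uc c0.
  by rewrite !z.
have no_zero y : u y != 0 by rewrite -normr_eq0 uc.
wlog x0 : x / 0 <= x => [H|].
  have [/H//|x0] := leP 0 x.
  have := uc x; have := uc 0 => <- /eqP; rewrite eqr_norm2 => /orP[/eqP//|/eqP uN].
  have [|z _ uz] := @IVT R u x 0 0 (ltW x0) (continuous_subspaceT cu).
    rewrite uN; case: (leP 0 (u 0)) => q.
      by rewrite ge_min le_max q oppr_le0 q orbT.
    by rewrite ge_min le_max (ltW q) oppr_ge0 (ltW q) orbT.
  by have := no_zero z; rewrite uz eqxx.
have := uc x; have := uc 0 => <- /eqP; rewrite eqr_norm2 => /orP[/eqP//|/eqP uN].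
have [|z _ uz] := @IVT R u 0 x 0 x0 (continuous_subspaceT cu).
  rewrite uN; case: (leP 0 (u 0)) => q.
    by rewrite ge_min le_max q oppr_le0 q orbT.
  by rewrite ge_min le_max (ltW q) oppr_ge0 (ltW q) orbT.
by have := no_zero z; rewrite uz eqxx.
Qed.

End Rigidity.

(** * Instability of the constants *)

Section Instability.
Variable R : realType.
Implicit Types (u : R -> R) (p q a mu e s w d : R).

Lemma H1_C1 u (u' : R -> R) : deriv_of u u' -> continuous u' ->
  (forall x, u (x + 2 * pi) = u x) -> H1 u u'.
Proof.
move=> du cu' up; split => //; split; [by move=> s t _; exact: integrable_cts|split].
  have c2 : continuous (fun x => u' x ^+ 2) by cts.
  by apply: integrableS (integrable_cts (- pi) pi c2) => //; apply: subset_itvl; rewrite bnd_simp.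
by move=> s t st; rewrite (Rintegral_deriv st cu' du).
Qed.

(** Taylor's formula with the second-order term weakened by [1 - d], so that it is a true upper
    bound on an explicit neighbourhood: there the second derivative of the difference [h] is
    nonnegative, and [h] and [h1] vanish at 0. *)
Lemma powR_second_order_le q d s : 0 < q < 1 -> 0 < d < 1 -> `|s| <= d / 2 ->
  (1 + s) `^ q <= 1 + q * s - q * (1 - q) / 2 * (1 - d) * s ^+ 2.
Proof.
move=> /andP[q0 q1] /andP[d0 d1]; rewrite ler_norml => /andP[s1 s2].
pose c := q * (1 - q) / 2 * (1 - d).
pose h x := 1 + q * x - c * x ^+ 2 - (1 + x) `^ q.
pose h1 x := q - 2 * c * x - q * (1 + x) `^ (q - 1).
pose h2 x := q * (1 - q) * (1 + x) `^ (q - 2) - 2 * c.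
have dh x : - (d / 2) <= x <= d / 2 -> is_derive x (1 : R) h (h1 x).
  move=> /andP[x1 x2]; rewrite /h; derive; first by move: x1 d1; clear; lra.
  by rewrite /h1; ring.
have dh1 x : - (d / 2) <= x <= d / 2 -> is_derive x (1 : R) h1 (h2 x).
  move=> /andP[x1 x2]; rewrite /h1; derive; first by move: x1 d1; clear; lra.
  by rewrite /h2 (_ : q - 1 - 1 = q - 2); ring.
have h2ge x : - (d / 2) <= x <= d / 2 -> 0 <= h2 x.
  move=> /andP[x1 x2]; have x0 : 0 < 1 + x by move: x1 d1; clear; lra.
  have : 1 - d <= (1 + x) `^ (q - 2).
    rewrite (_ : q - 2 = - (2 - q)); last by ring.
    rewrite powRN -[leRHS]mul1r ler_pdivlMr ?powR_gt0 //.
    have [xn|xp] := leP x 0.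
      have : (1 + x) `^ (2 - q) <= 1.
        rewrite -[leRHS](powRr0 (1 + x)); apply: ger_powR; first by rewrite x0 gerDl.
        by move: q1; clear; lra.
      have := powR_gt0 (2 - q) x0; move: ((1 + x) `^ _) => y y0 y1.
      by apply: mulr_ile1 => //; [move: d1|exact: ltW|move: d0]; clear; lra.
    (* What closes this case is [(1 - 2 x) (1 + x)^2 = 1 - 3 x^2 - 2 x^3 <= 1]. *)
    have : (1 + x) `^ (2 - q) <= (1 + x) ^+ 2.
      rewrite -powR_mulrn ?(ltW x0) //; apply: ler_powR; first by rewrite lerDl ltW.
      by move: q0; clear; lra.
    have d1' : 0 <= 1 - d by rewrite subr_ge0 ltW.
    move=> /(ler_wpM2l d1')/le_trans; apply.
    have xd : 1 - d <= 1 - 2 * x by move: x2; clear; lra.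
    apply: (le_trans (ler_wpM2r (sqr_ge0 (1 + x)) xd)).
    have := exprn_ge0 2 (ltW xp); have := exprn_ge0 3 (ltW xp).
    by clear; lra.
  have qq : 0 <= q * (1 - q) by rewrite mulr_ge0 ?subr_ge0 // ltW.
  move=> /(ler_wpM2l qq); rewrite /h2 /c; clear; lra.
have h10 : h1 0 = 0 by rewrite /h1 mulr0 subr0 addr0 powR1 mulr1 subrr.
have h00 : h 0 = 0 by rewrite /h !mulr0 expr0n mulr0 subr0 !addr0 powR1 subrr.
suff : 0 <= h s by rewrite /h subr_ge0.
rewrite -h00; have [sp|sn] := leP 0 s.
  apply: (nondecreasing_of_deriv sp (f' := h1)) => x /andP[x0 xs].
    by apply: dh; move: x0 xs s2 d0; clear; lra.
  rewrite -h10; apply: (nondecreasing_of_deriv x0 (f' := h2)) => y /andP[y0 yx].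
    by apply: dh1; move: y0 yx xs s2 d0; clear; lra.
  by apply: h2ge; move: y0 yx xs s2 d0; clear; lra.
rewrite -lerN2.
apply: (nondecreasing_of_deriv (ltW sn) (f := fun x => - h x) (f' := fun x => - h1 x))
  => x /andP[x0 xs].
  by apply: isdN; apply: dh; move: x0 xs s1 d0; clear; lra.
rewrite oppr_ge0 -h10; apply: (nondecreasing_of_deriv xs (f' := h2)) => y /andP[y0 yx].
  by apply: dh1; move: y0 yx x0 s1 d0; clear; lra.
by apply: h2ge; move: y0 yx x0 s1 d0; clear; lra.
Qed.

(** The right side is [(1 + x) (1 + (r - 1) x)], and the power [r - 1], being below 1, is dominated
    by its tangent line. *)
Lemma powR_interp_le r x : 1 < r < 2 -> 0 <= 1 + x ->
  (1 + x) `^ r <= 1 + r * x + (r - 1) * x ^+ 2 :> R.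
Proof.
move=> /andP[r1 r2] x0; have s0 : 0 < r - 1 by rewrite subr_gt0.
have r0 : 0 < r by exact: lt_trans r1.
rewrite -(mulr_powRB1 x0 r0).
have i1 : 1 < (r - 1)^-1 by rewrite invf_gt1 // ltrBlDr; move: r2; clear; lra.
have := bernoulli_powR i1 (powR_ge0 (1 + x) (r - 1)).
rewrite -powRrM divff ?gt_eqF // powRr1 //.
set v := (1 + x) `^ (r - 1) => h.
have {}h : v <= 1 + (r - 1) * x.
  have := ler_wpM2l (ltW s0) h; rewrite mulrDr mulrA divff ?gt_eqF // mul1r.
  by clear; lra.
have := ler_wpM2l x0 h; clear; lra.
Qed.

Lemma sint_cos : sint (@cos R) = 0.
Proof.
apply: (@sint_deriv_periodic _ sin) => [|x|x]; [exact: continuous_cos|by isd|].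
by rewrite -[2]/(1 + 1) mulrDl mul1r addrA !sinDpi opprK.
Qed.

Lemma sint_sqr_cos : sint (fun x : R => cos x ^+ 2) = 1 / 2.
Proof.
have cc : continuous (@cos R) by exact: continuous_cos.
have cs : continuous (@sin R) by exact: continuous_sin.
have E : sint (fun x : R => cos x ^+ 2 + (- 1) * sin x ^+ 2) = 0.
  apply: (@sint_deriv_periodic _ (fun x => sin x * cos x)) => [|x|x].
  - by cts.
  - by derive; ring.
  - by rewrite -[2]/(1 + 1) mulrDl mul1r addrA !sinDpi !cosDpi !opprK.
have S : sint (fun x : R => cos x ^+ 2 + sin x ^+ 2) = 1.
  by rewrite -[RHS](sint_cst (1 : R)); apply: eq_sint => x; exact: cos2Dsin2.
move: E S; rewrite sintD; [|by cts|by cts]; rewrite sintZ; last by cts.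
rewrite sintD; [|by cts|by cts].
by clear; lra.
Qed.

Lemma sint_trig a0 a1 a2 a3 :
  sint (fun x : R => a0 + a1 * cos x + a2 * cos x ^+ 2 + a3 * sin x ^+ 2) =
  a0 + (a2 + a3) / 2.
Proof.
have cc : continuous (@cos R) by exact: continuous_cos.
rewrite (@eq_sint _ _ (fun x => (a0 + a3) + (a1 * cos x + (a2 - a3) * cos x ^+ 2))); last first.
  by move=> x; rewrite sin2cos2; ring.
rewrite sintD; [|by cts|by cts]; rewrite sint_cst sintD; [|by cts|by cts].
rewrite !sintZ //; last by cts.
by rewrite sint_cos sint_sqr_cos; field.
Qed.

(* [b = 2 a] minimises the second variation [1 + b^2 - 4 a b - mu (2 - p)] of the
   functional at [1] in the direction [cos + i b sin]. *)
Lemma constant_unstable p a mu : 1 < p < 2 -> 0 < a < 1 / 2 -> 0 < mu ->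
  1 < mu * (2 - p) + 4 * a ^+ 2 ->
  exists psi1 g1 psi2 g2, [/\ H1 psi1 g1, H1 psi2 g2, 0 < cplx_L2sq psi1 psi2 &
    cplx_lhs a p mu psi1 g1 psi2 g2 < (a ^+ 2 + mu) * cplx_L2sq psi1 psi2].
Proof.
move=> /andP[p1 p2] /andP[a0 a1] mu0 cond.
pose b := 2 * a.
have b0 : 0 < b by rewrite mulr_gt0.
have b1 : b < 1 by rewrite /b; move: a1; clear; lra.
have b2 : b ^+ 2 < 1 by rewrite expr_lt1 // ltW.
pose D := mu * (2 - p) + 4 * a ^+ 2 - 1.
have D0 : 0 < D by rewrite subr_gt0.
(* The error terms at the end are at most [10 mu e <= D / 2]; the bound 1/8 makes [1 - 8 e]
   nonnegative and [6 e] less than 1. *)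
pose e := Num.min (1 / 8) (D / (20 * mu)).
have e0 : 0 < e by rewrite lt_min divr_gt0 //= divr_gt0 // mulr_gt0.
have e8 : e <= 1 / 8 by rewrite ge_min lexx.
have eD : e * (20 * mu) <= D by rewrite -ler_pdivlMr ?mulr_gt0 // ge_min lexx orbT.
pose psi1 (x : R) := 1 + e * cos x; pose psi2 (x : R) := e * b * sin x.
pose g1 (x : R) := - (e * sin x); pose g2 (x : R) := e * b * cos x.
have cc : continuous (@cos R) by exact: continuous_cos.
have cs : continuous (@sin R) by exact: continuous_sin.
have h1 : H1 psi1 g1.
  apply: H1_C1; [by move=> x; rewrite /psi1 /g1; derive; ring|by rewrite /g1; cts|].
  by move=> x; rewrite /psi1 -[2]/(1 + 1) mulrDl mul1r addrA !cosDpi opprK.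
have h2 : H1 psi2 g2.
  apply: H1_C1; [by move=> x; rewrite /psi2 /g2; derive; ring|by rewrite /g2; cts|].
  by move=> x; rewrite /psi2 -[2]/(1 + 1) mulrDl mul1r addrA !sinDpi opprK.
exists psi1, g1, psi2, g2.
have L : cplx_L2sq psi1 psi2 = 1 + e ^+ 2 * (1 + b ^+ 2) / 2.
  rewrite /cplx_L2sq (@eq_sint _ _ (fun x => 1 + 2 * e * cos x + e ^+ 2 * cos x ^+ 2 +
    (e * b) ^+ 2 * sin x ^+ 2)); last by move=> x; rewrite /psi1 /psi2; ring.
  by rewrite sint_trig; field.
have A : sint (fun x => (g1 x + a * psi2 x) ^+ 2 + (g2 x - a * psi1 x) ^+ 2) =
    a ^+ 2 + e ^+ 2 * ((a * b - 1) ^+ 2 + (b - a) ^+ 2) / 2.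
  rewrite (@eq_sint _ _ (fun x => a ^+ 2 + (- (2 * a * e * (b - a))) * cos x +
    (e * (b - a)) ^+ 2 * cos x ^+ 2 + (e * (a * b - 1)) ^+ 2 * sin x ^+ 2)); last first.
    by move=> x; rewrite /psi1 /psi2 /g1 /g2; ring.
  by rewrite sint_trig; field.
have e2 : 0 < e ^+ 2 by rewrite exprn_gt0.
split => //.
  by rewrite L ltr_pwDl // divr_ge0 // mulr_ge0 ?(ltW e2) // addr_ge0 ?sqr_ge0.
pose q := p / 2.
have q0 : 0 < q by rewrite /q; move: p1; clear; lra.
have q1 : q < 1 by rewrite /q; move: p2; clear; lra.
have q2 : 1 / 2 < q by rewrite /q; move: p1; clear; lra.
(* The coefficient of [e^2] in the squared [p]-norm: [|psi|^2 - 1] has mean [e^2 (1 + b^2) / 2], and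
   its square has mean about [2 e^2]. *)
pose Y := (1 + b ^+ 2) / 2 - (1 - q) * (1 - 8 * e).
have Y1 : -1 <= Y <= 1.
  have f0 : 0 <= 1 - 8 * e <= 1 by move: e8 e0; clear; lra.
  have : 0 <= (1 - q) * (1 - 8 * e) <= 1.
    have /andP[fa fb] := f0; have qa : 0 <= 1 - q by rewrite subr_ge0 ltW.
    have qb : 1 - q <= 1 by rewrite lerBlDr lerDl ltW.
    by rewrite mulr_ge0 // mulr_ile1.
  by have := sqr_ge0 b; rewrite /Y; move: b2; clear; lra.
have cL : continuous (fun x => psi1 x ^+ 2 + psi2 x ^+ 2) by rewrite /psi1 /psi2; cts.
have P1 : sint (fun x => (psi1 x ^+ 2 + psi2 x ^+ 2) `^ q) <= 1 + q * e ^+ 2 * Y.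
  pose G := q * (1 - q) / 2 * (1 - 6 * e).
  have d01 : 0 < 6 * e < 1 by move: e8 e0; clear; lra.
  pose z x := 2 * e * cos x + e ^+ 2 * cos x ^+ 2 + (e * b) ^+ 2 * sin x ^+ 2.
  have zE x : psi1 x ^+ 2 + psi2 x ^+ 2 = 1 + z x by rewrite /psi1 /psi2 /z; ring.
  have m01 x : 0 <= cos x ^+ 2 + b ^+ 2 * sin x ^+ 2 <= 1.
    apply/andP; split; first exact: addr_ge0 (sqr_ge0 _) (mulr_ge0 (sqr_ge0 _) (sqr_ge0 _)).
    rewrite -(cos2Dsin2 x) lerD2l.
    by rewrite ler_piMl ?sqr_ge0 // ltW.
  have c1 (x : R) : -1 <= cos x <= 1 by rewrite cos_geN1 cos_le1.
  have zm x : z x = 2 * e * cos x + e ^+ 2 * (cos x ^+ 2 + b ^+ 2 * sin x ^+ 2).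
    by rewrite /z; ring.
  have ee : e ^+ 2 <= e by rewrite expr2 ger_pMr //; move: e8; clear; lra.
  have zb x : `|z x| <= 6 * e / 2.
    rewrite zm; have /andP[m0 m1] := m01 x; have /andP[x0 x1] := c1 x.
    move: (cos x ^+ 2 + _) m0 m1 => m m0 m1.
    have := ler_wpM2l (ltW e0) x0; have := ler_wpM2l (ltW e0) x1.
    have := ler_wpM2l (ltW e2) m0; have := ler_wpM2l (ltW e2) m1.
    by rewrite ler_norml; move: ee e0; clear; lra.
  have z2 x : 4 * e ^+ 2 * cos x ^+ 2 - 4 * e ^+ 3 <= z x ^+ 2.
    rewrite zm; have /andP[m0 m1] := m01 x; have /andP[x0 x1] := c1 x.
    move: (cos x ^+ 2 + _) m0 m1 => m m0 m1.
    have : - 1 <= cos x * m by move: (cos x) x0 x1 => c x0 x1; nra.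
    have e3 : 0 <= 4 * e ^+ 3 by rewrite mulr_ge0 // exprn_ge0 // ltW.
    move=> /(ler_wpM2l e3); have := sqr_ge0 (e ^+ 2 * m).
    by clear; lra.
  have qa : 0 <= 1 - q by rewrite subr_ge0 ltW.
  have G0 : 0 <= G.
    have da : 0 <= 1 - 6 * e by rewrite subr_ge0 ltW //; case/andP: d01.
    exact: mulr_ge0 (divr_ge0 (mulr_ge0 (ltW q0) qa) (ler0n R 2)) da.
  apply: (@le_trans _ _ (sint (fun x => (1 + 4 * G * e ^+ 3) + (2 * q * e) * cos x +
      (q * e ^+ 2 - 4 * G * e ^+ 2) * cos x ^+ 2 + (q * (e * b) ^+ 2) * sin x ^+ 2))).
    apply: le_sint => [||x _].
    - by cts => // x; rewrite addr_ge0 ?sqr_ge0.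
    - by cts.
    rewrite zE; have q01 : 0 < q < 1 by rewrite q0.
    apply: (le_trans (powR_second_order_le q01 d01 (zb x))); rewrite -/G.
    have zq : q * z x = q * (2 * e * cos x + e ^+ 2 * cos x ^+ 2 + (e * b) ^+ 2 * sin x ^+ 2) by [].
    by move: (ler_wpM2l G0 (z2 x)) zq; move: (z x) => y; clear; lra.
  rewrite sint_trig.
  (* The factor [1 - 6 e] of the Taylor bound and the factor [1 - 2 e] from [z2] multiply to at
     least [1 - 8 e]. *)
  have GG : (1 - q) * q * (1 - 8 * e) * e ^+ 2 <= 2 * G * e ^+ 2 - 4 * G * e ^+ 3.
    rewrite -subr_ge0 (_ : _ - _ = q * (1 - q) * e ^+ 4 * 12); last by rewrite /G; field.
    exact: mulr_ge0 (mulr_ge0 (mulr_ge0 (ltW q0) qa) (exprn_ge0 4 (ltW e0))) (ler0n R 12).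
  by move: GG; rewrite /Y; clear; lra.
have sint0 : 0 <= sint (fun x => (psi1 x ^+ 2 + psi2 x ^+ 2) `^ q).
  apply: sint_ge0 => [|x]; last exact: powR_ge0.
  by cts => // x; rewrite addr_ge0 ?sqr_ge0.
have r12 : 1 < 2 / p < 2.
  have p0 : 0 < p by exact: lt_trans p1.
  by rewrite ltr_pdivlMr // ltr_pdivrMr // mul1r p2 ltr_pMr.
pose X := q * e ^+ 2 * Y.
have X0 : 0 <= 1 + X := le_trans sint0 P1.
have P2 : (sint (fun x => (psi1 x ^+ 2 + psi2 x ^+ 2) `^ q)) `^ (2 / p) <=
    1 + e ^+ 2 * Y + e ^+ 4.
  have r0 : 0 <= 2 / p by case/andP: r12 => h _; exact: ltW (lt_trans ltr01 h).
  apply: (@le_trans _ _ ((1 + X) `^ (2 / p))).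
    by apply: ge0_ler_powR r0 _ _ _ _ P1; rewrite nnegrE.
  apply: (le_trans (powR_interp_le r12 X0)).
  rewrite (_ : 2 / p * X = e ^+ 2 * Y); last first.
    by rewrite /X /q; field; rewrite gt_eqF // (lt_trans ltr01).
  rewrite lerD2l (_ : _ * X ^+ 2 = (1 - q) * q * Y ^+ 2 * e ^+ 4); last first.
    by rewrite /X /q; field; rewrite gt_eqF // (lt_trans ltr01).
  rewrite ler_piMl ?exprn_ge0 ?(ltW e0) //.
  have Y2 : Y ^+ 2 <= 1 by rewrite -real_normK ?num_real // exprn_ile1 // ler_norml.
  have qa : 0 <= 1 - q by rewrite subr_ge0 ltW.
  have qb : 1 - q <= 1 by rewrite lerBlDr lerDl ltW.
  have qq : (1 - q) * q <= 1 := mulr_ile1 qa (ltW q0) qb (ltW q1).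
  exact: mulr_ile1 (mulr_ge0 qa (ltW q0)) (sqr_ge0 Y) qq Y2.
rewrite /cplx_lhs A L -/q.
apply: (le_lt_trans (lerD (lexx _) (ler_wpM2l (ltW mu0) P2))).
(* [- D] is the second variation at [b = 2 a]; the two other terms are the loss in [Y] and the
   quartic remainder of [P2]. *)
rewrite -subr_gt0 (_ : _ - _ = e ^+ 2 / 2 * (D - 8 * e * mu * (2 - p) - 2 * mu * e ^+ 2)); last first.
  by rewrite /Y /D /q /b; field.
rewrite mulr_gt0 ?divr_gt0 //.
have m0 : 0 < mu * e by rewrite mulr_gt0.
have h3 : mu * e * (2 - p) <= mu * e by rewrite ger_pMr //; move: p1; clear; lra.
have h4 : mu * e * e <= mu * e by rewrite ger_pMr //; move: e8; clear; lra.
by move: eD m0 h3 h4; clear; lra.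
Qed.

End Instability.

(** * The optimal constant and the conclusion *)

Section OptimalConstant.
Variable R : realType.
Implicit Types (p a mu c : R).

Definition magnetic_constants a p mu : set R :=
  [set c : R | forall psi1 g1 psi2 g2, H1 psi1 g1 -> H1 psi2 g2 ->
     cplx_lhs a p mu psi1 g1 psi2 g2 >= c * cplx_L2sq psi1 psi2].

Lemma H1_cst c : H1 (fun _ : R => c) (fun _ : R => 0).
Proof. by apply: H1_C1 => [x||//]; [exact: isdC|exact: ctsC]. Qed.

(** Tested on the constant function 1. *)
Lemma magnetic_constants_ub a p mu c : 0 < p ->
  magnetic_constants a p mu c -> c <= a ^+ 2 + mu.
Proof.
move=> p0 /(_ _ _ _ _ (H1_cst 1) (H1_cst 0)); rewrite /cplx_lhs /cplx_L2sq.
rewrite expr1n expr0n addr0 powR1 !sint_cst powR1 mulr1 mulr0 addr0 expr0n.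
by rewrite add0r mulr1 sub0r sqrrN mulr1.
Qed.

(** A witness of nonemptiness: together with the upper bound it makes the [sup] in [lambda_ap] a
    genuine supremum and not a default value. *)
Lemma magnetic_constants0 a p mu : 0 < mu -> magnetic_constants a p mu 0.
Proof.
move=> mu0 psi1 g1 psi2 g2 _ _; rewrite mul0r /cplx_lhs.
apply: addr_ge0; last by rewrite mulr_ge0 ?powR_ge0 // ltW.
rewrite /sint mulr_ge0 ?invr_ge0 ?(ltW (twopi_gt0 R)) // fine_ge0 //.
by apply: integral_ge0 => x _; rewrite lee_fin addr_ge0 ?sqr_ge0.
Qed.

Lemma real_lhs_cst a p mu c : 0 < p -> c != 0 ->
  real_lhs a p mu (fun=> c) (fun=> 0) = (a ^+ 2 + mu) * L2sq (fun=> c).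
Proof.
move=> p0 c0; rewrite /real_lhs invL2E //; last exact: ctsC.
rewrite /L2sq /Lpsq !sint_cst invrK sqr_powR ?normr_ge0 ?gt_eqF //.
by rewrite real_normK ?num_real //; ring.
Qed.

End OptimalConstant.

Theorem theorem3p5 (R : realType) (p a mu : R) :
  1 < p < 2 -> 0 < a < 1 / 2 -> 0 < mu ->
  (mu * (2 - p) + 4 * a ^+ 2 <= 1 ->
     lambda_ap a p mu = a ^+ 2 + mu /\
     (forall u g : R -> R, H1 u g -> (exists x, u x != 0) ->
        real_lhs a p mu u g = lambda_ap a p mu * L2sq u ->
        exists c : R, forall x, u x = c)) /\
  (1 < mu * (2 - p) + 4 * a ^+ 2 ->
     lambda_ap a p mu < a ^+ 2 + mu /\
     (forall c : R, c != 0 ->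
        real_lhs a p mu (fun _ => c) (fun _ => 0)
          != lambda_ap a p mu * L2sq (fun _ : R => c))).
Proof.
move=> p12 a01 mu0; have /andP[p1 p2] := p12.
have p0 : 0 < p by exact: lt_trans p1.
have ub : ubound (magnetic_constants a p mu) (a ^+ 2 + mu).
  by move=> c; exact: magnetic_constants_ub.
have S0 := magnetic_constants0 a p mu0.
split=> [cond|cond].
  have lam : lambda_ap a p mu = a ^+ 2 + mu.
    apply/eqP; rewrite eq_le; apply/andP; split.
      by apply: ge_sup => //; exists 0.
    apply: ub_le_sup; first by exists (a ^+ 2 + mu).
    by move=> *; exact: magnetic_interpolation.
  split=> // u g h [x0 ux0]; rewrite lam /real_lhs => eqn.
  (* Subtracting [a^2] times the inverse-square inequality from the equality leaves at least
     [(1 - 4 a^2)] times the energy on the side of the entropy; below the threshold [|u|] therefore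
     saturates Beckner's inequality. *)
  have ext : (2 - p) * L2sq g <= entp p (fun x => `|u x|).
    rewrite entp_abs -(ler_pM2l mu0) mulrA.
    have F0 : 0 <= L2sq g by exact: sint_sqr_ge0.
    have := ler_wpM2l (sqr_ge0 a) (inverse_square_ineq_H1 h).
    have c1 : mu * (2 - p) <= 1 - 4 * a ^+ 2 by move: cond; clear; lra.
    have := ler_wpM2r F0 c1; move: eqn.
    by move: (L2sq g) (invL2 u) (L2sq u) (Lpsq p u); clear => F I L P; lra.
  have [c uc] := abs_constant p12 h ext.
  exists (u 0); apply: constant_of_abs uc.
  exact: primitive_L2_continuous (H1_primitive_L2 h).
have lt : lambda_ap a p mu < a ^+ 2 + mu.
  have [psi1 [g1 [psi2 [g2 [h1 h2 L0 lt]]]]] := constant_unstable p12 a01 mu0 cond.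
  (* Every admissible constant is at most the quotient of the unstable test function, so the
     supremum is too, and the strict inequality survives. *)
  move: lt; rewrite -ltr_pdivrMr //; apply: le_lt_trans.
  apply: ge_sup; first by exists 0.
  by move=> c Sc; rewrite ler_pdivlMr //; exact: Sc.
split=> // c c0; rewrite real_lhs_cst //.
have c2 : 0 < L2sq (fun=> c) by rewrite /L2sq sint_cst exprn_even_gt0 //= c0.
(* Equality at a nonzero constant would force the optimal constant to be [a^2 + mu]. *)
by apply/eqP => /(mulIf (lt0r_neq0 c2)) E; move: lt; rewrite -E ltxx.
Qed.
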